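(* An operator $X\in\mathcal B(H^2(S_\Omega))$ is a Toeplitz operator (i.e. $X=T_\phi$ for some $\phi\in L^\infty(S_\Omega)$) if and only if \[\sum_\alpha\psi^{(\ell)}_\alpha(\boldsymbol T_z)^*X\psi^{(\ell)}_\alpha(\boldsymbol T_z)=\binom{r}{\ell}X\quad\text{for all }1\le\ell\le r.\]
   Context: Let $\Omega\subset\mathbb C^d$ be a classical (irreducible) Cartan domain of rank $r$ in its Harish-Chandra realization, with $\mathbb K$ the stabilizer of $0$ in the identity component of $\mathrm{Aut}(\Omega)$ (linear maps), polar decomposition $z=k\cdot\sum_jt_je_j$ (Jordan frame $e_1,\dots,e_r$, singular numbers $t_1\ge\dots\ge t_r\ge0$), and Shilov boundary $S_\Omega=\{k\cdot(e_1+\dots+e_r):k\in\mathbb K\}$ with its unique $\mathbb K$-invariant probability measure $dz$. The Jordan triple determinant $\Delta(z,w)$ is the unique $\mathbb K$-invariant sesqui-analytic polynomial with $\Delta(z,z)=\prod_j(1-t_j^2)$; write $\Delta=\sum_{\ell=0}^r(-1)^\ell\Delta^{(\ell)}$ with $\Delta^{(\ell)}$ homogeneous of bidegree $(\ell,\ell)$, and $\Delta^{(\ell)}(z,w)=\sum_\alpha\psi^{(\ell)}_\alpha(z)\overline{\psi^{(\ell)}_\alpha(w)}$ for finitely many homogeneous polynomials $\psi^{(\ell)}_\alpha$ of degree $\ell$ (a scaled orthogonal basis of the $\mathbb K$-irreducible polynomial subspace of signature $(1,\dots,1,0,\dots,0)$ with $\ell$ ones); $\Delta^{(1)}(z,w)=\sum_iz_i\bar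 w_i$. $H^2(S_\Omega)$ is the Hardy space (closure of polynomials in $L^2(S_\Omega,dz)$), $P_{H^2(S_\Omega)}$ the Szegő projection, and for $\phi\in L^\infty(S_\Omega)$ the Toeplitz operator is $T_\phi h=P_{H^2(S_\Omega)}(\phi h)$. $\boldsymbol T_z=(T_{z_1},\dots,T_{z_d})$ is the Szegő shift (multiplication by coordinates on $H^2(S_\Omega)$). *)

(* Defs.v *)
From HB Require Import structures.
From mathcomp Require Import all_boot all_order all_algebra.
From mathcomp Require Import all_classical all_reals all_analysis.
From mathcomp Require Import complex.
Set Implicit Arguments. Unset Strict Implicit. Unset Printing Implicit Defensive.
Import Order.TTheory GRing.Theory Num.Theory.
Import numFieldNormedType.Exports.
Local Open Scope ring_scope.
Local Open Scope classical_set_scope.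

(* The classical (irreducible) Cartan domains, in their standard       *)
(* Harish-Chandra realizations as spaces of matrices:                  *)
(*   CI n m   : I_{n,m}, all n x m matrices, 1 <= n <= m, rank n       *)
(*   CII n    : II_n, symmetric n x n matrices, n >= 1, rank n         *)
(*   CIII n   : III_n, antisymmetric n x n matrices, n >= 2, rank n/2  *)
(*   CIV n    : IV_n, Lie ball in C^n (row vectors 1 x n), n >= 3,     *)
(*              rank 2                                                 *)
Inductive cartan := CI of nat & nat | CII of nat | CIII of nat | CIV of nat.

Definition cartan_valid (D : cartan) : Prop :=
  match D with
  | CI n m => (1 <= n /\ n <= m)%N
  | CII n => (1 <= n)%N
  | CIII n => (2 <= n)%N
  | CIV n => (3 <= n)%N
  end.

Definition cp (D : cartan) : nat :=
  match D with CI n _ => n | CII n => n | CIII n => n | CIV _ => 1%N end.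
Definition cq (D : cartan) : nat :=
  match D with CI _ m => m | CII n => n | CIII n => n | CIV n => n end.

Definition crank (D : cartan) : nat :=
  match D with CI n _ => n | CII n => n | CIII n => n./2 | CIV _ => 2%N end.

Section Domain.
Variable R : realType.
Local Notation C := R[i].

Definition cmx (D : cartan) := 'M[C]_(cp D, cq D).

Definition adjmx m n (A : 'M[C]_(m, n)) : 'M[C]_(n, m) :=
  (map_mx (@conjc R) A)^T.

Definition unitary n (u : 'M[C]_n) : Prop := u *m adjmx u = 1%:M.

Definition rcast n (o : 'M[R]_n) : 'M[C]_n := map_mx (fun x => Complex x 0) o.

(* the underlying complex vector space V (as a subspace of the ambient
   matrix space) *)
Definition inV (D : cartan) : cmx D -> Prop :=
  match D as D0 return cmx D0 -> Prop with
  | CI n m => fun _ => True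
  | CII n => fun z => z^T = z
  | CIII n => fun z => z^T = - z
  | CIV n => fun _ => True
  end.

(* K : the identity component of the stabilizer of 0 in Aut(Omega) *)
Definition inK (D : cartan) : (cmx D -> cmx D) -> Prop :=
  match D as D0 return (cmx D0 -> cmx D0) -> Prop with
  | CI n m => fun k => exists (u : 'M[C]_n) (v : 'M[C]_m),
      unitary u /\ unitary v /\ k = (fun z => u *m z *m v)
  | CII n => fun k => exists (u : 'M[C]_n),
      unitary u /\ k = (fun z => u *m z *m u^T)
  | CIII n => fun k => exists (u : 'M[C]_n),
      unitary u /\ k = (fun z => u *m z *m u^T)
  | CIV n => fun k => exists (c : C) (o : 'M[R]_n),
      c * conjc c = 1 /\ o *m o^T = 1%:M /\ \det o = 1 /\
      k = (fun z => c *: (z *m (rcast o)^T))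
  end.

(* e = e_1 + ... + e_r, the sum of a Jordan frame *)
Definition frame_sum (D : cartan) : cmx D :=
  match D as D0 return cmx D0 with
  | CI n m => \matrix_(i < n, j < m) (if (i == j :> nat) then 1 else 0)
  | CII n => 1%:M
  | CIII n => \matrix_(i < n, j < n)
      (if (~~ odd i) && (j == i.+1 :> nat) then 1
       else if (~~ odd j) && (i == j.+1 :> nat) then -1 else 0)
  | CIV n => \matrix_(i < 1, j < n) (if (j == 0%N :> nat) then 1 else 0)
  end.

Definition shilov (D : cartan) : set (cmx D) :=
  [set z | exists k, inK k /\ z = k (frame_sum D)].

(* The Jordan triple determinant, packaged as the polynomial
   lambda |-> Delta(lambda z, w) in {poly C}. *)
Definition det1mx n (A : 'M[C]_n) : {poly C} :=
  \det (1%:M - 'X *: map_mx polyC A).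

Definition jdelta_poly (D : cartan) : cmx D -> cmx D -> {poly C} :=
  match D as D0 return cmx D0 -> cmx D0 -> {poly C} with
  | CI n m => fun z w => det1mx (z *m adjmx w)
  | CII n => fun z w => det1mx (z *m adjmx w)
  | CIII n => fun z w =>
      (* the unique polynomial P with P(0) = 1 and P^2 = det(1 - lambda z w^* ) *)
      xget 0 [set P : {poly C} | P.[0] = 1 /\ P ^+ 2 = det1mx (z *m adjmx w)]
  | CIV n => fun z w =>
      let zw := (z *m adjmx w) 0 0 in
      let zz := (z *m z^T) 0 0 in
      let ww := (w *m w^T) 0 0 in
      1 - (2 * zw) *: 'X + (zz * conjc ww) *: 'X ^+ 2
  end.

Definition jdelta (D : cartan) (z w : cmx D) : C := (jdelta_poly z w).[1].

(* Delta^{(l)}(z, w): Delta = sum_l (-1)^l Delta^{(l)} with Delta^{(l)} of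
   bidegree (l, l), i.e. Delta(lambda z, w) = sum_l (-lambda)^l Delta^{(l)}(z,w). *)
Definition jdelta_l (D : cartan) (l : nat) (z w : cmx D) : C :=
  (-1) ^+ l * (jdelta_poly z w)`_l.

Inductive is_polyfun (D : cartan) : (cmx D -> C) -> Prop :=
  | pf_const (c : C) : is_polyfun (fun _ => c)
  | pf_coord (i : 'I_(cp D)) (j : 'I_(cq D)) : is_polyfun (fun z => z i j)
  | pf_add f g : is_polyfun f -> is_polyfun g -> is_polyfun (fun z => f z + g z)
  | pf_mul f g : is_polyfun f -> is_polyfun g -> is_polyfun (fun z => f z * g z).

Definition homog_poly (D : cartan) (l : nat) (f : cmx D -> C) : Prop :=
  is_polyfun f /\ forall (c : C) (z : cmx D), inV z -> f (c *: z) = c ^+ l * f z.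

End Domain.

Section Measure.
Variable R : realType.
Local Notation C := R[i].
Variable D : cartan.

HB.instance Definition _ := Choice.on (cmx R D).
HB.instance Definition _ := isPointed.Build (cmx R D) 0.

Definition borel_gen : set (set (cmx R D)) :=
  [set A | exists (i : 'I_(cp D)) (j : 'I_(cq D)) (B : set R), measurable B /\
     (A = [set z : cmx R D | B (complex.Re (z i j))] \/
      A = [set z : cmx R D | B (complex.Im (z i j))])].

Definition Cspace := g_sigma_algebraType borel_gen.
End Measure.

Section Hardy.
Variable R : realType.
Local Notation C := R[i].
Variable D : cartan.
Local Notation T := (Cspace R D).
Variable mu : probability T R.

Definition cabs2 (z : C) : R := complex.Re z ^+ 2 + complex.Im z ^+ 2.

Definition cmeasurable (f : T -> C) : Prop :=
  measurable_fun setT (fun x => complex.Re (f x)) /\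
  measurable_fun setT (fun x => complex.Im (f x)).

(* complex integral over S_Omega (mu is concentrated on S_Omega) *)
Definition cint (f : T -> C) : C :=
  Complex (Rintegral mu setT (fun x => complex.Re (f x)))
          (Rintegral mu setT (fun x => complex.Im (f x))).

Definition inner (f g : T -> C) : C := cint (fun x => f x * conjc (g x)).

Definition norm2 (f : T -> C) : R := Rintegral mu setT (fun x => cabs2 (f x)).

Definition isL2 (f : T -> C) : Prop :=
  cmeasurable f /\ (\int[mu]_x (cabs2 (f x))%:E < +oo)%E.

Definition isLinf (phi : T -> C) : Prop :=
  cmeasurable phi /\ exists c : R, {ae mu, forall x, cabs2 (phi x) <= c}.

Definition ae_eq (f g : T -> C) : Prop := {ae mu, forall x, f x = g x}.

Definition isH2 (f : T -> C) : Prop :=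
  isL2 f /\ exists P : nat -> (T -> C), (forall n, is_polyfun (P n)) /\
    (fun n : nat => norm2 (fun x => f x - P n x)) @ \oo --> (0 : R).

(* bounded linear operators on H^2 (acting on representatives; H^2 is a
   space of a.e.-classes) *)
Definition bounded_op_H2 (X : (T -> C) -> (T -> C)) : Prop :=
  (forall f, isH2 f -> isH2 (X f)) /\
  (forall f g, isH2 f -> isH2 g -> ae_eq f g -> ae_eq (X f) (X g)) /\
  (forall (a : C) f g, isH2 f -> isH2 g ->
      ae_eq (X (fun x => a * f x + g x)) (fun x => a * X f x + X g x)) /\
  (exists c : R, forall f, isH2 f -> norm2 (X f) <= c * norm2 f).

Definition szego_proj (g h : T -> C) : Prop :=
  isH2 h /\ forall k, isH2 k -> inner (fun x => g x - h x) k = 0.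

Definition is_toeplitz (X : (T -> C) -> (T -> C)) : Prop :=
  exists phi, isLinf phi /\
    forall f, isH2 f -> szego_proj (fun x => phi x * f x) (X f).

End Hardy.

(* Main.v *)
Require Import Defs.
From HB Require Import structures.
From mathcomp Require Import all_boot all_order all_algebra.
From mathcomp Require Import all_classical all_reals all_analysis.
From mathcomp Require Import measurable_realfun complex.
From mathcomp Require Import zify ring lra.
Import Order.TTheory GRing.Theory Num.Theory.
Import numFieldNormedType.Exports.
Local Open Scope ring_scope.
Local Open Scope classical_set_scope.
Set Implicit Arguments. Unset Strict Implicit. Unset Printing Implicit Defensive.

(** Only the identity for [l = 1] is needed in the converse. On the Shilov
    boundary the functions [A_i = psi_i / sqrt r] of degree one satisfy
    [\sum_i |A_i|^2 = 1] and span the coordinates, and the form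
    [B f g = <X f, g>] satisfies [\sum_i B (A_i f) (A_i g) = B f g]. For a word
    [a] of length [n] in the [A_i], let [U] be its formal derivative in the
    letter [A_i]; over all words, [\sum |U / n - conj A_i * a|^2 = (1 - |A_i|^2) / n].
    Hence every trigonometric polynomial [t = \sum u * conj v] is approximated by
    analytic families, [p ~ t * a] with [\sum |a|^2 = 1], along which
    [Lam t := \sum B u v] is preserved. The boundedness of [X] then yields
    [|Lam (t1 * conj t2)| <= c * ||t1|| * ||t2||] in [L^2] (in AM-GM form), so [Lam]
    extends to a bounded functional on [L^2], is dominated on indicators by a
    multiple of [mu], and Radon-Nikodym provides the bounded symbol.

    The indicators of measurable sets are [L^2]-limits of trigonometric polynomials.
    The Shilov boundary is the image of a compact set of unitary matrices under a
    polynomial map, so it is Borel; this is needed to make sense of [mu] being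
    concentrated on it. On it the kernels [jdelta_l] are the coefficients of
    [(1 - X)^r], which gives the direct implication. *)


(** The obstacle is that [B] takes only analytic arguments: for [t = \sum u * conj v], bounding
    [Lam t] term by term involves the norms of the [u] and [v], not that of [t]. With analytic [p]
    close to [t * a], the sum [\sum B p a] is controlled by [\sum |p|^2], comparable to [|t|^2], and
    still equals [Lam t] exactly. The derivative enters because the words of length [n] form a unit
    vector at each point of the boundary, whose inner product with the vector of derivatives is
    [n * conj A_i] by the Leibniz rule; so [conj A_i * a] is the orthogonal projection of [U / n].
    Continuity in [L^2] alone would only give a symbol in [L^2]. Its boundedness comes from the
    product form of the estimate: for [h] close to the indicator of [E], [Lam (h^2)] is at most a
    multiple of [||h||^2], hence of the measure of [E]. Estimates read [s * x + s^-1 * y] for every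
    [s > 0]: unlike a product of norms, this is additive over families. Real and imaginary parts of
    [Lam] are treated separately, on real-valued functions. *)

Section BoundedFunctions.
Context d (T : measurableType d) (R : realType) (mu : probability T R).
Implicit Types f g : T -> R.
Local Notation I f := (Rintegral mu setT f).

Definition intgr f := mu.-integrable setT (EFin \o f).

(** The bound is only almost everywhere because polynomials on the ambient matrix space are bounded
    on the Shilov boundary but not off it. *)
Definition bddm f := measurable_fun setT f /\ exists c : R, {ae mu, forall x, `|f x| <= c}.

Lemma bddm_intgr f : bddm f -> intgr f.
Proof.
move=> [mf [c fc]]; apply/integrableP; split; first exact/measurable_EFinP.
have mE : measurable_fun setT (fun x => (`|f x|)%:E).
  by apply/measurable_EFinP; exact: measurableT_comp.
apply: (@le_lt_trans _ _ (\int[mu]_x (`|c|%:E)%E)%E); last first.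
  by rewrite integral_cst //= probability_setT mule1 ltry.
apply: ae_ge0_le_integral => //=.
apply: filterS fc => x fx _; rewrite lee_fin.
exact: le_trans fx (ler_norm _).
Qed.

Lemma intgrD f g : intgr f -> intgr g -> intgr (fun x => f x + g x).
Proof.
move=> hf hg.
rewrite /intgr (_ : EFin \o _ = (fun x => (EFin \o f) x + (EFin \o g) x)%E) //.
exact: integrableD.
Qed.

Lemma intgrZ c f : intgr f -> intgr (fun x => c * f x).
Proof.
move=> hf.
rewrite /intgr (_ : EFin \o _ = (fun x => c%:E * (EFin \o f) x)%E) //.
exact: integrableZl.
Qed.

Lemma intgr_dom f g : measurable_fun setT f -> intgr g ->
  {ae mu, forall x, `|f x| <= g x} -> intgr f.
Proof.
move=> mf /integrableP[mg ig] fg; apply/integrableP; split.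
  exact/measurable_EFinP.
apply: le_lt_trans ig; apply: ae_ge0_le_integral => //=.
- have h : measurable_fun setT (fun x => `|f x|) by exact: measurableT_comp.
  exact/measurable_EFinP.
- have h : measurable_fun setT (fun x => `|g x|).
    by apply: measurableT_comp => //; exact/measurable_EFinP.
  exact/measurable_EFinP.
- apply: filterS fg => x fx _; rewrite lee_fin; exact: le_trans fx (ler_norm _).
Qed.

Lemma ae_eq_Rint f g : measurable_fun setT f -> measurable_fun setT g ->
  {ae mu, forall x, f x = g x} -> I f = I g.
Proof.
move=> mf mg fg; rewrite /Rintegral; congr fine.
apply: ae_eq_integral => //; [exact/measurable_EFinP|exact/measurable_EFinP|].
by apply: filterS fg => x /= -> _.
Qed.

Lemma RintD f g : intgr f -> intgr g -> I (fun x => f x + g x) = I f + I g.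
Proof. by move=> hf hg; rewrite -RintegralD. Qed.

Lemma RintZ c f : intgr f -> I (fun x => c * f x) = c * I f.
Proof. by move=> hf; rewrite -RintegralZl. Qed.

Lemma Rint_cst c : I (fun=> c) = c.
Proof. by rewrite Rintegral_cst //= probability_setT /= mulr1. Qed.

Lemma intgr_meas f : intgr f -> measurable_fun setT f.
Proof. by case/integrableP => /measurable_EFinP. Qed.

Lemma ae_ge0_Rint f : intgr f -> {ae mu, forall x, 0 <= f x} -> 0 <= I f.
Proof.
move=> hf f0; have mf := intgr_meas hf.
rewrite (@ae_eq_Rint f (fun x => `|f x|)) //.
- by apply: Rintegral_ge0.
- exact: measurableT_comp.
- by apply: filterS f0 => x fx; rewrite ger0_norm.
Qed.

Lemma ae_le_Rint f g : intgr f -> intgr g -> {ae mu, forall x, f x <= g x} ->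
  I f <= I g.
Proof.
move=> hf hg fg; rewrite -subr_ge0.
have hf' := intgrZ (-1) hf.
rewrite -mulN1r -RintZ // -RintD //; apply: ae_ge0_Rint; first exact: intgrD.
by apply: filterS fg => x fx; rewrite mulN1r subr_ge0.
Qed.

Lemma bddm_cst c : bddm (fun=> c).
Proof. by split; [exact: measurable_cst|exists `|c|; exact: aeW]. Qed.

Lemma bddmD f g : bddm f -> bddm g -> bddm (fun x => f x + g x).
Proof.
move=> [mf [c fc]] [mg [c' gc]]; split; first exact: measurable_funD.
exists (c + c'); apply: filterS2 fc gc => x fx gx.
by apply: le_trans (ler_normD _ _) _; exact: lerD.
Qed.

Lemma bddmM f g : bddm f -> bddm g -> bddm (fun x => f x * g x).
Proof.
move=> [mf [c fc]] [mg [c' gc]]; split; first exact: measurable_funM.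
exists (c * c'); apply: filterS2 fc gc => x fx gx.
by rewrite normrM ler_pM.
Qed.

Lemma bddmZ c f : bddm f -> bddm (fun x => c * f x).
Proof. by move=> hf; apply: bddmM => //; exact: bddm_cst. Qed.

Lemma bddmB f g : bddm f -> bddm g -> bddm (fun x => f x - g x).
Proof.
move=> hf /(bddmZ (-1)) hg; rewrite (_ : (fun _ => _) = fun x => f x + (-1) * g x).
  exact: bddmD.
by apply/funext => x; rewrite mulN1r.
Qed.

Lemma bddm_sqr f : bddm f -> bddm (fun x => f x ^+ 2).
Proof. by move=> hf; exact: bddmM. Qed.

Lemma bddm_indic A : measurable A -> bddm (\1_A : T -> R).
Proof.
move=> mA; split; first exact: measurable_indic.
exists 1; apply: aeW => x; rewrite indicE; case: (_ \in _) => /=; rewrite ?normr1 ?normr0 //.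
Qed.

Lemma Rint_indic A : measurable A -> I (\1_A : T -> R) = fine (mu A).
Proof. by move=> mA; rewrite /Rintegral integral_indic // setIT. Qed.

Lemma bddm_sum (J : Type) (s : seq J) (F : J -> T -> R) :
  (forall j, bddm (F j)) -> bddm (fun x => \sum_(j <- s) F j x).
Proof.
move=> hF; elim: s => [|j s IH].
  rewrite (_ : (fun _ => _) = fun=> 0); first exact: bddm_cst.
  by apply/funext => x; rewrite big_nil.
rewrite (_ : (fun _ => _) = fun x => F j x + \sum_(j <- s) F j x).
  exact: bddmD.
by apply/funext => x; rewrite big_cons.
Qed.

Lemma Rint_sum (J : Type) (s : seq J) (F : J -> T -> R) :
  (forall j, bddm (F j)) -> I (fun x => \sum_(j <- s) F j x) = \sum_(j <- s) I (F j).
Proof.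
move=> hF; elim: s => [|j s IH].
  rewrite big_nil (_ : (fun _ => _) = fun=> 0) ?Rint_cst //.
  by apply/funext => x; rewrite big_nil.
rewrite big_cons -IH -RintD //; do ?exact: bddm_intgr.
  by congr Rintegral; apply/funext => x; rewrite big_cons.
by apply: bddm_intgr; exact: bddm_sum.
Qed.

Lemma Rint_sqr_ge0 f : 0 <= I (fun x => f x ^+ 2).
Proof. by apply: Rintegral_ge0 => x _; exact: sqr_ge0. Qed.

End BoundedFunctions.

Lemma eq0_norm_le_eps (R : realFieldType) (K x : R) : 0 <= K ->
  (forall s : R, 0 < s -> `|x| <= K * s) -> x = 0.
Proof.
move=> K0 H; apply/eqP; rewrite -normr_eq0 eq_le normr_ge0 andbT.
apply/ler_addgt0Pl => e e0; rewrite addr0.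
have K1 : 0 < K + 1 by lra.
apply: le_trans (H (e / (K + 1)) _) _; first exact: divr_gt0.
by rewrite mulrCA -[leRHS]mulr1 ler_pM2l // ler_pdivrMr //; lra.
Qed.

(** * Extension of a densely defined [L^2]-bounded functional *)

Section Extension.
Context d (T : measurableType d) (R : realType) (mu : probability T R).
Implicit Types f g h : T -> R.
Local Notation I f := (Rintegral mu setT f).
Local Notation n2 f := (Rintegral mu setT (fun x => f x ^+ 2)).

Lemma n2D f g : bddm mu f -> bddm mu g ->
  n2 (fun x => f x + g x) <= 2 * n2 f + 2 * n2 g.
Proof.
move=> bf bg; have Bf := bddm_intgr (bddm_sqr bf).
have Bg := bddm_intgr (bddm_sqr bg).
rewrite -!RintZ // -RintD; do ?exact: intgrZ.
apply: ae_le_Rint.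
- by apply: bddm_intgr; apply: bddm_sqr; exact: bddmD.
- by apply: intgrD; exact: intgrZ.
- apply: aeW => x; have := sqr_ge0 (f x - g x); lra.
Qed.

Lemma n2Z c f : bddm mu f -> n2 (fun x => c * f x) = c ^+ 2 * n2 f.
Proof.
move=> bf; rewrite -RintZ; last exact/bddm_intgr/bddm_sqr.
by congr Rintegral; apply/funext => x; rewrite exprMn.
Qed.

Lemma n2_sub3 f g h : bddm mu f -> bddm mu g -> bddm mu h ->
  n2 (fun x => f x - g x) <= 2 * n2 (fun x => f x - h x) + 2 * n2 (fun x => g x - h x).
Proof.
move=> bf bg bh; have B1 := bddmB bf bh; have B2 := bddmB bg bh.
have B3 := bddmZ (-1) B2.
have := n2D B1 B3; rewrite n2Z // sqrrN expr1n mul1r; apply: le_trans.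
rewrite le_eqVlt; apply/orP; left; apply/eqP; congr Rintegral.
by apply/funext => x; congr (_ ^+ 2); lra.
Qed.

Variables (LR : (T -> R) -> R -> Prop) (M : R).
Hypothesis M0 : 0 < M.
Hypothesis LRb : forall h y, LR h y -> bddm mu h.
Hypothesis LRlin : forall c h1 y1 h2 y2, LR h1 y1 -> LR h2 y2 ->
  LR (fun x => c * h1 x + h2 x) (c * y1 + y2).
Hypothesis LR1 : exists y, LR (fun=> 1) y.
Hypothesis LRbound : forall h y, LR h y -> forall s : R, 0 < s ->
  `|y| <= M * (s * n2 h + s^-1).

Lemma LR0 : LR (fun=> 0) 0.
Proof.
case: LR1 => y /[dup] h /(LRlin (-1) h).
by rewrite !mulN1r !addNr.
Qed.

(** A root-free multiple of the [L^2] distance: minimised over [s] it equals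
    [2 * sqrt 2 * M * ||h - g||]. The factor 2 pays for splitting [||h' - h||^2] at [g]. *)
Definition radius (s : R) h g := M * (s + 2 * s^-1 * n2 (fun x => h x - g x)).

(* The best lower bound for the continuous extension of [LR] to [g] that the
   estimate [LRbound] provides; it needs no choice of approximants. *)
Definition ext g := sup [set v | exists h y s, [/\ LR h y, 0 < s & v = y - radius s h g]].

(** Any two of the intervals of centre [y] and half-width [radius s h g] meet. Applying [LRbound] to
    [h' - h] with parameter [(s + s')^-1] makes its constant term [M * (s + s')], which is shared
    between the two radii, and [(s + s')^-1] is below both [s^-1] and [s'^-1]. *)
Lemma LR_gap g h y s h' y' s' : bddm mu g -> LR h y -> LR h' y' -> 0 < s -> 0 < s' ->
  y' - radius s' h' g <= y + radius s h g.
Proof.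
move=> bg Hh Hh' s0 s0'.
have H := LRlin (-1) Hh Hh'.
have t0 : 0 < (s + s')^-1 by rewrite invr_gt0 addr_gt0.
have := LRbound H t0; rewrite invrK mulN1r => Hb.
have := n2_sub3 (LRb Hh') (LRb Hh) bg.
rewrite (_ : (fun x => (h' x - h x) ^+ 2) = (fun x => (-1 * h x + h' x) ^+ 2)); last first.
  by apply/funext => x; congr (_ ^+ 2); lra.
rewrite /radius; set a := n2 (fun x => -1 * h x + h' x) in Hb *.
set b := n2 (fun x => h' x - g x); set c := n2 (fun x => h x - g x) => Habc.
have b0 : 0 <= b by exact: Rint_sqr_ge0.
have c0 : 0 <= c by exact: Rint_sqr_ge0.
have Hy : y' - y <= `|- y + y'| by rewrite addrC ler_norm.
suff H2 : (s + s')^-1 * a <= 2 * s^-1 * c + 2 * s'^-1 * b.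
  have : M * ((s + s')^-1 * a + (s + s')) <= M * ((2 * s^-1 * c + 2 * s'^-1 * b) + (s + s')).
    by rewrite ler_pM2l // lerD2r.
  lra.
have H3 : (s + s')^-1 * a <= (s + s')^-1 * (2 * b + 2 * c) by rewrite ler_pM2l.
have Hs : (s + s')^-1 <= s^-1 by rewrite lef_pV2 ?posrE ?addr_gt0 //; lra.
have Hs' : (s + s')^-1 <= s'^-1 by rewrite lef_pV2 ?posrE ?addr_gt0 //; lra.
have H4 : (s + s')^-1 * c <= s^-1 * c by rewrite ler_wpM2r.
have H5 : (s + s')^-1 * b <= s'^-1 * b by rewrite ler_wpM2r.
lra.
Qed.

(** By [LR_gap] every upper end bounds all lower ends, so the supremum of the lower ends lies in
    each interval. *)
Lemma ext_near g h y s : bddm mu g -> LR h y -> 0 < s ->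
  `|y - ext g| <= radius s h g.
Proof.
move=> bg Hh s0.
have ub v : [set v | exists h y s, [/\ LR h y, 0 < s & v = y - radius s h g]] v ->
    v <= y + radius s h g.
  by move=> [h' [y' [s' [Hh' s0' ->]]]]; exact: LR_gap.
have H1 : ext g <= y + radius s h g.
  apply: ge_sup; last by move=> v /ub.
  by exists (y - radius s h g), h, y, s.
have H2 : y - radius s h g <= ext g.
  apply: ub_le_sup; last by exists h, y, s.
  by exists (y + radius s h g) => v /ub.
by rewrite ler_norml; lra.
Qed.

Definition dens g := bddm mu g /\
  forall e : R, 0 < e -> exists h y, LR h y /\ n2 (fun x => h x - g x) <= e.

Lemma ext_approx g s : dens g -> 0 < s -> exists h y,
  [/\ LR h y, n2 (fun x => h x - g x) <= s ^+ 2 & `|y - ext g| <= 3 * M * s].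
Proof.
move=> [bg Hg] s0; have s2 : 0 < s ^+ 2 by rewrite exprn_gt0.
have [h [y [Hh Hn]]] := Hg _ s2; exists h, y; split => //.
(* The squared distance is at most [s ^+ 2], so the radius is at most
   [M * (s + 2 * s) = 3 * M * s]. *)
apply: le_trans (ext_near bg Hh s0) _; rewrite /radius.
rewrite (_ : 3 * M * s = M * (3 * s)); last lra.
rewrite ler_pM2l //.
have : s^-1 * n2 (fun x => h x - g x) <= s^-1 * s ^+ 2 by rewrite ler_pM2l ?invr_gt0.
by rewrite expr2 mulKf ?gt_eqF //; lra.
Qed.

Lemma dens_lin c g1 g2 : dens g1 -> dens g2 -> dens (fun x => c * g1 x + g2 x).
Proof.
move=> D1 D2; have [[b1 _] [b2 _]] := (D1, D2); split.
  by apply: bddmD => //; exact: bddmZ.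
move=> e e0; pose K := 2 * (c ^+ 2 + 1).
have K0 : 0 < K by rewrite /K; have := sqr_ge0 c; lra.
have [_ /(_ (e / K) (divr_gt0 e0 K0))[h1 [y1 [H1 N1]]]] := D1.
have [_ /(_ (e / K) (divr_gt0 e0 K0))[h2 [y2 [H2 N2]]]] := D2.
exists (fun x => c * h1 x + h2 x), (c * y1 + y2); split; first exact: LRlin.
have B1 := bddmB (LRb H1) b1; have B2 := bddmB (LRb H2) b2.
have := n2D (bddmZ c B1) B2; rewrite n2Z //.
have -> : (fun x => (c * h1 x + h2 x - (c * g1 x + g2 x)) ^+ 2) =
   (fun x => (c * (h1 x - g1 x) + (h2 x - g2 x)) ^+ 2).
  by apply/funext => x; congr (_ ^+ 2); lra.
move=> Hn; apply: le_trans Hn _.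
have H3 : c ^+ 2 * n2 (fun x => h1 x - g1 x) <= c ^+ 2 * (e / K).
  by rewrite ler_wpM2l ?sqr_ge0.
have -> : e = 2 * (c ^+ 2 * (e / K)) + 2 * (e / K).
  by rewrite -mulrDr -[X in _ + X]mul1r -mulrDl mulrA -/K mulrC divfK ?gt_eqF.
lra.
Qed.

Lemma ext_lin c g1 g2 : dens g1 -> dens g2 ->
  ext (fun x => c * g1 x + g2 x) = c * ext g1 + ext g2.
Proof.
move=> D1 D2; apply/eqP; rewrite -subr_eq0; apply/eqP.
have [bg _] := dens_lin c D1 D2.
have [b1 _] := D1; have [b2 _] := D2.
(* The first summand bounds the radius around the combined approximant, whose squared error is at
   most [2 * (c ^+ 2 + 1) * s ^+ 2]; the second collects the two errors [3 * M * s] of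
   [ext_approx]. *)
apply: (@eq0_norm_le_eps _ (M * (1 + 4 * (c ^+ 2 + 1)) + 3 * M * (`|c| + 1))).
  have c0 := sqr_ge0 c; have n0 := normr_ge0 c.
  have M0' : 0 <= M := ltW M0.
  by apply: addr_ge0; apply: mulr_ge0; lra.
move=> s s0.
have [h1 [y1 [H1 N1 Y1]]] := ext_approx D1 s0.
have [h2 [y2 [H2 N2 Y2]]] := ext_approx D2 s0.
have := ext_near bg (LRlin c H1 H2) s0; rewrite /radius.
have -> : (fun x => (c * h1 x + h2 x - (c * g1 x + g2 x)) ^+ 2) =
   (fun x => (c * (h1 x - g1 x) + (h2 x - g2 x)) ^+ 2).
  by apply/funext => x; congr (_ ^+ 2); lra.
have B1 := bddmB (LRb H1) b1; have B2 := bddmB (LRb H2) b2.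
have := n2D (bddmZ c B1) B2; rewrite n2Z //.
set a := Rintegral _ _ (fun x => (c * (h1 x - g1 x) + _) ^+ 2); set E := ext _ => Ha HE.
have H3 : c ^+ 2 * n2 (fun x => h1 x - g1 x) <= c ^+ 2 * s ^+ 2.
  by rewrite ler_wpM2l ?sqr_ge0.
have Ha' : s^-1 * a <= 2 * (c ^+ 2 + 1) * s.
  have : s^-1 * a <= s^-1 * (2 * (c ^+ 2 + 1) * s ^+ 2) by rewrite ler_pM2l ?invr_gt0 //; lra.
  suff -> : s^-1 * (2 * (c ^+ 2 + 1) * s ^+ 2) = 2 * (c ^+ 2 + 1) * s by [].
  by field; rewrite gt_eqF.
have HE' : M * (s + 2 * s^-1 * a) <= M * ((1 + 4 * (c ^+ 2 + 1)) * s).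
  by rewrite ler_pM2l //; lra.
have HcY : `|c * (y1 - ext g1)| <= `|c| * (3 * M * s) by rewrite normrM ler_wpM2l.
have -> : E - (c * ext g1 + ext g2) =
  - (c * y1 + y2 - E) + c * (y1 - ext g1) + (y2 - ext g2) by lra.
apply: le_trans (ler_normD _ _) _; have := ler_normD (- (c * y1 + y2 - E)) (c * (y1 - ext g1)).
rewrite normrN; lra.
Qed.

Lemma ext_LR h y : LR h y -> ext h = y.
Proof.
move=> Hh; apply/eqP; rewrite eq_sym -subr_eq0; apply/eqP.
apply: (@eq0_norm_le_eps _ M); first exact: ltW.
move=> s s0; apply: le_trans (ext_near (LRb Hh) Hh s0) _; rewrite /radius.
have -> : (fun x => (h x - h x) ^+ 2) = fun=> 0.
  by apply/funext => x; rewrite subrr expr0n.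
by rewrite Rint_cst mulr0 addr0.
Qed.

Lemma ext_bound g s : bddm mu g -> 0 < s -> `|ext g| <= M * (s + 2 * s^-1 * n2 g).
Proof.
move=> bg s0; have := ext_near bg LR0 s0; rewrite /radius sub0r normrN.
by under [fun x => (0 - g x) ^+ 2]funext do rewrite sub0r sqrrN.
Qed.

Lemma LR_dens h y : LR h y -> dens h.
Proof.
move=> Hh; split; first exact: LRb Hh.
move=> e e0; exists h, y; split => //.
have -> : (fun x => (h x - h x) ^+ 2) = fun=> 0.
  by apply/funext => x; rewrite subrr expr0n.
by rewrite Rint_cst ltW.
Qed.

End Extension.

(** * Polynomials converging pointwise to a step function *)

Section StepPolynomials.
Variable R : realType.
Implicit Types x y r s : R.

Lemma bernoulli_ge x n : 0 <= x -> 1 + n%:R * x <= (1 + x) ^+ n.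
Proof.
move=> x0; elim: n => [|n IH]; first by rewrite mul0r addr0 expr0.
rewrite exprS -natr1; apply: le_trans (ler_wpM2l _ IH); last by lra.
have : 0 <= n%:R * x * x by rewrite !mulr_ge0.
lra.
Qed.

Lemma bernoulli_le x n : 0 <= x <= 1 -> 1 - n%:R * x <= (1 - x) ^+ n.
Proof.
move=> /andP[x0 x1]; elim: n => [|n IH]; first by rewrite mul0r subr0 expr0.
rewrite exprS -natr1; apply: le_trans (ler_wpM2l _ IH); last by lra.
have : 0 <= n%:R * x * x by rewrite !mulr_ge0.
lra.
Qed.

(** Write [x = r * y] with [y] halfway between [x] and 1. Then [n * r ^ n] stays below [(1 - r)^-1],
    since each of the [n] terms of the geometric sum is at least [r ^ n], and [y ^ n] supplies the
    decay. *)
Lemma natr_expr_cvg0 x : 0 <= x < 1 -> (fun n : nat => n%:R * x ^+ n) @ \oo --> (0 : R).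
Proof.
move=> /andP[x0 x1]; pose y := (1 + x) / 2; pose r := x / y.
have y0 : 0 < y by rewrite /y; lra.
have y1 : y < 1 by rewrite /y; lra.
have r0 : 0 <= r by rewrite divr_ge0 // ltW.
have r1 : r < 1 by rewrite /r ltr_pdivrMr // mul1r /y; lra.
have xE : x = r * y by rewrite /r divfK // gt_eqF.
have rn1 n : r ^+ n <= 1 by rewrite exprn_ile1 // ltW.
have H n : n%:R * r ^+ n * (1 - r) <= 1 - r ^+ n.
  elim: n => [|n IH]; first by rewrite !mul0r expr0 subrr.
  have IH' := ler_wpM2l r0 IH.
  have : 0 <= (1 - r) * (1 - r ^+ n.+1) by rewrite mulr_ge0 // subr_ge0 // ltW.
  rewrite exprS -natr1; lra.
have cy : (fun n => (1 - r)^-1 * y ^+ n) @ \oo --> (0 : R).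
  rewrite -[X in _ --> X](mulr0 (1 - r)^-1); apply: cvgM; first exact: cvg_cst.
  by apply: cvg_expr; rewrite ger0_norm // ltW.
apply: (@squeeze_cvgr _ _ _ _ (fun=> 0) (fun n => (1 - r)^-1 * y ^+ n)) => //.
- apply: nearW => n; apply/andP; split; first by rewrite mulr_ge0 ?exprn_ge0.
  rewrite xE exprMn mulrA; apply: ler_wpM2r; first by rewrite exprn_ge0 // ltW.
  rewrite -[leRHS]mul1r ler_pdivlMr ?subr_gt0 // (le_trans (H n)) // lerBlDr.
  by rewrite lerDl exprn_ge0.
- exact: cvg_cst.
Qed.

(** A variant of the polynomials [(1 - s^n)^(k^n)] from the elementary proof of the
    Stone-Weierstrass theorem, with the step placed at [1/2]. *)
Definition steppoly n s := (1 - s ^+ n) ^+ (n * 2 ^ n).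

Lemma steppoly_01 n s : 0 <= s <= 1 -> 0 <= steppoly n s <= 1.
Proof.
move=> /andP[s0 s1]; have h1 : s ^+ n <= 1 by rewrite exprn_ile1.
have h0 : 0 <= s ^+ n by rewrite exprn_ge0.
by rewrite exprn_ge0 ?subr_ge0 //= exprn_ile1 ?subr_ge0 // lerBlDr lerDl.
Qed.

(* The exponent [n * 2 ^ n] makes the limit at the threshold [s = 1/2] equal to [0]. *)
Lemma steppoly_cvg s : 0 <= s <= 1 ->
  (fun n => steppoly n s) @ \oo --> ((s < 2^-1)%R%:R : R).
Proof.
move=> /[dup] s01 /andP[s0 s1]; case: ltP => hs /=.
- apply: (@squeeze_cvgr _ _ _ _ (fun n => 1 - n%:R * (2 * s) ^+ n) (fun=> 1)).
  + apply: nearW => n; have /andP[_ ->] := steppoly_01 n s01; rewrite andbT.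
    have sn : 0 <= s ^+ n <= 1 by rewrite exprn_ge0 ?exprn_ile1.
    have := bernoulli_le (n * 2 ^ n) sn.
    by rewrite natrM natrX exprMn mulrA.
  + rewrite -[X in _ --> X]subr0; apply: cvgB; first exact: cvg_cst.
    by apply: natr_expr_cvg0; lra.
  + exact: cvg_cst.
- apply: (@squeeze_cvgr _ _ _ _ (fun=> 0) (fun n => n.+1%:R^-1)).
  + apply: nearW => n; have /andP[-> _] := steppoly_01 n s01 => /=.
    (* Here [s ^ n >= x] and [N * x = n]. Since [(1 - x) ^ N * (1 + x) ^ N <= 1] and
       [(1 + x) ^ N >= 1 + n] by Bernoulli, the value is at most [1 / (n + 1)]. *)
    pose x : R := 2^-1 ^+ n; pose N := (n * 2 ^ n)%N.
    have x0 : 0 <= x by rewrite exprn_ge0.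
    have x1 : x <= 1 by rewrite exprn_ile1 //; lra.
    have xs : x <= s ^+ n by rewrite lerXn2r ?nnegrE //; lra.
    have Nx : N%:R * x = n%:R.
      by rewrite /N natrM natrX /x -mulrA -exprMn divff ?expr1n ?mulr1.
    apply: (@le_trans _ _ ((1 - x) ^+ N)).
      rewrite /steppoly lerXn2r ?nnegrE ?subr_ge0 ?exprn_ile1 //; lra.
    rewrite -[leRHS]mul1r ler_pdivlMr ?ltr0n //.
    have := bernoulli_ge N x0; rewrite Nx nat1r => HB.
    have := @ler_wpM2l _ ((1 - x) ^+ N) _ _ _ HB; rewrite exprn_ge0 ?subr_ge0 // => /(_ isT).
    move=> h; apply: le_trans h _; rewrite -exprMn exprn_ile1 //.
      by rewrite mulr_ge0; lra.
    have := sqr_ge0 x; lra.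
  + exact: cvg_cst.
  + exact: cvg_harmonic.
Qed.

End StepPolynomials.

Section BoundedConvergence.
Context d (T : measurableType d) (R : realType) (mu : probability T R).

Lemma bounded_Rint_cvg0 (f : nat -> T -> R) :
  (forall n, measurable_fun setT (f n)) ->
  {ae mu, forall x n, `|f n x| <= 1} ->
  {ae mu, forall x, f ^~ x @ \oo --> (0 : R)} ->
  (fun n => Rintegral mu setT (f n)) @ \oo --> (0 : R).
Proof.
move=> mf f1 f0.
have [] := @dominated_convergence _ _ R mu setT measurableT
   (fun n x => (f n x)%:E) (fun=> 0%E) (fun=> 1%E).
- by move=> n; exact/measurable_EFinP.
- exact: measurable_cst.
- apply: filterS f0 => x fx _; exact: cvg_EFin (nearW _ _) fx.
- exact: (bddm_intgr (bddm_cst mu 1)).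
- by apply: filterS f1 => x fx n _; rewrite lee_fin.
move=> _ _; rewrite integral0 => /fine_cvg; apply: cvg_trans.
exact: cvg_refl.
Qed.
End BoundedConvergence.

(** * Approximation of indicators in [L^2] by an algebra of functions *)

Section Density.
Context d (T : measurableType d) (R : realType) (mu : probability T R).
Implicit Types (f g h : T -> R) (A B : set T).
Local Notation I f := (Rintegral mu setT f).
Local Notation n2 f := (Rintegral mu setT (fun x => f x ^+ 2)).

Variables (LR : (T -> R) -> R -> Prop).
Hypothesis LRb : forall h y, LR h y -> bddm mu h.
Hypothesis LRlin : forall c h1 y1 h2 y2, LR h1 y1 -> LR h2 y2 ->
  LR (fun x => c * h1 x + h2 x) (c * y1 + y2).
Hypothesis LR1 : exists y, LR (fun=> 1) y.
Hypothesis LRmul : forall h1 y1 h2 y2, LR h1 y1 -> LR h2 y2 ->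
  exists y, LR (fun x => h1 x * h2 x) y.

Lemma LR_affine a b h y : LR h y -> exists y', LR (fun x => a * h x + b) y'.
Proof.
move=> Hh; case: LR1 => y1 H1.
have := LRlin a Hh (LRlin b H1 (LR0 LRlin LR1)).
rewrite (_ : (fun x => _) = (fun x => a * h x + b)); first by eexists; eassumption.
by apply/funext => x; rewrite mulr1 addr0.
Qed.

Lemma LR_exp n h y : LR h y -> exists y', LR (fun x => h x ^+ n) y'.
Proof.
move=> Hh; elim: n => [|n [y' IH]]; first by case: LR1 => y1 H1; exists y1.
have [z Hz] := LRmul Hh IH; exists z.
by rewrite (_ : (fun x => _) = (fun x => h x * h x ^+ n)) //; apply/funext => x; rewrite exprS.
Qed.

(** The range condition makes the class stable under products: without it, the product of two [L^2]
    approximants need not approach the indicator of the intersection. *)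
Definition dens01 A := measurable A /\ forall e : R, 0 < e -> exists h y,
  [/\ LR h y, {ae mu, forall x, 0 <= h x <= 1} & n2 (fun x => h x - \1_A x) <= e].

Lemma dens01_set0 : dens01 set0.
Proof.
split => // e e0; exists (fun=> 0), 0; split.
- exact: (LR0 LRlin LR1).
- by apply: aeW => x; rewrite lexx ler01.
- rewrite (_ : (fun x => _) = (fun=> 0)) ?Rint_cst ?ltW //.
  by apply/funext => x; rewrite indic0 subrr expr0n.
Qed.

Lemma dens01_setC A : dens01 A -> dens01 (~` A).
Proof.
move=> [mA HA]; split; first exact: measurableC.
move=> e /HA[h [y [Hh h01 hn]]]; have [y' Hy'] := LR_affine (-1) 1 Hh.
exists (fun x => -1 * h x + 1), y'; split => //.
  by apply: filterS h01 => x; lra.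
rewrite (_ : (fun x => _) = (fun x => (h x - \1_A x) ^+ 2)) //.
apply/funext => x; rewrite -[RHS]sqrrN; congr (_ ^+ 2); rewrite !indicE in_setC.
by case: (x \in A) => /=; lra.
Qed.

Lemma dens01_setI A B : dens01 A -> dens01 B -> dens01 (A `&` B).
Proof.
move=> [mA HA] [mB HB]; split; first exact: measurableI.
move=> e e0; have e4 : 0 < e / 4 by lra.
have [h [y [Hh h01 hn]]] := HA _ e4; have [k [z [Hk k01 kn]]] := HB _ e4.
have [u Hu] := LRmul Hh Hk; exists (fun x => h x * k x), u; split => //.
  by apply: filterS2 h01 k01 => x /andP[a b] /andP[c' d']; rewrite mulr_ge0 // mulr_ile1.
have bA := bddmB (LRb Hh) (bddm_indic mu mA).
have bB := bddmB (LRb Hk) (bddm_indic mu mB).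
have bAB := bddm_indic mu (measurableI _ _ mA mB).
apply: (@le_trans _ _ (2 * n2 (fun x => h x - \1_A x) + 2 * n2 (fun x => k x - \1_B x))); last lra.
have iA := bddm_intgr (bddm_sqr bA); have iB := bddm_intgr (bddm_sqr bB).
rewrite -!RintZ // -RintD; do ?exact: intgrZ.
apply: ae_le_Rint.
- by apply/bddm_intgr/bddm_sqr/bddmB => //; exact: LRb Hu.
- by apply: intgrD; exact: intgrZ.
apply: filterS2 h01 k01 => x /andP[h0 h1] /andP[k0 k1].
rewrite indicI /=; set a : R := \1_A x; set b : R := \1_B x.
have a1 : a ^+ 2 <= 1 by rewrite /a indicE; case: (x \in A) => /=; rewrite ?expr1n ?expr0n.
have k2 : k x ^+ 2 <= 1 by rewrite exprn_ile1.
have -> : h x * k x - a * b = (h x - a) * k x + a * (k x - b) by lra.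
apply: (@le_trans _ _ (2 * ((h x - a) * k x) ^+ 2 + 2 * (a * (k x - b)) ^+ 2)).
  by have := sqr_ge0 ((h x - a) * k x - a * (k x - b)); lra.
have : (h x - a) ^+ 2 * k x ^+ 2 <= (h x - a) ^+ 2 by rewrite ler_piMr ?sqr_ge0.
have : a ^+ 2 * (k x - b) ^+ 2 <= (k x - b) ^+ 2 by rewrite ler_piMl ?sqr_ge0.
by rewrite !exprMn; lra.
Qed.

Lemma dens01_setU A B : dens01 A -> dens01 B -> dens01 (A `|` B).
Proof.
move=> /dens01_setC hA /dens01_setC hB.
by rewrite -[A `|` B]setCK setCU; apply/dens01_setC/dens01_setI.
Qed.

(** Continuity of [mu] from below reduces to finite unions, because the squared [L^2] distance of
    nested indicators is the difference of their measures. *)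
Lemma dens01_bigcup (F : nat -> set T) :
  (forall n, dens01 (F n)) -> dens01 (\bigcup_n F n).
Proof.
move=> HF; pose U n := \big[setU/set0]_(i < n.+1) F i.
have dU n : dens01 (U n).
  rewrite /U; elim: n.+1 => [|k IH]; first by rewrite big_ord0; exact: dens01_set0.
  by rewrite big_ord_recr /=; exact: dens01_setU.
have mU n : measurable (U n) by case: (dU n).
have UE : \bigcup_n U n = \bigcup_n F n by rewrite bigcup_bigsetU_bigcup.
have mF : measurable (\bigcup_n F n).
  by apply: bigcup_measurable => n _; case: (HF n).
split => // e e0.
have cU : (mu \o U) @ \oo --> mu (\bigcup_n F n).
  rewrite -UE; apply: nondecreasing_cvg_mu => //; first by rewrite UE.
  move=> m n mn; apply/subsetPset; exact: subset_bigsetU.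
have finE A : measurable A -> mu A = (fine (mu A))%:E.
  by move=> mA; rewrite fineK // fin_num_measure.
have cU' : (fun n => fine (mu (U n))) @ \oo --> fine (mu (\bigcup_n F n)).
  by apply: fine_cvg; rewrite -finE.
have e4 : 0 < e / 4 by lra.
have /cvgrPdist_le/(_ _ e4)[n _ /(_ n (leqnn n))] := cU'.
move=> /(le_trans (ler_norm _)) Hn.
have [_ /(_ _ e4)[h [y [Hh h01 hn]]]] := dU n.
exists h, y; split => //.
have bh := LRb Hh; have bU := bddm_indic mu (mU n); have bF := bddm_indic mu mF.
have := n2_sub3 bh bF bU.
suff -> : n2 (fun x => \1_(\bigcup_n F n) x - \1_(U n) x) =
   fine (mu (\bigcup_n F n)) - fine (mu (U n)) by lra.
have iU := bddm_intgr bU; have iF := bddm_intgr bF.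
rewrite -!Rint_indic // -mulN1r -RintZ // -RintD //; last exact: intgrZ.
congr Rintegral; apply/funext => x; rewrite !indicE mulN1r.
have UF : U n `<=` \bigcup_n F n by rewrite -UE; exact: bigcup_sup.
case: (boolP (x \in U n)) => xU; last first.
  by rewrite subr0; case: (_ \in _) => /=; rewrite ?expr1n ?expr0n ?subr0.
by rewrite (mem_set (UF _ (set_mem xU))) subrr expr0n.
Qed.

Lemma dens01_ray h y c : LR h y -> dens01 [set x | h x < c].
Proof.
move=> Hh; have [mh [K hK]] := LRb Hh.
have mA : measurable [set x | h x < c].
  rewrite (_ : [set x | _] = setT `&` h @^-1` [set r | r < c]) ?setTI //.
  rewrite -set_itvNyo -[_ @^-1` _]setTI; apply: mh => //; exact: measurable_itv.
split => // e e0; pose L := `|K| + `|c| + 1.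
have L0 : 0 < L by rewrite /L; have := normr_ge0 K; have := normr_ge0 c; lra.
(* The affine map sends the essential range of [h] into [[0, 1]] and the threshold [c] to [1/2],
   because [|h - c| <= L] almost everywhere; the step polynomials then apply. *)
pose a := (2 * L)^-1; have a0 : 0 < a by rewrite invr_gt0; lra.
have aL : a * L = 2^-1 by rewrite /a; field; rewrite gt_eqF.
pose s x := a * h x + (2^-1 - a * c).
have [ys Hs] := LR_affine a (2^-1 - a * c) Hh.
have s01 : {ae mu, forall x, 0 <= s x <= 1}.
  apply: filterS hK => x /= hx.
  have : `|h x - c| <= L.
    apply: le_trans (ler_normB _ _) _; have := ler_norm K; rewrite /L; lra.
  rewrite ler_norml => /andP[]; rewrite -(ler_pM2l a0) -(ler_pM2l a0 (h x - c)) mulrN aL /s; lra.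
have sA x : (s x < 2^-1) = (h x < c).
  by rewrite /s -(ltr_pM2l a0 (h x) c); apply/idP/idP; lra.
have Hq n : exists y', LR (fun x => steppoly n (s x)) y'.
  have [y1 H1] := LR_exp n Hs; have [y2 H2] := LR_affine (-1) 1 H1.
  have [y3 H3] := LR_exp (n * 2 ^ n) H2; exists y3.
  rewrite (_ : (fun x => _) = (fun x => (-1 * s x ^+ n + 1) ^+ (n * 2 ^ n))) //.
  by apply/funext => x; rewrite /steppoly; congr (_ ^+ _); lra.
suff : (fun n => n2 (fun x => steppoly n (s x) - \1_[set x | h x < c] x)) @ \oo --> (0 : R).
  move=> /cvgrPdist_le/(_ _ e0)[n _ /(_ n (leqnn n))]; rewrite sub0r normrN => Hn.
  have [y' Hy'] := Hq n; exists (fun x => steppoly n (s x)), y'; split => //.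
    by apply: filterS s01 => x; exact: steppoly_01.
  exact: le_trans (ler_norm _) Hn.
apply: bounded_Rint_cvg0.
- move=> n; have [y' Hy'] := Hq n.
  by have [] := bddm_sqr (bddmB (LRb Hy') (bddm_indic mu mA)).
- apply: filterS s01 => x sx n; have /andP[q0 q1] := steppoly_01 n sx.
  rewrite ger0_norm ?sqr_ge0 // indicE.
  by case: (_ \in _) => /=; nra.
- apply: filterS s01 => x sx.
  have c1 : (fun n => steppoly n (s x) - \1_[set x | h x < c] x) @ \oo -->
     ((s x < 2^-1)%R%:R - (s x < 2^-1)%R%:R : R).
    apply: cvgB; first exact: steppoly_cvg.
    rewrite indicE sA (_ : (x \in _) = (h x < c)); first exact: cvg_cst.
    by apply/idP/idP => [/set_mem //|?]; exact/mem_set.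
  by have := cvgM c1 c1; rewrite subrr mulr0; exact.
Qed.

Lemma dens01_sigma : sigma_algebra setT dens01.
Proof.
split; [exact: dens01_set0| |exact: dens01_bigcup].
by move=> A /dens01_setC; rewrite setTD.
Qed.

Lemma dens01_dens A : dens01 A -> dens mu LR (\1_A : T -> R).
Proof.
move=> [mA HA]; split; first exact: bddm_indic.
by move=> e /HA[h [y [Hh _ hn]]]; exists h, y.
Qed.

End Density.

(** * Bounded Radon-Nikodym densities *)

Section ChargeDensity.
Context d (T : measurableType d) (R : realType) (mu : probability T R).
Implicit Types (f g h : T -> R) (A B : set T).
Local Notation I f := (Rintegral mu setT f).

Lemma fine_muE A : measurable A -> mu A = (fine (mu A))%:E.
Proof. by move=> mA; rewrite fineK // fin_num_measure. Qed.

Lemma Rint_eq0_ae f : intgr mu f -> (forall x, 0 <= f x) -> I f <= 0 ->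
  {ae mu, forall x, f x = 0}.
Proof.
move=> hf f0 If; have mf := intgr_meas hf.
have : (\int[mu]_x `|(f x)%:E| = 0)%E.
  have -> : (\int[mu]_x `|(f x)%:E| = \int[mu]_x (f x)%:E)%E.
    by apply: eq_integral => x _; rewrite gee0_abs // lee_fin.
  have Efin := integrable_fin_num measurableT hf.
  rewrite -[LHS]fineK //; congr EFin; apply/eqP; rewrite eq_le If /=.
  exact: Rintegral_ge0.
move/ae_eq_integral_abs => /(_ measurableT).
have mE : measurable_fun setT (EFin \o f) by exact/measurable_EFinP.
by move=> /(_ mE); apply: filterS => x /(_ Logic.I)[].
Qed.

Lemma intgr_indicM f A : intgr mu f -> measurable A ->
  intgr mu (fun x => f x * \1_A x).
Proof.
move=> hf mA; have mf := intgr_meas hf.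
apply: (@intgr_dom _ _ _ _ _ (fun x => `|f x|)).
- by apply: measurable_funM => //; exact: measurable_indic.
- exact: integrable_abse hf.
- apply: aeW => x; rewrite normrM indicE; case: (_ \in _) => /=.
    by rewrite normr1 mulr1.
  by rewrite normr0 mulr0.
Qed.

(** Test on [A = {c < f}]: there [f - c] is positive, yet its integral over [A] is at most 0, so [A]
    is null. *)
Lemma ae_le_of_Rint f c : intgr mu f ->
  (forall A, measurable A -> I (fun x => f x * \1_A x) <= c * fine (mu A)) ->
  {ae mu, forall x, f x <= c}.
Proof.
move=> hf H; have mf := intgr_meas hf; pose A := [set x | c < f x].
have mA : measurable A.
  rewrite (_ : A = f @^-1` `]c, +oo[) //; last first.
    by apply/seteqP; split => x; rewrite /A /= in_itv /= andbT.
  by rewrite -[_ @^-1` _]setTI; apply: mf.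
have i1 := intgr_indicM hf mA.
have i2 : intgr mu (fun x => (- c) * \1_A x).
  by apply: intgrZ; apply: bddm_intgr; exact: bddm_indic.
have := @Rint_eq0_ae _ (intgrD i1 i2).
have Ae x : A x -> f x * \1_A x + - c * \1_A x = f x - c.
  by move=> Ax; rewrite indicE mem_set //= !mulr1.
case.
- move=> x; have [Ax|nAx] := pselect (A x).
    by rewrite Ae // subr_ge0 ltW.
  by rewrite indicE memNset // !mulr0 addr0.
- rewrite RintD // RintZ ?Rint_indic //; last exact/bddm_intgr/bddm_indic.
  by have := H _ mA; lra.
- move=> N [mN muN sN]; exists N; split => // x /= fx; apply: sN => /= fx0.
  apply: fx; rewrite leNgt; apply/negP => Ax; move: fx0; rewrite Ae //.
  by move/eqP; rewrite subr_eq0 => /eqP e; move: Ax; rewrite e ltxx.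
Qed.

(** Domination by [mu] upgrades finite to countable additivity, since [nu] of a remainder is at most
    [c] times its vanishing measure. It also gives absolute continuity, and bounds the Radon-Nikodym
    density when tested against [phi] and [-phi]. *)
Lemma bounded_charge_density (nu : set T -> R) (c : R) :
  (forall A, measurable A -> `|nu A| <= c * fine (mu A)) ->
  (forall A B, measurable A -> measurable B -> A `&` B = set0 ->
     nu (A `|` B) = nu A + nu B) ->
  exists phi : T -> R, bddm mu phi /\
    forall A, measurable A -> nu A = I (fun x => phi x * \1_A x).
Proof.
move=> nub nuD.
have nu0 : nu set0 = 0.
  have := nuD _ _ (@measurable0 _ T) (@measurable0 _ T) (setI0 _).
  by rewrite setU0 => e; lra.
pose n' (A : set T) := (nu A)%:E.
have n'0 : n' set0 = 0%E by rewrite /n' nu0.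
have n'fin A : measurable A -> n' A \is a fin_num by [].
have n'sig : semi_sigma_additive n'.
  move=> F mF tF mU; pose U n := \big[setU/set0]_(i < n) F i.
  have mUn n : measurable (U n) by apply: bigsetU_measurable => i _; exact: mF.
  have UF n : U n `<=` \bigcup_n F n by move=> x; rewrite /U -bigcup_mkord => -[i _ Fx]; exists i.
  have sumE n : nu (U n) = \sum_(0 <= i < n) nu (F i).
    elim: n => [|n IH]; first by rewrite /U big_ord0 big_nil nu0.
    rewrite /U big_ord_recr big_nat_recr //= -IH nuD //; first exact: mUn.
    apply: (@trivIset_bigsetUI _ predT F) => //.
    by rewrite [X in trivIset X F](_ : _ = [set: nat])//; exact/seteqP.
  have dif n : `|nu (\bigcup_n F n) - nu (U n)| <= c * (fine (mu (\bigcup_n F n)) - fine (mu (U n))).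
    have mD : measurable (\bigcup_n F n `\` U n) by exact: measurableD.
    have DE : (\bigcup_n F n `\` U n) `|` U n = \bigcup_n F n by rewrite setUC setDUK.
    have DI : (\bigcup_n F n `\` U n) `&` U n = set0 by rewrite setDE -setIA setICl setI0.
    rewrite -[in nu _]DE nuD // addrK; apply: le_trans (nub _ mD) _.
    have := measureU mu mD (mUn n) DI; rewrite DE => /(congr1 fine).
    by rewrite fineD ?fin_num_measure // => ->; rewrite addrK.
  have cU : (fun n => fine (mu (U n))) @ \oo --> fine (mu (\bigcup_n F n)).
    apply: fine_cvg; rewrite -fine_muE //.
    have UE : \bigcup_n U n = \bigcup_n F n.
      apply/seteqP; split => [x [n _ /UF]//|x [n _ Fx]]; exists n.+1 => //.
      by rewrite /U -bigcup_mkord; exists n => //=.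
    rewrite -UE; apply: nondecreasing_cvg_mu => //; first by rewrite UE.
    by move=> m n mn; apply/subsetPset; exact: subset_bigsetU.
  have cD : (fun n => c * (fine (mu (\bigcup_n F n)) - fine (mu (U n)))) @ \oo --> (0 : R).
    have := cvgM (cvg_cst c) (cvgB (cvg_cst (fine (mu (\bigcup_n F n)))) cU).
    by rewrite subrr mulr0; exact.
  rewrite /n'; under eq_fun do rewrite sumEFin -sumE.
  apply: cvg_EFin; first exact: nearW.
  apply/cvgrPdist_le => e e0; move/cvgrPdist_le: cD => /(_ _ e0).
  apply: filterS => n; rewrite sub0r normrN; apply: le_trans.
  exact: le_trans (dif n) (ler_norm _).
pose C : {charge set T -> \bar R} := HB.pack n' (isCharge.Build _ T R n' n'0 n'fin n'sig).
have Cmu : C `<< mu.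
  move=> A nA B mB BA; have := nub _ mB; rewrite nA //= mulr0 normr_le0 => /eqP h.
  by rewrite /= /n' h.
pose phi x := fine (Radon_Nikodym C mu x).
have phiE x : Radon_Nikodym C mu x = (phi x)%:E by rewrite fineK // Radon_Nikodym_fin_num.
have ip : intgr mu phi.
  have := Radon_Nikodym_integrable Cmu; rewrite /intgr.
  by rewrite (_ : EFin \o phi = Radon_Nikodym C mu) //; apply/funext => x; rewrite phiE.
have nuE A : measurable A -> nu A = I (fun x => phi x * \1_A x).
  move=> mA; have : n' A = (\int[mu]_(x in A) Radon_Nikodym C mu x)%E.
    exact: (Radon_Nikodym_integral Cmu mA).
  under eq_integral do rewrite phiE.
  rewrite integral_mkcond /= /Rintegral /n' => /(congr1 fine) /= ->; congr fine; apply: eq_integral => x _.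
  by rewrite patchE indicE; case: (x \in A) => /=; rewrite ?mulr1 ?mulr0.
exists phi; split => //; split; first exact: intgr_meas ip.
exists c.
have up : {ae mu, forall x, phi x <= c}.
  apply: ae_le_of_Rint => // A mA; rewrite -nuE //.
  exact: le_trans (ler_norm _) (nub _ mA).
have lo : {ae mu, forall x, (-1) * phi x <= c}.
  apply: ae_le_of_Rint; first exact: intgrZ.
  move=> A mA; have -> : (fun x => -1 * phi x * \1_A x) = (fun x => -1 * (phi x * \1_A x)).
    by apply/funext => x; rewrite mulrA.
  rewrite RintZ; last exact: intgr_indicM.
  rewrite -nuE // mulN1r; apply: le_trans (nub _ mA).
  by rewrite -normrN ler_norm.
by apply: filterS2 up lo => x ux lx; rewrite ler_norml; lra.
Qed.
End ChargeDensity.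

(** * Integral representation of the extended real functional *)

Section Representation.
Context d (T : measurableType d) (R : realType) (mu : probability T R).
Implicit Types (f g h : T -> R) (A B : set T).
Local Notation I f := (Rintegral mu setT f).
Local Notation n2 f := (Rintegral mu setT (fun x => f x ^+ 2)).

Variables (LR : (T -> R) -> R -> Prop) (M : R).
Hypothesis M0 : 0 < M.
Hypothesis LRb : forall h y, LR h y -> bddm mu h.
Hypothesis LRlin : forall c h1 y1 h2 y2, LR h1 y1 -> LR h2 y2 ->
  LR (fun x => c * h1 x + h2 x) (c * y1 + y2).
Hypothesis LR1 : exists y, LR (fun=> 1) y.
Hypothesis LRbound : forall h y, LR h y -> forall s : R, 0 < s ->
  `|y| <= M * (s * n2 h + s^-1).
Hypothesis LRsqr : forall h y, LR h y ->
  exists y', LR (fun x => h x ^+ 2) y' /\ `|y'| <= M * n2 h.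
Hypothesis LRdens : forall A, measurable A -> dens01 mu LR A.

Local Notation ext g := (ext mu LR M g).

(** If [h] takes values in [[0, 1]] and is close to [\1_A], so is its square, and [LRsqr] bounds the
    functional there by [M * n2 h], which is first order in [mu A]. The factor 2 comes from
    [n2 h <= 2 * mu A + 2 * t ^+ 2]. *)
Lemma ext_indic_bound A : measurable A -> `|ext \1_A| <= (2 * M) * fine (mu A).
Proof.
move=> mA; have bA := bddm_indic mu mA.
have Mge : 0 <= M := ltW M0; have M11 : 0 < 11 * M by rewrite mulr_gt0.
apply/ler_addgt0Pl => e e0.
(* The error is [9 * M * t] from the radius around the square of [h], namely [t + 2 * (4 * t)], plus
   [2 * M * t] from [n2 h]. The cap at 1 gives [t ^+ 2 <= t]. *)
pose t : R := Num.min 1 (e / (11 * M)).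
have t0 : 0 < t by rewrite lt_min ltr01 divr_gt0.
have t1 : t <= 1 by rewrite ge_min lexx.
have te : 11 * M * t <= e.
  by rewrite mulrC -ler_pdivlMr ?ge_min ?lexx ?orbT.
have t2 : 0 < t ^+ 2 by rewrite exprn_gt0.
have tt : t ^+ 2 <= t by rewrite expr2 ler_piMr // ltW.
have [_ /(_ _ t2)[h [y [Hh h01 hn]]]] := LRdens mA.
have [y' [Hy' y'b]] := LRsqr Hh.
have bh := LRb Hh; have bd := bddmB bh bA.
have id := bddm_intgr (bddm_sqr bd).
have iA := bddm_intgr bA.
have n2h : n2 h <= 2 * fine (mu A) + 2 * t ^+ 2.
  apply: (@le_trans _ _ (2 * I (\1_A : T -> R) + 2 * n2 (fun x => h x - \1_A x))).
    rewrite -!RintZ // -RintD; do ?exact: intgrZ.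
    apply: ae_le_Rint.
    - exact/bddm_intgr/bddm_sqr.
    - by apply: intgrD; exact: intgrZ.
    apply: aeW => x; rewrite indicE; case: (x \in A) => /=.
      by have := sqr_ge0 (h x - 2 * 1); lra.
    by have := sqr_ge0 (h x); lra.
  by rewrite Rint_indic //; lra.
have n2d : n2 (fun x => h x ^+ 2 - \1_A x) <= 4 * t ^+ 2.
  apply: (@le_trans _ _ (4 * n2 (fun x => h x - \1_A x))); last by rewrite ler_pM2l.
  rewrite -RintZ //; apply: ae_le_Rint; last first.
  - apply: filterS h01 => x /andP[h0 h1]; rewrite indicE; case: (x \in A) => /=.
      have -> : (h x ^+ 2 - 1) ^+ 2 = (h x + 1) ^+ 2 * (h x - 1) ^+ 2 by ring.
      by apply: ler_wpM2r; [exact: sqr_ge0|nra].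
    rewrite !subr0; have : h x ^+ 2 <= 1 by rewrite exprn_ile1.
    by have := sqr_ge0 (h x); nra.
  - exact: intgrZ.
  - by apply/bddm_intgr/bddm_sqr/bddmB => //; exact: bddm_sqr.
have := ext_near M0 LRb LRlin LRbound bA Hy' t0; rewrite /radius.
set E := ext _ => HE.
have HE' : M * (t + 2 * t^-1 * n2 (fun x => h x ^+ 2 - \1_A x)) <= M * (9 * t).
  rewrite ler_pM2l //.
  have : t^-1 * n2 (fun x => h x ^+ 2 - \1_A x) <= t^-1 * (4 * t ^+ 2).
    by rewrite ler_pM2l ?invr_gt0.
  have -> : t^-1 * (4 * t ^+ 2) = 4 * t by field; rewrite gt_eqF.
  lra.
have y'b' : M * n2 h <= M * (2 * fine (mu A) + 2 * t) by rewrite ler_pM2l //; lra.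
have -> : E = y' - (y' - E) by lra.
apply: le_trans (ler_normB _ _) _; lra.
Qed.

Lemma indic_setU_disj A B : A `&` B = set0 ->
  (\1_(A `|` B) : T -> R) = (fun x => 1 * \1_A x + \1_B x).
Proof.
move=> AB; apply/funext => x; rewrite !indicE in_setU mul1r.
case: (boolP (x \in A)) => xA; case: (boolP (x \in B)) => xB //=; rewrite ?addr0 ?add0r //.
by have : (A `&` B) x by [split; exact: set_mem]; rewrite AB.
Qed.

(** The sum is the minimum of [n] and the integer part of [x]; it is used to write step functions as
    sums of indicators. *)
Lemma layer_cake (n : nat) (x : R) : 0 <= x ->
  let S := \sum_(j < n) ((j.+1%:R <= x)%R%:R : R) in
  S <= x /\ S <= n%:R /\ (S = n%:R \/ x < S + 1).
Proof.
move=> x0; elim: n => [|n [IH1 [IH2 IH3]]] /=; first by rewrite big_ord0; split => //; split => //; left.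
rewrite big_ord_recr /=; move: IH1 IH2 IH3; move: (\sum_(j < n) _) => S IH1 IH2 IH3.
have nS : n.+1%:R = n%:R + 1 :> R by rewrite -natr1.
case: (leP n.+1%:R x); rewrite nS => hx /=.
  have SE : S = n%:R by case: IH3 => // h; lra.
  by rewrite SE; split; [lra|split; [lra|left; lra]].
by rewrite addr0; split; [lra|split; [lra|right; case: IH3 => ?; lra]].
Qed.

(** The difference [Lam] between [ext] and integration against the density vanishes on indicators
    and is bounded in [L^2]. Uniform approximation of [h] by combinations of indicators therefore
    forces [Lam h = 0]. *)
Theorem real_symbol : exists phi : T -> R, bddm mu phi /\
  forall h y, LR h y -> y = I (fun x => phi x * h x).
Proof.
have Mge : 0 <= M := ltW M0.
have densI A : measurable A -> dens mu LR (\1_A : T -> R).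
  by move=> mA; apply: dens01_dens; exact: LRdens.
have [phi [bphi phiE]] : exists phi : T -> R, bddm mu phi /\
    forall A, measurable A -> ext \1_A = I (fun x => phi x * \1_A x).
  apply: (@bounded_charge_density _ _ _ mu (fun A => ext \1_A) (2 * M)).
    exact: ext_indic_bound.
  move=> A B mA mB AB; rewrite indic_setU_disj //.
  by rewrite (ext_lin M0) ?mul1r //; exact: densI.
exists phi; split => // h y Hh.
pose Lam g := ext g - I (fun x => phi x * g x).
have iphi g : bddm mu g -> intgr mu (fun x => phi x * g x).
  by move=> bg; apply: bddm_intgr; exact: bddmM.
have Lam_lin c g1 g2 : dens mu LR g1 -> dens mu LR g2 ->
    Lam (fun x => c * g1 x + g2 x) = c * Lam g1 + Lam g2.
  move=> D1 D2; rewrite /Lam (ext_lin M0) //.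
  have [[b1 _] [b2 _]] := (D1, D2).
  have -> : (fun x => phi x * (c * g1 x + g2 x)) =
      (fun x => c * (phi x * g1 x) + phi x * g2 x) by apply/funext => x; ring.
  rewrite RintD ?RintZ //; try exact: iphi; last by apply: intgrZ; exact: iphi.
  lra.
have LamI A : measurable A -> Lam \1_A = 0 by move=> mA; rewrite /Lam phiE // subrr.
have [mphi [c phic]] := bphi.
pose c' : R := `|c| + 1; have c0 : 0 < c' by rewrite /c'; have := normr_ge0 c; lra.
have Lam_bound g (s : R) : bddm mu g -> 0 < s -> `|Lam g| <= (2 * M + c') * (s + s^-1 * n2 g).
  move=> bg s0; have ig := bddm_intgr (bddm_sqr bg).
  have n2g0 : 0 <= n2 g by exact: Rint_sqr_ge0.
  have sg0 : 0 <= s^-1 * n2 g by rewrite mulr_ge0 // invr_ge0 ltW.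
  have H1 := ext_bound M0 LRb LRlin LR1 LRbound bg s0.
  have H2 : `|I (fun x => phi x * g x)| <= c' * (s + s^-1 * n2 g).
    have pw x : `|phi x| <= c -> `|phi x * g x| <= c' * s + c' * s^-1 * (g x ^+ 2).
      move=> px; rewrite normrM.
      have gx : `|g x| <= s + s^-1 * g x ^+ 2.
        have : 0 <= s^-1 * (s - `|g x|) ^+ 2 by rewrite mulr_ge0 ?sqr_ge0 // invr_ge0 ltW.
        have -> : s^-1 * (s - `|g x|) ^+ 2 = s - 2 * `|g x| + s^-1 * `|g x| ^+ 2.
          by field; rewrite gt_eqF.
        by rewrite real_normK ?num_real //; have := normr_ge0 (g x); lra.
      have pc : `|phi x| <= c' by rewrite /c'; have := ler_norm c; lra.
      have : `|phi x| * `|g x| <= c' * (s + s^-1 * g x ^+ 2) by rewrite ler_pM.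
      lra.
    have iR : intgr mu (fun x => c' * s + c' * s^-1 * (g x ^+ 2)).
      by apply: intgrD; [exact/bddm_intgr/bddm_cst|exact: intgrZ].
    have IR : I (fun x => c' * s + c' * s^-1 * (g x ^+ 2)) = c' * (s + s^-1 * n2 g).
      rewrite RintD ?Rint_cst ?RintZ //; first by lra.
        exact/bddm_intgr/bddm_cst.
      exact: intgrZ.
    rewrite -IR; apply: le_trans (le_normr_Rintegral measurableT (iphi _ bg)) _.
    apply: ae_le_Rint => //; first exact: integrable_abse (iphi _ bg).
    by apply: filterS phic => x; exact: pw.
  apply: le_trans (ler_normB _ _) _.
  have M2 : 0 <= M * s by rewrite mulr_ge0 // ltW.
  lra.
have Lam0 : Lam h = 0.
  have [mh [K hK]] := LRb Hh; pose L : R := `|K| + 1.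
  have L0 : 0 < L by rewrite /L; have := normr_ge0 K; lra.
  have M2c : 0 <= (2 * M + c') * (1 + 4 * L ^+ 2).
    by rewrite mulr_ge0 //; have := sqr_ge0 L; lra.
  apply: (@eq0_norm_le_eps _ ((2 * M + c') * (1 + 4 * L ^+ 2))) => // e e0.
  have [n /ltW ne] : exists n : nat, (n.+1%:R)^-1 < e.
    have /cvgrPdist_lt/(_ _ e0)[n _ /(_ n (leqnn n))] := @cvg_harmonic R.
    rewrite sub0r normrN /= ger0_norm ?invr_ge0 // => ?; by exists n.
  apply: le_trans (ler_wpM2l M2c ne).
  set N : R := n.+1%:R; have N0 : 0 < N by rewrite ltr0n.
  (* [u] carries [[-L, L]] onto [[0, N]], so counting the integer thresholds below [u] approximates
     [h] within [2 * L / N] after scaling back. *)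
  pose u x := N * (h x + L) / (2 * L).
  have mu_ : measurable_fun setT u.
    apply: measurable_funM; last exact: measurable_cst.
    apply: measurable_funM; first exact: measurable_cst.
    by apply: measurable_funD.
  pose E (j : 'I_n.+1) := [set x | j.+1%:R <= u x].
  have mE j : measurable (E j).
    rewrite (_ : E j = u @^-1` `[j.+1%:R, +oo[) //; last first.
      by apply/seteqP; split => x; rewrite /E /= in_itv /= andbT.
    by rewrite -[_ @^-1` _]setTI; apply: mu_.
  have Lam_sum (s : seq 'I_n.+1) : dens mu LR (fun x => \sum_(j <- s) \1_(E j) x) /\
      Lam (fun x => \sum_(j <- s) \1_(E j) x) = 0.
    elim: s => [|j s [IHd IH]].
      rewrite (_ : (fun x => _) = \1_set0); first by split; [exact: densI|exact: LamI].
      by apply/funext => x; rewrite big_nil indic0.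
    rewrite (_ : (fun x => _) = (fun x => 1 * \1_(E j) x + \sum_(j <- s) \1_(E j) x)); last first.
      by apply/funext => x; rewrite big_cons mul1r.
    split; first by apply: dens_lin => //; exact: densI.
    by rewrite Lam_lin // ?LamI ?IH ?mulr0 ?addr0 //; exact: densI.
  (* The constant [- L] is written with [\1_setT], so that [sg] is a combination of indicators and
     [Lam] annihilates it. *)
  pose sg x : R := (2 * L / N) * \sum_(j <- index_enum 'I_n.+1) \1_(E j) x + - L * \1_setT x.
  have dT : dens mu LR (fun x => - L * \1_setT x + \1_set0 x) by apply: dens_lin => //; exact: densI.
  have dsg : dens mu LR sg /\ Lam sg = 0.
    have [d1 l1] := Lam_sum (index_enum 'I_n.+1).
    have d2 : dens mu LR (fun x => - L * (\1_setT x : R)) /\ Lam (fun x => - L * (\1_setT x : R)) = 0.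
      rewrite (_ : (fun x => _) = (fun x => - L * \1_setT x + \1_set0 x)).
        by split => //; rewrite Lam_lin ?LamI ?mulr0 ?addr0 //; exact: densI.
      by apply/funext => x; rewrite indic0 addr0.
    case: d2 => d2 l2; split; first exact: dens_lin.
    by rewrite /sg Lam_lin // l1 l2 mulr0 addr0.
  case: dsg => dsg lsg.
  have dh := LR_dens LRb Hh.
  have bh := LRb Hh; have [bs _] := dsg.
  have dd := dens_lin LRb LRlin (-1) dsg dh.
  have -> : Lam h = Lam (fun x => -1 * sg x + h x) by rewrite Lam_lin // lsg mulr0 add0r.
  have [bd _] := dd.
  (* With parameter [N^-1] the estimate becomes [N^-1 + N * (2 * L / N) ^+ 2 = (1 + 4 * L ^+ 2) /
     N]. *)
  have Ni : 0 < N^-1 by rewrite invr_gt0.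
  apply: le_trans (Lam_bound _ _ bd Ni) _.
  rewrite -[leRHS]mulrA; apply: ler_wpM2l; first by rewrite addr_ge0; lra.
  rewrite invrK.
  suff H : n2 (fun x => -1 * sg x + h x) <= (2 * L / N) ^+ 2.
    have : N * n2 (fun x => -1 * sg x + h x) <= N * (2 * L / N) ^+ 2 by rewrite ler_pM2l.
    have -> : N * (2 * L / N) ^+ 2 = 4 * L ^+ 2 * N^-1 by field; rewrite gt_eqF.
    by move=> H'; rewrite [leRHS]mulrDl mul1r; apply: lerD.
  rewrite -[leRHS](Rint_cst mu).
  apply: ae_le_Rint; [exact/bddm_intgr/bddm_sqr|exact/bddm_intgr/bddm_cst|].
  apply: filterS hK => x hx.
  have hL : `|h x| <= L by rewrite /L; have := ler_norm K; lra.
  move: hL; rewrite ler_norml => /andP[hl hr].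
  have u0 : 0 <= u x by rewrite /u divr_ge0 ?mulr_ge0 //; lra.
  have uN : u x <= N by rewrite /u ler_pdivrMr ?ler_pM2l //; lra.
  have [] := layer_cake n.+1 u0; rewrite -/N.
  have SE : \sum_(j < n.+1) ((j.+1%:R <= u x)%R%:R : R) = \sum_(j <- index_enum 'I_n.+1) \1_(E j) x.
    apply: eq_bigr => j _; rewrite indicE; congr (_%:R); congr nat_of_bool.
    by apply/idP/idP => [?|/set_mem //]; exact/mem_set.
  rewrite SE; set S := \sum_(j <- _) _ => Su [SN Sx].
  have Sd : `|u x - S| <= 1 by rewrite ler_norml; case: Sx; lra.
  have -> : -1 * sg x + h x = (2 * L / N) * (u x - S).
    rewrite /sg -/S /u indicE in_setT /=; field.
    by rewrite !gt_eqF.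
  rewrite exprMn ler_piMr ?sqr_ge0 //.
  by rewrite -real_normK ?num_real // exprn_ile1.
by move: Lam0; rewrite /Lam (ext_LR M0 LRb LRlin LRbound Hh) => /eqP; rewrite subr_eq0 => /eqP.
Qed.

End Representation.

(** * Real and imaginary parts and the squared modulus *)

Section ComplexNumbers.
Variable R : realType.
Local Notation C := R[i].
Implicit Types z w : C.

Lemma cabs2_ge0 z : 0 <= cabs2 z.
Proof. by rewrite addr_ge0 ?sqr_ge0. Qed.

Lemma cabs2M z w : cabs2 (z * w) = cabs2 z * cabs2 w.
Proof. by case: z => a b; case: w => c d; rewrite /cabs2 /=; ring. Qed.

Lemma cabs2D z w : cabs2 (z + w) <= 2 * cabs2 z + 2 * cabs2 w.
Proof.
case: z => a b; case: w => c d; rewrite /cabs2 /=.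
by have := sqr_ge0 (a - c); have := sqr_ge0 (b - d); lra.
Qed.

Lemma cabs2J z : cabs2 (conjc z) = cabs2 z.
Proof. by case: z => a b; rewrite /cabs2 /= sqrrN. Qed.

Lemma cabs20 : cabs2 (0 : C) = 0.
Proof. by rewrite /cabs2 /= !expr0n addr0. Qed.

Lemma mulcJE z : z * conjc z = Complex (cabs2 z) 0.
Proof. by case: z => a b; rewrite /cabs2; apply/eqP; rewrite eq_complex /=; apply/andP; split; apply/eqP; ring. Qed.

(** Indexing the two real coordinates by a boolean lets one argument treat both. *)
Definition part (b : bool) z := if b then complex.Re z else complex.Im z.

Lemma partD b z w : part b (z + w) = part b z + part b w.
Proof. by case: z => ? ?; case: w => ? ?; case: b. Qed.

Lemma part0 b : part b (0 : C) = 0. Proof. by case: b. Qed.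

Lemma part_realM b (c : R) z : part b (Complex c 0 * z) = c * part b z.
Proof. by case: z => x y; case: b => /=; ring. Qed.

Lemma part_sum b (J : Type) (s : seq J) (F : J -> C) :
  part b (\sum_(j <- s) F j) = \sum_(j <- s) part b (F j).
Proof. exact: (big_morph (part b) (partD b) (part0 b)). Qed.

Lemma part_mulJ_le b z w (s : R) : 0 < s ->
  `|part b (z * conjc w)| <= s * cabs2 z + s^-1 * cabs2 w.
Proof.
move=> s0; have si : 0 < s^-1 by rewrite invr_gt0.
have key (x y : R) : `|x * y| <= 2^-1 * (s * x ^+ 2 + s^-1 * y ^+ 2).
  have : 0 <= s^-1 * (s * `|x| - `|y|) ^+ 2 by rewrite mulr_ge0 ?sqr_ge0 // ltW.
  have -> : s^-1 * (s * `|x| - `|y|) ^+ 2 = s * `|x| ^+ 2 - 2 * (`|x| * `|y|) + s^-1 * `|y| ^+ 2.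
    by field; rewrite gt_eqF.
  by rewrite !real_normK ?num_real // normrM; lra.
case: z => a b'; case: w => c d; rewrite /cabs2 /=.
have K1 := key a c; have K2 := key b' d; have K3 := key a d; have K4 := key b' c.
have p1 : 0 <= s * a ^+ 2 by rewrite mulr_ge0 ?sqr_ge0 // ltW.
have p2 : 0 <= s * b' ^+ 2 by rewrite mulr_ge0 ?sqr_ge0 // ltW.
have p3 : 0 <= s^-1 * c ^+ 2 by rewrite mulr_ge0 ?sqr_ge0 // ltW.
have p4 : 0 <= s^-1 * d ^+ 2 by rewrite mulr_ge0 ?sqr_ge0 // ltW.
case: b => /=.
  rewrite mulrN opprK; apply: le_trans (ler_normD _ _) _; lra.
rewrite mulrN addrC; apply: le_trans (ler_normB _ _) _; lra.
Qed.

Lemma complex_ext z w : (forall b, part b z = part b w) -> z = w.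
Proof. move=> H; apply/eqP; rewrite eq_complex.
by rewrite -!/(part true _) -!/(part false _) !H !eqxx. Qed.

End ComplexNumbers.

(** * The spaces [L^2], [L^oo] and the Hardy space *)

Section HardyBasics.
Variables (R : realType) (D : cartan).
Local Notation C := R[i].
Local Notation T := (Cspace R D).
Variable mu : probability T R.
Implicit Types f g h : T -> C.
Local Notation part := (@part R).

Lemma cmeasP f : cmeasurable f <-> forall b, measurable_fun setT (fun x => part b (f x)).
Proof. by split=> [[h1 h2] []|h] //; split; [exact: (h true)|exact: (h false)]. Qed.

Lemma cmeas_cst c : cmeasurable (fun _ : T => c).
Proof. by split; exact: measurable_cst. Qed.

Lemma cmeasD f g : cmeasurable f -> cmeasurable g -> cmeasurable (fun x => f x + g x).
Proof.
move=> /cmeasP hf /cmeasP hg; apply/cmeasP => b.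
under eq_fun do rewrite partD; exact: measurable_funD.
Qed.

Lemma ReM (z w : C) : complex.Re (z * w) =
  complex.Re z * complex.Re w - complex.Im z * complex.Im w.
Proof. by case: z; case: w. Qed.

Lemma ImM (z w : C) : complex.Im (z * w) =
  complex.Re z * complex.Im w + complex.Im z * complex.Re w.
Proof. by case: z; case: w. Qed.

Lemma cmeasM f g : cmeasurable f -> cmeasurable g -> cmeasurable (fun x => f x * g x).
Proof.
move=> [f1 f2] [g1 g2]; split.
  by under eq_fun do rewrite ReM; apply: measurable_funB; exact: measurable_funM.
by under eq_fun do rewrite ImM; apply: measurable_funD; exact: measurable_funM.
Qed.

Lemma cmeasJ f : cmeasurable f -> cmeasurable (fun x => conjc (f x)).
Proof.
move=> [f1 f2]; split.
  by rewrite (_ : (fun x => _) = (fun x => complex.Re (f x))) //; apply/funext => x; case: (f x).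
rewrite (_ : (fun x => _) = (fun x => 0 - complex.Im (f x))).
  by apply: measurable_funB.
by apply/funext => x; case: (f x) => a b /=; rewrite sub0r.
Qed.

Lemma cmeas_cabs2 f : cmeasurable f -> measurable_fun setT (fun x => cabs2 (f x)).
Proof.
move=> [f1 f2]; rewrite /cabs2; under eq_fun do rewrite !expr2.
by apply: measurable_funD; exact: measurable_funM.
Qed.

Lemma isL2P f : isL2 mu f <-> cmeasurable f /\ intgr mu (fun x => cabs2 (f x)).
Proof.
have E : (\int[mu]_x `|(cabs2 (f x))%:E| = \int[mu]_x (cabs2 (f x))%:E)%E.
  by apply: eq_integral => x _; rewrite gee0_abs // lee_fin cabs2_ge0.
split=> -[mf H]; split => //.
  apply/integrableP; split; last by rewrite E.
  by apply/measurable_EFinP; exact: cmeas_cabs2.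
by case/integrableP: H => _; rewrite E.
Qed.

Lemma isL2_lin (a : C) f g : isL2 mu f -> isL2 mu g -> isL2 mu (fun x => a * f x + g x).
Proof.
move=> /isL2P[mf If] /isL2P[mg Ig]; apply/isL2P.
have ma := cmeasD (cmeasM (cmeas_cst a) mf) mg; split => //.
apply: (@intgr_dom _ _ _ _ _ (fun x => 2 * cabs2 a * cabs2 (f x) + 2 * cabs2 (g x))).
- exact: cmeas_cabs2.
- by apply: intgrD; apply: intgrZ.
- apply: aeW => x; rewrite ger0_norm ?cabs2_ge0 // -mulrA -cabs2M.
  exact: cabs2D.
Qed.

Lemma isL2M (phi f : T -> C) : isLinf mu phi -> isL2 mu f -> isL2 mu (fun x => phi x * f x).
Proof.
move=> [mp [c pc]] /isL2P[mf If]; apply/isL2P; split; first exact: cmeasM.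
apply: (@intgr_dom _ _ _ _ _ (fun x => c * cabs2 (f x))).
- by apply: cmeas_cabs2; exact: cmeasM.
- exact: intgrZ.
- apply: filterS pc => x px; rewrite ger0_norm ?cabs2_ge0 // cabs2M.
  by rewrite ler_wpM2r ?cabs2_ge0.
Qed.

Lemma norm2M (phi f : T -> C) (c : R) : isLinf mu phi -> {ae mu, forall x, cabs2 (phi x) <= c} ->
  isL2 mu f -> norm2 mu (fun x => phi x * f x) <= c * norm2 mu f.
Proof.
move=> hp pc hf; have /isL2P[_ I1] := isL2M hp hf; have /isL2P[_ I2] := hf.
rewrite -RintZ //; apply: ae_le_Rint => //; first exact: intgrZ.
by apply: filterS pc => x px; rewrite cabs2M ler_wpM2r ?cabs2_ge0.
Qed.

Lemma norm2_lin (a : C) f g : isL2 mu f -> isL2 mu g ->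
  norm2 mu (fun x => a * f x + g x) <= 2 * cabs2 a * norm2 mu f + 2 * norm2 mu g.
Proof.
move=> hf hg; have /isL2P[_ I1] := isL2_lin a hf hg.
have /isL2P[_ I2] := hf; have /isL2P[_ I3] := hg.
rewrite -!RintZ // -RintD; do ?exact: intgrZ.
apply: ae_le_Rint => //; first by apply: intgrD; exact: intgrZ.
by apply: aeW => x; rewrite -mulrA -cabs2M; exact: cabs2D.
Qed.

Lemma norm2_ge0 f : 0 <= norm2 mu f.
Proof. by apply: Rintegral_ge0 => x _; exact: cabs2_ge0. Qed.

Lemma LinfM f g : isLinf mu f -> isLinf mu g -> isLinf mu (fun x => f x * g x).
Proof.
move=> [mf [c fc]] [mg [c' gc]]; split; first exact: cmeasM.
exists (c * c'); apply: filterS2 fc gc => x fx gx.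
by rewrite cabs2M ler_pM ?cabs2_ge0.
Qed.

Lemma LinfD f g : isLinf mu f -> isLinf mu g -> isLinf mu (fun x => f x + g x).
Proof.
move=> [mf [c fc]] [mg [c' gc]]; split; first exact: cmeasD.
exists (2 * c + 2 * c'); apply: filterS2 fc gc => x fx gx.
by apply: le_trans (cabs2D _ _) _; lra.
Qed.

Lemma Linf_cst c : isLinf mu (fun=> c).
Proof. by split; [exact: cmeas_cst|exists (cabs2 c); apply: aeW]. Qed.

Lemma LinfJ f : isLinf mu f -> isLinf mu (fun x => conjc (f x)).
Proof.
move=> [mf [c fc]]; split; first exact: cmeasJ.
by exists c; apply: filterS fc => x; rewrite cabs2J.
Qed.

Lemma Linf_L2 f : isLinf mu f -> isL2 mu f.
Proof.
move=> hf; have h1 : isL2 mu (fun=> 1).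
  apply/isL2P; split; first exact: cmeas_cst.
  by apply: bddm_intgr; exact: bddm_cst.
by have := isL2M hf h1; rewrite (_ : (fun x => _) = f) //; apply/funext => x; rewrite mulr1.
Qed.

Definition cintg f := forall b, intgr mu (fun x => part b (f x)).

Lemma cintE b f : part b (cint mu f) = Rintegral mu setT (fun x => part b (f x)).
Proof. by case: b. Qed.

Lemma cintD f g : cintg f -> cintg g -> cint mu (fun x => f x + g x) = cint mu f + cint mu g.
Proof.
move=> hf hg; apply: complex_ext => b; rewrite partD !cintE.
by under eq_fun do rewrite partD; rewrite RintD.
Qed.

Lemma cintgZ (a : C) f : cintg f -> cintg (fun x => a * f x).
Proof.
move=> hf; have h1 := hf true; have h2 := hf false; case: a => a1 a2 [].
  rewrite (_ : (fun x => _) = (fun x => a1 * part true (f x) + (- a2) * part false (f x))).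
    by apply: intgrD; exact: intgrZ.
  by apply/funext => x; case: (f x) => u v /=; ring.
rewrite (_ : (fun x => _) = (fun x => a1 * part false (f x) + a2 * part true (f x))).
  by apply: intgrD; exact: intgrZ.
by apply/funext => x; case: (f x) => u v /=; ring.
Qed.

Lemma cintZ (a : C) f : cintg f -> cint mu (fun x => a * f x) = a * cint mu f.
Proof.
move=> hf; have h1 := hf true; have h2 := hf false; case: a => a1 a2.
have E b (u v : R) (k : C) : (forall x, part b (k * f x) = u * part true (f x) + v * part false (f x)) ->
    part b (cint mu (fun x => k * f x)) = u * part true (cint mu f) + v * part false (cint mu f).
  move=> H; rewrite !cintE; under eq_fun do rewrite H.
  by rewrite RintD ?RintZ //; exact: intgrZ.
apply: complex_ext => -[].
  rewrite (E _ a1 (- a2)); first by case: (cint mu f) => u v /=; ring.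
  by move=> x; case: (f x) => u v /=; ring.
rewrite (E _ a2 a1); first by case: (cint mu f) => u v /=; ring.
by move=> x; case: (f x) => u v /=; ring.
Qed.

Lemma cint_ae f g : cmeasurable f -> cmeasurable g -> Defs.ae_eq mu f g -> cint mu f = cint mu g.
Proof.
move=> /cmeasP mf /cmeasP mg fg; apply: complex_ext => b; rewrite !cintE.
by apply: ae_eq_Rint => //; apply: filterS fg => x ->.
Qed.

Lemma cintg_mulJ f g : isL2 mu f -> isL2 mu g -> cintg (fun x => f x * conjc (g x)).
Proof.
move=> /isL2P[mf If] /isL2P[mg Ig] b.
have /cmeasP mfg := cmeasM mf (cmeasJ mg).
apply: (@intgr_dom _ _ _ _ _ (fun x => cabs2 (f x) + cabs2 (g x))) => //.
  exact: intgrD.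
by apply: aeW => x; have := @part_mulJ_le _ b (f x) (g x) 1 ltr01; rewrite invr1 !mul1r.
Qed.

Lemma inner_linl (a : C) f g h : isL2 mu f -> isL2 mu g -> isL2 mu h ->
  inner mu (fun x => a * f x + g x) h = a * inner mu f h + inner mu g h.
Proof.
move=> hf hg hh; have i1 := cintg_mulJ hf hh; have i2 := cintg_mulJ hg hh.
rewrite /inner -cintZ // -cintD //; last exact: cintgZ.
by congr cint; apply/funext => x; rewrite mulrDl mulrA.
Qed.

Lemma inner_linr (a : C) f g h : isL2 mu f -> isL2 mu g -> isL2 mu h ->
  inner mu h (fun x => a * f x + g x) = conjc a * inner mu h f + inner mu h g.
Proof.
move=> hf hg hh; have i1 := cintg_mulJ hh hf; have i2 := cintg_mulJ hh hg.
rewrite /inner -cintZ // -cintD //; last exact: cintgZ.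
by congr cint; apply/funext => x; rewrite rmorphD rmorphM /=; ring.
Qed.

Lemma inner_bound b f g (s : R) : 0 < s -> isL2 mu f -> isL2 mu g ->
  `|part b (inner mu f g)| <= s * norm2 mu f + s^-1 * norm2 mu g.
Proof.
move=> s0 hf hg; have i1 := cintg_mulJ hf hg b.
have /isL2P[_ If] := hf; have /isL2P[_ Ig] := hg.
rewrite cintE; apply: le_trans (le_normr_Rintegral measurableT i1) _.
rewrite -!RintZ // -RintD; do ?exact: intgrZ.
apply: ae_le_Rint; first exact: integrable_abse i1.
  by apply: intgrD; exact: intgrZ.
by apply: aeW => x; exact: part_mulJ_le.
Qed.

Lemma inner_ae f f' g g' : isL2 mu f -> isL2 mu f' -> isL2 mu g -> isL2 mu g' ->
  Defs.ae_eq mu f f' -> Defs.ae_eq mu g g' -> inner mu f g = inner mu f' g'.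
Proof.
move=> [mf _] [mf' _] [mg _] [mg' _] ff gg; apply: cint_ae.
- by apply: cmeasM => //; exact: cmeasJ.
- by apply: cmeasM => //; exact: cmeasJ.
- by apply: filterS2 ff gg => x -> ->.
Qed.

Lemma coord_meas (i : 'I_(cp D)) (j : 'I_(cq D)) : cmeasurable (fun x : T => x i j).
Proof.
split=> _ B mB; rewrite setTI; apply: sub_sigma_algebra.
  by exists i, j, B; split => //; left.
by exists i, j, B; split => //; right.
Qed.

Hypothesis coord_bd : exists c : R, {ae mu, forall x : T, forall i j, cabs2 (x i j) <= c}.

Lemma poly_Linf (p : T -> C) : is_polyfun p -> isLinf mu p.
Proof.
elim=> [c|i j|f g _ hf _ hg|f g _ hf _ hg].
- exact: Linf_cst.
- split; first exact: coord_meas.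
  by case: coord_bd => c hc; exists c; apply: filterS hc => x.
- exact: LinfD.
- exact: LinfM.
Qed.

Lemma isH2_L2 f : isH2 mu f -> isL2 mu f. Proof. by case. Qed.

Lemma poly_H2 (p : T -> C) : is_polyfun p -> isH2 mu p.
Proof.
move=> hp; split; first by apply: Linf_L2; exact: poly_Linf.
exists (fun=> p); split => //.
rewrite (_ : (fun n : nat => _) = fun=> 0); first exact: cvg_cst.
apply/funext => n; rewrite /norm2 -[RHS](Rint_cst mu); congr Rintegral.
by apply/funext => x; rewrite subrr cabs20.
Qed.

Lemma H2_lin (a : C) f g : isH2 mu f -> isH2 mu g -> isH2 mu (fun x => a * f x + g x).
Proof.
move=> [f2 [P [hP cP]]] [g2 [Q [hQ cQ]]]; split; first exact: isL2_lin.
exists (fun n x => a * P n x + Q n x); split.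
  by move=> n; apply: pf_add => //; apply: pf_mul => //; exact: pf_const.
apply: (@squeeze_cvgr _ _ _ _ (fun=> 0) (fun n => 2 * cabs2 a * norm2 mu (fun x => f x - P n x) +
   2 * norm2 mu (fun x => g x - Q n x))).
- apply: nearW => n; rewrite norm2_ge0 /=.
  have pL p k : is_polyfun p -> isL2 mu k -> isL2 mu (fun x => k x - p x).
    move=> hp hk; rewrite (_ : (fun x => _) = (fun x => (-1) * p x + k x)).
      by apply: isL2_lin => //; apply: Linf_L2; exact: poly_Linf.
    by apply/funext => x; rewrite mulN1r addrC.
  have := norm2_lin a (pL _ _ (hP n) f2) (pL _ _ (hQ n) g2); apply: le_trans.
  rewrite le_eqVlt; apply/orP; left; apply/eqP; congr norm2; apply/funext => x; ring.
- exact: cvg_cst.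
- rewrite -[X in _ --> X]addr0 -[X in _ --> X + _](mulr0 (2 * cabs2 a)) -[X in _ --> _ + X](mulr0 2).
  by apply: cvgD; apply: cvgM => //; exact: cvg_cst.
Qed.

Lemma H2_polyM (p f : T -> C) : is_polyfun p -> isH2 mu f -> isH2 mu (fun x => p x * f x).
Proof.
move=> hp [f2 [P [hP cP]]]; have lp := poly_Linf hp; split; first exact: isL2M.
exists (fun n x => p x * P n x); split; first by move=> n; exact: pf_mul.
have [_ [c pc]] := lp.
apply: (@squeeze_cvgr _ _ _ _ (fun=> 0) (fun n => c * norm2 mu (fun x => f x - P n x))).
- apply: nearW => n; rewrite norm2_ge0 /=.
  have h1 : isL2 mu (fun x => f x - P n x).
    rewrite (_ : (fun x => _) = (fun x => (-1) * P n x + f x)).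
      by apply: isL2_lin => //; apply: Linf_L2; exact: poly_Linf.
    by apply/funext => x; rewrite mulN1r addrC.
  have := norm2M lp pc h1; apply: le_trans.
  by rewrite le_eqVlt; apply/orP; left; apply/eqP; congr norm2; apply/funext => x; ring.
- exact: cvg_cst.
- by rewrite -[X in _ --> X](mulr0 c); apply: cvgM => //; exact: cvg_cst.
Qed.

End HardyBasics.

(** * Trading trigonometric polynomials for analytic families *)

Section WordFamilies.
#[local] Arguments conjc : simpl never.
Variables (R : realType) (D : cartan).
Local Notation C := R[i].
Local Notation T := (Cspace R D).

Record pol := Pol { pfun :> T -> C ; polP : is_polyfun pfun }.

Definition pcst c := Pol (pf_const D c).
Definition padd (p q : pol) := Pol (pf_add (polP p) (polP q)).
Definition pmul (p q : pol) := Pol (pf_mul (polP p) (polP q)).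
Definition pscale c p := pmul (pcst c) p.

Variables (S : set T) (m : nat) (A : 'I_m -> pol).
Hypothesis A1 : forall x, S x -> \sum_(i < m) A i x * conjc (A i x) = 1.
Hypothesis coordA : forall i j, exists c : 'I_m -> C, forall x, S x ->
  x i j = \sum_(k < m) c k * A k x.

(* Sesquilinear forms that only see the restrictions to [S] and are fixed by
   [B |-> \sum_i B (A i * _) (A i * _)]. *)
Record good (B : pol -> pol -> C) : Prop := Good {
  BDl : forall f g h, B (padd f g) h = B f h + B g h ;
  BZl : forall a f h, B (pscale a f) h = a * B f h ;
  BDr : forall f g h, B h (padd f g) = B h f + B h g ;
  BZr : forall a f h, B h (pscale a f) = conjc a * B h f ;
  BS : forall f f' g g' : pol, (forall x, S x -> f x = f' x) ->
        (forall x, S x -> g x = g' x) -> B f g = B f' g' ;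
  Binv : forall f g, \sum_(i < m) B (pmul (A i) f) (pmul (A i) g) = B f g
}.

(** Identities proved for the first argument of every good form transfer to the second one; see
    [rep_fam_swp]. *)
Lemma good_flip B : good B -> good (fun f g => conjc (B g f)).
Proof.
move=> hB; split.
- by move=> f g h; rewrite (BDr hB) rmorphD.
- by move=> a f h; rewrite (BZr hB) rmorphM /= conjcK.
- by move=> f g h; rewrite (BDl hB) rmorphD.
- by move=> a f h; rewrite (BZl hB) rmorphM.
- by move=> f f' g g' ff gg; rewrite (BS hB gg ff).
- by move=> f g; rewrite -[in RHS](Binv hB) rmorph_sum.
Qed.

Definition trig := seq (pol * pol).
Implicit Types t w : trig.

Definition ev t x := \sum_(p <- t) p.1 x * conjc (p.2 x).
(** Formally the value of [B] on [t * f * conj g]. The slots [f] and [g] stay free because products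
    of families put the factors of one family into the slots of the other. *)
Definition bt (B : pol -> pol -> C) t f g := \sum_(p <- t) B (pmul p.1 f) (pmul p.2 g).
Definition swp t : trig := [seq (p.2, p.1) | p <- t].
Definition tmul t1 t2 : trig := [seq (pmul p.1 q.1, pmul p.2 q.2) | p <- t1, q <- t2].

Lemma ev_swp t x : ev (swp t) x = conjc (ev t x).
Proof.
rewrite /ev big_map rmorph_sum; apply: eq_bigr => p _ /=.
by rewrite rmorphM /= conjcK mulrC.
Qed.

Lemma ev_cat t1 t2 x : ev (t1 ++ t2) x = ev t1 x + ev t2 x.
Proof. exact: big_cat. Qed.

Lemma ev_tmul t1 t2 x : ev (tmul t1 t2) x = ev t1 x * ev t2 x.
Proof.
rewrite /ev /tmul big_allpairs_dep /= big_distrlr /=; apply: eq_bigr => p _; apply: eq_bigr => q _.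
by rewrite rmorphM /=; ring.
Qed.

Lemma bt_cat B t1 t2 f g : bt B (t1 ++ t2) f g = bt B t1 f g + bt B t2 f g.
Proof. exact: big_cat. Qed.

Lemma bt_swp B t f g : bt B (swp t) f g = conjc (bt (fun f g => conjc (B g f)) t g f).
Proof.
rewrite /bt big_map rmorph_sum; apply: eq_bigr => p _ /=.
by rewrite conjcK.
Qed.

Lemma bt_tmul B t1 t2 f g : good B ->
  bt B (tmul t1 t2) f g = \sum_(p <- t1) bt B t2 (pmul p.1 f) (pmul p.2 g).
Proof.
move=> hB; rewrite /bt /tmul big_allpairs_dep /=; apply: eq_bigr => p _; apply: eq_bigr => q _.
by apply: (BS hB) => x _ /=; ring.
Qed.

Definition unit_fam w := forall x, S x -> \sum_(k <- w) k.1 x * conjc (k.1 x) = 1.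
Definition near_fam t e w := forall x, S x -> \sum_(k <- w) cabs2 (k.2 x - ev t x * k.1 x) <= e.
Definition inv_fam w := forall B, good B -> forall f g,
  \sum_(k <- w) B (pmul k.1 f) (pmul k.1 g) = B f g.
(** Formally the sum of [p * conj a] is [t]. The identity is exact although [p] is only near
    [t * a], and it holds for all good forms at once, so it may be applied to the flipped form. *)
Definition rep_fam t w := forall B, good B -> forall f g,
  \sum_(k <- w) B (pmul k.2 f) (pmul k.1 g) = bt B t f g.

(* [w] lists pairs [(a, p)] with [p] close to [ev t * a]: a trigonometric
   polynomial is traded for analytic ones. *)
Definition approximable t := forall e : R, 0 < e -> exists w,
  [/\ unit_fam w, near_fam t e w, inv_fam w & rep_fam t w].

Lemma rep_fam_swp t w : rep_fam t w -> forall B, good B -> forall f g,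
  \sum_(k <- w) B (pmul k.1 f) (pmul k.2 g) = bt B (swp t) f g.
Proof.
move=> H B hB f g; rewrite bt_swp -(H _ (good_flip hB)) rmorph_sum.
by apply: eq_bigr => k _; rewrite /= conjcK.
Qed.

Lemma approx_equiv t t' : (forall x, S x -> ev t x = ev t' x) ->
  (forall B, good B -> forall f g, bt B t f g = bt B t' f g) -> approximable t -> approximable t'.
Proof.
move=> He Hb H e e0; have [w [h1 h2 h3 h4]] := H e e0; exists w; split => //.
  by move=> x Sx; rewrite -He //; exact: h2.
by move=> B hB f g; rewrite -Hb // h4.
Qed.

Lemma sum_cabs2 (J : Type) (s : seq J) (F : J -> C) :
  Complex (\sum_(k <- s) cabs2 (F k)) 0 = \sum_(k <- s) F k * conjc (F k).
Proof.
elim: s => [|k s IH]; first by rewrite !big_nil.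
by rewrite !big_cons -IH mulcJE; apply/eqP; rewrite eq_complex /= addr0 !eqxx.
Qed.

Lemma unit_famR w x : unit_fam w -> S x -> \sum_(k <- w) cabs2 (k.1 x) = 1.
Proof. by move=> hw Sx; have := hw x Sx; rewrite -sum_cabs2 => -[]. Qed.

Lemma approx_analytic u : approximable [:: (u, pcst 1)].
Proof.
move=> e e0; exists [:: (pcst 1, u)]; split.
- by move=> x _; rewrite big_seq1 /= conjc1 mulr1.
- move=> x _; rewrite /ev !big_seq1 /= conjc1 !mulr1 subrr cabs20; exact: ltW.
- by move=> B hB f g; rewrite big_seq1 /=; apply: (BS hB) => x _ /=; rewrite mul1r.
- by move=> B hB f g; rewrite /bt !big_seq1 /=.
Qed.

Lemma bt_inv w t B f g : good B -> inv_fam w ->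
  \sum_(l <- w) bt B t (pmul l.1 f) (pmul l.1 g) = bt B t f g.
Proof.
move=> hB hw; rewrite /bt exchange_big; apply: eq_bigr => p _ /=.
rewrite -[RHS](hw _ hB); apply: eq_bigr => l _.
by apply: (BS hB) => x _ /=; ring.
Qed.

Lemma bt_rep w t t2 B f g : good B -> rep_fam t2 w ->
  \sum_(l <- w) bt B t (pmul l.2 f) (pmul l.1 g) = bt B (tmul t t2) f g.
Proof.
move=> hB hw; rewrite bt_tmul // /bt exchange_big; apply: eq_bigr => p _ /=.
rewrite -[RHS](hw _ hB); apply: eq_bigr => l _.
by apply: (BS hB) => x _ /=; ring.
Qed.

Lemma sum_mul (J J' : Type) (s : seq J) (s' : seq J') (F : J -> R) (G : J' -> R) :
  \sum_(k <- s) \sum_(l <- s') F k * G l = (\sum_(k <- s) F k) * \sum_(l <- s') G l.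
Proof. by rewrite big_distrlr. Qed.

Lemma unit_fam_tmul (F : pol * pol -> pol * pol -> pol) w1 w2 : unit_fam w1 -> unit_fam w2 ->
  unit_fam [seq (pmul k.1 l.1, F k l) | k <- w1, l <- w2].
Proof.
move=> h1 h2 x Sx; rewrite big_allpairs_dep /= -[RHS]mulr1 -{1}(h1 x Sx) -(h2 x Sx).
rewrite big_distrlr /=; apply: eq_bigr => k _; apply: eq_bigr => l _.
by rewrite rmorphM /=; ring.
Qed.

Lemma inv_fam_tmul (F : pol * pol -> pol * pol -> pol) w1 w2 : inv_fam w1 -> inv_fam w2 ->
  inv_fam [seq (pmul k.1 l.1, F k l) | k <- w1, l <- w2].
Proof.
move=> h1 h2 B hB f g; rewrite big_allpairs_dep /= -[RHS](h1 _ hB); apply: eq_bigr => k _.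
rewrite -[RHS](h2 _ hB); apply: eq_bigr => l _.
by apply: (BS hB) => x _ /=; ring.
Qed.

(** For the sum take [a = a1 * a2] and [p = p1 * a2 + a1 * p2]. The factors 2 of [cabs2D] turn the
    two errors [e / 4] into [e]. *)
Lemma approx_cat t1 t2 : approximable t1 -> approximable t2 -> approximable (t1 ++ t2).
Proof.
move=> H1 H2 e e0; have e4 : 0 < e / 4 by lra.
have [w1 [a1 b1 c1 d1]] := H1 _ e4; have [w2 [a2 b2 c2 d2]] := H2 _ e4.
exists [seq (pmul k.1 l.1, padd (pmul k.2 l.1) (pmul k.1 l.2)) | k <- w1, l <- w2].
split; [exact: unit_fam_tmul| |exact: inv_fam_tmul|].
- move=> x Sx; rewrite big_allpairs_dep ev_cat /=.
  set h1 := ev t1 x; set h2 := ev t2 x.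
  apply: (@le_trans _ _ (\sum_(k <- w1) \sum_(l <- w2)
     (2 * cabs2 (k.2 x - h1 * k.1 x) * cabs2 (l.1 x) +
      2 * cabs2 (k.1 x) * cabs2 (l.2 x - h2 * l.1 x)))).
    apply: ler_sum => k _; apply: ler_sum => l _; rewrite -!mulrA -!cabs2M.
    apply: le_trans (cabs2D _ _).
    by rewrite le_eqVlt; apply/orP; left; apply/eqP; congr cabs2; ring.
  under eq_bigr do rewrite big_split /=.
  rewrite big_split /= !sum_mul -!mulr_sumr !unit_famR // !mulr1.
  by have := b1 x Sx; have := b2 x Sx; rewrite -/h1 -/h2; lra.
- move=> B hB f g; rewrite big_allpairs_dep bt_cat /=.
  transitivity (\sum_(k <- w1) \sum_(l <- w2)
    (B (pmul k.2 (pmul l.1 f)) (pmul k.1 (pmul l.1 g)) +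
     B (pmul k.1 (pmul l.2 f)) (pmul k.1 (pmul l.1 g)))).
    apply: eq_bigr => k _; apply: eq_bigr => l _; rewrite -(BDl hB).
    by apply: (BS hB) => x _ /=; ring.
  under eq_bigr do rewrite big_split /=.
  rewrite big_split /= exchange_big /= [X in _ + X = _]exchange_big /=; congr (_ + _).
    by under eq_bigr do rewrite (d1 _ hB); rewrite bt_inv.
  by under eq_bigr do rewrite (c1 _ hB); rewrite (d2 _ hB).
Qed.

(** On [S] each [A k] has modulus at most 1 by [A1], and the coordinates are linear combinations of
    the [A k]. *)
Lemma pol_bdS (p : pol) : exists2 K : R, 0 <= K & forall x, S x -> cabs2 (p x) <= K.
Proof.
case: p => f /=; elim=> [c|i j|{}f g _ [K K0 hK] _ [L L0 hL]|{}f g _ [K K0 hK] _ [L L0 hL]].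
- by exists (cabs2 c) => //; exact: cabs2_ge0.
- have [c hc] := coordA i j.
  suff H (s : seq 'I_m) : exists2 K : R, 0 <= K & forall x, S x -> cabs2 (\sum_(k <- s) c k * A k x) <= K.
    have [K K0 hK] := H (index_enum 'I_m); exists K => // x Sx.
    by rewrite hc //; exact: hK.
  elim: s => [|k s [K K0 hK]]; first by exists 0 => // x _; rewrite big_nil cabs20.
  exists (2 * cabs2 (c k) + 2 * K); first by rewrite addr_ge0 ?mulr_ge0 ?cabs2_ge0.
  move=> x Sx; rewrite big_cons; apply: le_trans (cabs2D _ _) _; apply: lerD.
    rewrite cabs2M ler_pM2l // ler_piMr ?cabs2_ge0 //.
    have := A1 Sx; rewrite -sum_cabs2 => -[<-].
    rewrite (bigD1 k) //= lerDl; apply: sumr_ge0 => i' _; exact: cabs2_ge0.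
  by rewrite ler_pM2l //; exact: hK.
- exists (2 * K + 2 * L); first by rewrite addr_ge0 ?mulr_ge0.
  move=> x Sx; apply: le_trans (cabs2D _ _) _.
  by have := hK x Sx; have := hL x Sx; lra.
- exists (K * L); first exact: mulr_ge0.
  by move=> x Sx; rewrite cabs2M ler_pM ?cabs2_ge0 //; [exact: hK|exact: hL].
Qed.

Lemma ev_bdS t : exists2 K : R, 0 <= K & forall x, S x -> cabs2 (ev t x) <= K.
Proof.
elim: t => [|[u v] t [K K0 hK]]; first by exists 0 => // x _; rewrite /ev big_nil cabs20.
have [U U0 hU] := pol_bdS u; have [V V0 hV] := pol_bdS v.
exists (2 * (U * V) + 2 * K); first by rewrite addr_ge0 ?mulr_ge0.
move=> x Sx; rewrite /ev big_cons; apply: le_trans (cabs2D _ _) _; apply: lerD.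
  by rewrite ler_pM2l // cabs2M cabs2J ler_pM ?cabs2_ge0 //; [exact: hU|exact: hV].
by rewrite ler_pM2l //; exact: hK.
Qed.

Lemma near_fam_norm t e w x : unit_fam w -> near_fam t e w -> S x ->
  \sum_(k <- w) cabs2 (k.2 x) <= 2 * cabs2 (ev t x) + 2 * e.
Proof.
move=> hu hn Sx; apply: (@le_trans _ _ (\sum_(k <- w)
   (2 * cabs2 (ev t x) * cabs2 (k.1 x) + 2 * cabs2 (k.2 x - ev t x * k.1 x)))).
  apply: ler_sum => k _; rewrite -mulrA -cabs2M; apply: le_trans (cabs2D _ _).
  by rewrite le_eqVlt; apply/orP; left; apply/eqP; congr cabs2; ring.
rewrite big_split /= -!mulr_sumr unit_famR // mulr1.
by have := hn x Sx; lra.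
Qed.

(** For the product take [a = a1 * a2] and [p = p1 * p2]; the error is [p1 * (p2 - h2 * a2) + h2 *
    (p1 - h1 * a1) * a2]. *)
Lemma approx_tmul t1 t2 : approximable t1 -> approximable t2 -> approximable (tmul t1 t2).
Proof.
move=> H1 H2 e e0.
have [K1 K10 hK1] := ev_bdS t1; have [K2 K20 hK2] := ev_bdS t2.
have k1 : 0 < 8 * (K1 + 1) by lra.
have k2 : 0 < 4 * (K2 + 1) by lra.
(* Each half of the error gets [e / 2]: [e1 <= 1] yields [\sum |p1|^2 <= 2 * (K1 + 1)], hence the 8
   in [e2], and the second half costs [2 * (K2 + 1) * e1]. *)
pose e1 : R := Num.min 1 (e / (4 * (K2 + 1))); pose e2 : R := e / (8 * (K1 + 1)).
have e10 : 0 < e1 by rewrite lt_min ltr01 divr_gt0.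
have e20 : 0 < e2 by rewrite divr_gt0.
have e11 : e1 <= 1 by rewrite ge_min lexx.
have e1e : (4 * (K2 + 1)) * e1 <= e.
  by rewrite mulrC -ler_pdivlMr // ge_min lexx orbT.
have e2e : 8 * (K1 + 1) * e2 = e by rewrite /e2 mulrC divfK // gt_eqF.
have [w1 [a1 b1 c1 d1]] := H1 _ e10; have [w2 [a2 b2 c2 d2]] := H2 _ e20.
exists [seq (pmul k.1 l.1, pmul k.2 l.2) | k <- w1, l <- w2].
split; [exact: unit_fam_tmul| |exact: inv_fam_tmul|].
- move=> x Sx; rewrite big_allpairs_dep ev_tmul /=.
  have p1 := near_fam_norm a1 b1 Sx; have q1 := hK1 x Sx; have q2 := hK2 x Sx.
  have n1 := b1 x Sx; have n2 := b2 x Sx.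
  set h1 := ev t1 x in p1 q1 n1 *; set h2 := ev t2 x in q2 n2 *.
  apply: (@le_trans _ _ (\sum_(k <- w1) \sum_(l <- w2)
     (2 * cabs2 (k.2 x) * cabs2 (l.2 x - h2 * l.1 x) +
      2 * cabs2 h2 * cabs2 (k.2 x - h1 * k.1 x) * cabs2 (l.1 x)))).
    apply: ler_sum => k _; apply: ler_sum => l _; rewrite -!mulrA -!cabs2M.
    apply: le_trans (cabs2D _ _).
    by rewrite le_eqVlt; apply/orP; left; apply/eqP; congr cabs2; ring.
  under eq_bigr do rewrite big_split /=.
  rewrite big_split /= !sum_mul -!mulr_sumr unit_famR // mulr1.
  set P := \sum_(k <- w1) cabs2 (k.2 x) in p1 *.
  set N1 := \sum_(k <- w1) cabs2 _ in n1 *; set N2 := \sum_(l <- w2) _ in n2 *.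
  have N10 : 0 <= N1 by apply: sumr_ge0 => *; exact: cabs2_ge0.
  have N20 : 0 <= N2 by apply: sumr_ge0 => *; exact: cabs2_ge0.
  have P0 : 0 <= P by apply: sumr_ge0 => *; exact: cabs2_ge0.
  have P2 : P <= 2 * (K1 + 1) by lra.
  have X1 : P * N2 <= 2 * (K1 + 1) * e2 by rewrite ler_pM.
  have X2 : cabs2 h2 * N1 <= (K2 + 1) * e1 by rewrite ler_pM ?cabs2_ge0 //; lra.
  lra.
- move=> B hB f g; rewrite big_allpairs_dep /= -(bt_rep _ _ _ hB d2).
  rewrite exchange_big /=; apply: eq_bigr => l _; rewrite -(d1 _ hB).
  by apply: eq_bigr => k _; apply: (BS hB) => x _ /=; ring.
Qed.

(** * Approximating [conj A_i] by derivatives of words *)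

Section ConjugateGenerator.
Variable i : 'I_m.

(* Words of length [n] in the [A j], paired with their formal derivatives in
   the letter [A i]. *)
Fixpoint words n : trig := if n is n'.+1 then
  [seq (pmul (A j) k.1, padd (pmul (A j) k.2) (pscale (j == i)%:R k.1)) |
     j <- index_enum 'I_m, k <- words n'] else [:: (pcst 1, pcst 0)].

Lemma sum_delta (F : 'I_m -> C) : \sum_(j < m) (j == i)%:R * F j = F i.
Proof.
rewrite (bigD1 i) //= eqxx mul1r big1 ?addr0 // => j /negbTE ->.
by rewrite mul0r.
Qed.

Lemma words_unit n x : S x -> \sum_(k <- words n) k.1 x * conjc (k.1 x) = 1.
Proof.
move=> Sx; elim: n => [|n IH] /=; first by rewrite big_seq1 /= conjc1 mulr1.
rewrite big_allpairs_dep /= -(A1 Sx); apply: eq_bigr => j _.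
rewrite -[RHS]mulr1 -IH mulr_sumr; apply: eq_bigr => k _.
by rewrite rmorphM /=; ring.
Qed.

(** Each of the [n] positions contributes [conj A_i] once: the deleted letter survives only in the
    conjugate, and the other letters sum to 1 by [A1]. *)
Lemma words_UJ n x : S x -> \sum_(k <- words n) k.2 x * conjc (k.1 x) = n%:R * conjc (A i x).
Proof.
move=> Sx; elim: n => [|n IH] /=; first by rewrite big_seq1 /= !mul0r.
rewrite big_allpairs_dep /=.
transitivity (\sum_(j < m) ((A j x * conjc (A j x)) * \sum_(k <- words n) k.2 x * conjc (k.1 x) +
    (j == i)%:R * (conjc (A j x) * \sum_(k <- words n) k.1 x * conjc (k.1 x)))).
  apply: eq_bigr => j _; rewrite !mulr_sumr -big_split /=; apply: eq_bigr => k _.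
  by rewrite rmorphM /=; ring.
by rewrite big_split /= -mulr_suml A1 // IH words_unit // sum_delta -natr1; ring.
Qed.

(** Expanding over two deleted positions, the [n] coincident pairs give 1 each and the [n * (n - 1)]
    distinct pairs give [|A_i|^2] each. *)
Lemma words_UU n x : S x -> \sum_(k <- words n) k.2 x * conjc (k.2 x) =
  n%:R + n%:R * (n%:R - 1) * (A i x * conjc (A i x)).
Proof.
move=> Sx; elim: n => [|n IH] /=; first by rewrite big_seq1 /= !mul0r addr0.
rewrite big_allpairs_dep /=.
have UJ' : \sum_(k <- words n) k.1 x * conjc (k.2 x) = n%:R * A i x.
  have := congr1 (@conjc R) (words_UJ n Sx).
  rewrite rmorph_sum rmorphM /= conjcK rmorph_nat => <-.
  by apply: eq_bigr => k _; rewrite rmorphM /= conjcK mulrC.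
transitivity (\sum_(j < m) ((A j x * conjc (A j x)) * \sum_(k <- words n) k.2 x * conjc (k.2 x) +
  (j == i)%:R * (A j x * \sum_(k <- words n) k.2 x * conjc (k.1 x) +
      conjc (A j x) * \sum_(k <- words n) k.1 x * conjc (k.2 x) +
      \sum_(k <- words n) k.1 x * conjc (k.1 x)))).
  apply: eq_bigr => j _; rewrite !mulr_sumr -!big_split /= mulr_sumr -big_split /=.
  apply: eq_bigr => k _; rewrite rmorphD !rmorphM /= rmorph_nat.
  by case: (j == i) => /=; ring.
rewrite big_split /= -mulr_suml A1 // IH sum_delta words_unit // words_UJ // UJ' -natr1.
ring.
Qed.

Lemma words_inv n : inv_fam (words n).
Proof.
move=> B hB; elim: n => [|n IH] f g /=.
  by rewrite big_seq1 /=; apply: (BS hB) => x _ /=; rewrite mul1r.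
rewrite big_allpairs_dep /= -[RHS](Binv hB); apply: eq_bigr => j _.
rewrite -IH; apply: eq_bigr => k _.
by apply: (BS hB) => x _ /=; ring.
Qed.

Lemma B0l B g : good B -> B (pcst 0) g = 0.
Proof.
move=> hB; rewrite -[RHS](mul0r (B (pcst 0) g)) -(BZl hB).
by apply: (BS hB) => x _ //=; rewrite mul0r.
Qed.

(** The count of [words_UJ] at the level of forms: [Binv] removes the letters common to both slots,
    and the deleted letter remains in the second slot. *)
Lemma words_rep n B f g : good B ->
  \sum_(k <- words n) B (pmul k.2 f) (pmul k.1 g) = n%:R * B f (pmul (A i) g).
Proof.
move=> hB; elim: n f g => [|n IH] f g /=.
  rewrite big_seq1 /= mul0r -[RHS](B0l (pmul (pcst 1) g) hB).
  by apply: (BS hB) => x _ //=; rewrite mul0r.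
rewrite big_allpairs_dep /=.
transitivity (\sum_(j < m) (\sum_(k <- words n) B (pmul (A j) (pmul k.2 f)) (pmul (A j) (pmul k.1 g)) +
   (j == i)%:R * \sum_(k <- words n) B (pmul k.1 f) (pmul k.1 (pmul (A j) g)))).
  apply: eq_bigr => j _; rewrite mulr_sumr -big_split /=; apply: eq_bigr => k _.
  rewrite -(BZl hB).
  have -> : B (pscale (j == i)%:R (pmul k.1 f)) (pmul k.1 (pmul (A j) g)) =
      B (pscale (j == i)%:R (pmul k.1 f)) (pmul (A j) (pmul k.1 g)).
    by apply: (BS hB) => x _ //=; ring.
  rewrite -(BDl hB).
  by apply: (BS hB) => x _ /=; ring.
rewrite big_split /= sum_delta exchange_big /= (words_inv n hB).
under eq_bigr do rewrite (Binv hB).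
by rewrite IH -natr1 mulrDl mul1r.
Qed.

#[local] Arguments words : simpl never.

Lemma approx_conjA : approximable [:: (pcst 1, A i)].
Proof.
move=> e e0.
have [n ne] : exists n : nat, (n.+1%:R)^-1 < e.
  have /cvgrPdist_lt/(_ _ e0)[n _ /(_ n (leqnn n))] := @cvg_harmonic R.
  by rewrite sub0r normrN /= ger0_norm ?invr_ge0 // => ?; exists n.
pose c : C := Complex (n.+1%:R^-1) 0.
have cE : c * n.+1%:R = 1.
  have -> : n.+1%:R = Complex (n.+1%:R : R) 0 by exact: (esym (rmorph_nat (real_complex R) n.+1)).
  apply/eqP; rewrite eq_complex /=; apply/andP; split; apply/eqP; last by ring.
  by rewrite mulr0 subr0 mulVf // pnatr_eq0.
have cJ : conjc c = c by rewrite /c /conjc oppr0.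
exists [seq (k.1, pscale c k.2) | k <- words n.+1]; split.
- by move=> x Sx; rewrite big_map /=; exact: words_unit.
- move=> x Sx; rewrite big_map /= /ev big_seq1 /= mul1r; apply: le_trans (ltW ne).
  set a := A i x; set N := words n.+1.
  (* With [y = |A_i|^2] and [c] the inverse of the length, the Gram sums give [c + y - c * y] for
     the square, [y] for each cross term and [y] for the last one. *)
  have H : \sum_(k <- N) (c * k.2 x - conjc a * k.1 x) * conjc (c * k.2 x - conjc a * k.1 x) =
     c * (1 - a * conjc a).
    transitivity (c * c * (\sum_(k <- N) k.2 x * conjc (k.2 x))
        - c * a * (\sum_(k <- N) k.2 x * conjc (k.1 x))
        - c * conjc a * (\sum_(k <- N) conjc (k.2 x * conjc (k.1 x)))
        + a * conjc a * (\sum_(k <- N) k.1 x * conjc (k.1 x))).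
      rewrite !mulr_sumr -!sumrN -!big_split /=; apply: eq_bigr => k _.
      by rewrite rmorphB !rmorphM /= !conjcK cJ; ring.
    rewrite -rmorph_sum words_UU // words_UJ // words_unit // rmorphM /= conjcK rmorph_nat -/a.
    have E3 : c * a * (n.+1%:R * conjc a) = a * conjc a.
      by rewrite mulrACA cE mul1r.
    have E4 : c * conjc a * (n.+1%:R * a) = a * conjc a.
      by rewrite mulrACA cE mul1r mulrC.
    have E5 (y : C) : c * c * (n.+1%:R + n.+1%:R * (n.+1%:R - 1) * y) =
        (c * n.+1%:R) * c + (c * n.+1%:R) * (c * n.+1%:R) * y - (c * n.+1%:R) * c * y.
      by ring.
    by rewrite E3 E4 mulr1 E5 cE; ring.
  move: H; rewrite -sum_cabs2 mulcJE => /(congr1 (@complex.Re R)) /= ->.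
  rewrite mul0r subr0 ler_piMr ?invr_ge0 //.
  by rewrite lerBlDr lerDl cabs2_ge0.
- by move=> B hB f g; rewrite big_map /=; exact: (words_inv n.+1 hB).
- move=> B hB f g; rewrite big_map /= /bt big_seq1 /=.
  transitivity (c * \sum_(k <- words n.+1) B (pmul k.2 f) (pmul k.1 g)).
    rewrite mulr_sumr; apply: eq_bigr => k _; rewrite -(BZl hB).
    by apply: (BS hB) => x _ /=; ring.
  rewrite words_rep // mulrA cE mul1r.
  by apply: (BS hB) => x _ //=; rewrite mul1r.
Qed.
End ConjugateGenerator.

Lemma approx_conj_eq (p q : pol) : (forall x, S x -> p x = q x) ->
  approximable [:: (pcst 1, p)] -> approximable [:: (pcst 1, q)].
Proof.
move=> pq; apply: approx_equiv.
  by move=> x Sx; rewrite /ev !big_seq1 /= pq.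
by move=> B hB f g; rewrite /bt !big_seq1 /=; apply: (BS hB) => x Sx //=; rewrite pq.
Qed.

Lemma approx_conj_cst c : approximable [:: (pcst 1, pcst c)].
Proof.
have := @approx_analytic (pcst (conjc c)); apply: approx_equiv.
  by move=> x Sx; rewrite /ev !big_seq1 /= conjc1 mulr1 mul1r.
move=> B hB f g; rewrite /bt !big_seq1 /=.
rewrite -!/(pscale _ _) !(BZl hB) mul1r.
rewrite (_ : B f (pscale 1 g) = B f g) ?(BZr hB) //.
by rewrite conjc1 mul1r.
Qed.

Lemma approx_conj_add p q : approximable [:: (pcst 1, p)] -> approximable [:: (pcst 1, q)] ->
  approximable [:: (pcst 1, padd p q)].
Proof.
move=> hp hq; have := approx_cat hp hq; apply: approx_equiv.
  by move=> x Sx; rewrite /ev !big_cons !big_nil /= rmorphD /=; ring.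
move=> B hB f g; rewrite /bt !big_cons !big_nil /= !addr0 -(BDr hB).
by apply: (BS hB) => x Sx //=; ring.
Qed.

Lemma approx_conj_mul p q : approximable [:: (pcst 1, p)] -> approximable [:: (pcst 1, q)] ->
  approximable [:: (pcst 1, pmul p q)].
Proof.
move=> hp hq; have := approx_tmul hp hq; apply: approx_equiv.
  by move=> x Sx; rewrite ev_tmul /ev !big_seq1 /= rmorphM /=; ring.
move=> B hB f g; rewrite bt_tmul // /bt !big_seq1 /=.
by apply: (BS hB) => x Sx //=; ring.
Qed.

Lemma approx_conj p : approximable [:: (pcst 1, p)].
Proof.
(* The induction runs on the bare predicate [is_polyfun], so the bundled polynomial is any [q]
   agreeing with [f] on [S]. *)
suff H (f : T -> C) : is_polyfun f -> forall q : pol, (forall x, S x -> q x = f x) ->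
    approximable [:: (pcst 1, q)] by exact: (H p (polP p)).
elim=> [c q qE|i j q qE|{}f g hf Hf hg Hg q qE|{}f g hf Hf hg Hg q qE].
- by apply: approx_conj_eq (approx_conj_cst c) => x Sx; rewrite qE.
- have [c hc] := coordA i j.
  pose L (s : seq 'I_m) := foldr (fun k acc => padd (pscale (c k) (A k)) acc) (pcst 0) s.
  have LE s x : L s x = \sum_(k <- s) c k * A k x.
    by elim: s => [|k s IH]; rewrite ?big_nil ?big_cons //= -IH.
  apply: (@approx_conj_eq (L (index_enum 'I_m))); first by move=> x Sx; rewrite qE // hc // LE.
  elim: (index_enum _) => [|k s IH] /=; first exact: approx_conj_cst.
  apply: approx_conj_add => //; apply: approx_conj_mul; [exact: approx_conj_cst|exact: approx_conjA].
- apply: (@approx_conj_eq (padd (Pol hf) (Pol hg))); first by move=> x Sx; rewrite qE.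
  by apply: approx_conj_add; [exact: Hf|exact: Hg].
- apply: (@approx_conj_eq (pmul (Pol hf) (Pol hg))); first by move=> x Sx; rewrite qE.
  by apply: approx_conj_mul; [exact: Hf|exact: Hg].
Qed.

Theorem approx_all t : approximable t.
Proof.
elim: t => [|[u v] t IH].
  apply: approx_equiv (approx_analytic (pcst 0)).
    by move=> x Sx; rewrite /ev big_seq1 big_nil /= mul0r.
  move=> B hB f g; rewrite /bt big_seq1 big_nil /= -[RHS](B0l (pmul (pcst 1) g) hB).
  by apply: (BS hB) => x _ //=; rewrite mul0r.
rewrite -cat1s; apply: approx_cat => //.
apply: approx_equiv (approx_tmul (approx_analytic u) (approx_conj v)).
  by move=> x Sx; rewrite ev_tmul /ev !big_seq1 /= conjc1 mulr1 mul1r.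
move=> B hB f g; rewrite bt_tmul // /bt !big_seq1 /=.
by apply: (BS hB) => x Sx //=; ring.
Qed.

End WordFamilies.

(** * The bounded symbol of an invariant bounded form *)

Section Symbol.
#[local] Arguments conjc : simpl never.
Variables (R : realType) (D : cartan).
Local Notation C := R[i].
Local Notation T := (Cspace R D).
Local Notation pol := (pol R D).
Local Notation trig := (trig R D).
Variable mu : probability T R.
Variables (S : set T) (m : nat) (A : 'I_m -> pol).
Hypothesis aeS : {ae mu, forall x, S x}.
Hypothesis A1 : forall x, S x -> \sum_(i < m) A i x * conjc (A i x) = 1.
Hypothesis coordA : forall i j, exists c : 'I_m -> C, forall x, S x ->
  x i j = \sum_(k < m) c k * A k x.
Variables (B : pol -> pol -> C) (M : R).
Hypothesis hB : good S A B.
Hypothesis M0 : 0 < M.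
Hypothesis Bbound : forall b (f g : pol) (s : R), 0 < s ->
  `|part b (B f g)| <= M * (s * norm2 mu f + s^-1 * norm2 mu g).

Local Notation p1 := (pcst D (1 : C)).
Local Notation Lam t := (bt B t p1 p1).

Lemma coord_bdS : exists c : R, {ae mu, forall x : T, forall i j, cabs2 (x i j) <= c}.
Proof.
have H (s : seq ('I_(cp D) * 'I_(cq D))) : exists2 K : R, 0 <= K &
    forall x, S x -> forall p, p \in s -> cabs2 (x p.1 p.2) <= K.
  elim: s => [|p s [K K0 hK]]; first by exists 0.
  have [L L0 hL] := pol_bdS A1 coordA (Pol (pf_coord R p.1 p.2)).
  exists (K + L); first exact: addr_ge0.
  move=> x Sx q; rewrite inE => /predU1P[->|qs].
    by apply: le_trans (hL x Sx) _; rewrite lerDr.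
  by apply: le_trans (hK x Sx q qs) _; rewrite lerDl.
have [K _ hK] := H (enum [set: 'I_(cp D) * 'I_(cq D)]%SET).
exists K; apply: filterS aeS => x Sx i j; apply: (hK x Sx (i, j)).
by rewrite mem_enum inE.
Qed.

Let polL (p : pol) : isLinf mu p := poly_Linf coord_bdS (polP p).

Lemma pol_cabs2_bddm (p : pol) : bddm mu (fun x => cabs2 (p x)).
Proof.
have [mp [c pc]] := polL p; split; first exact: cmeas_cabs2.
by exists c; apply: filterS pc => x; rewrite ger0_norm ?cabs2_ge0.
Qed.

Lemma ev_Linf (t : trig) : isLinf mu (ev t).
Proof.
elim: t => [|p t IH].
  rewrite (_ : ev [::] = fun=> 0); first exact: Linf_cst.
  by apply/funext => x; rewrite /ev big_nil.
rewrite (_ : ev (p :: t) = fun x => p.1 x * conjc (p.2 x) + ev t x).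
  by apply: LinfD => //; apply: LinfM => //; apply: LinfJ.
by apply/funext => x; rewrite /ev big_cons.
Qed.

Lemma sumB_bound b (v : trig) (s : R) : 0 < s ->
  `|part b (\sum_(k <- v) B k.1 k.2)| <=
    M * (s * Rintegral mu setT (fun x => \sum_(k <- v) cabs2 (k.1 x)) +
      s^-1 * Rintegral mu setT (fun x => \sum_(k <- v) cabs2 (k.2 x))).
Proof.
move=> s0; rewrite part_sum; apply: le_trans (ler_norm_sum _ _ _) _.
rewrite (@Rint_sum _ _ _ mu _ v (fun k x => cabs2 (k.1 x))); last by move=> k; exact: pol_cabs2_bddm.
rewrite (@Rint_sum _ _ _ mu _ v (fun k x => cabs2 (k.2 x))); last by move=> k; exact: pol_cabs2_bddm.
rewrite !mulr_sumr -big_split /= mulr_sumr; apply: ler_sum => k _.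
exact: Bbound.
Qed.

(** Take families [(a_k, p_k)] for [t1] and [(a_l, q_l)] for [t2]. The value is the sum of
    [B (p_k * a_l) (a_k * q_l)], and since [\sum |a|^2 = 1] the squared entries of each slot add up
    to [\sum |p_k|^2] or [\sum |q_l|^2]. *)
Lemma Lam2_bound b (t1 t2 : trig) (s : R) : 0 < s ->
  `|part b (Lam (tmul t1 (swp t2)))| <=
    (2 * M) * (s * norm2 mu (ev t1) + s^-1 * norm2 mu (ev t2)).
Proof.
move=> s0; apply/ler_addgt0Pr => e e0.
have Mge : 0 <= M := ltW M0.
have si0 : 0 < s^-1 by rewrite invr_gt0.
(* The accuracy [d] of both families contributes [M * (s * 2 * d + s^-1 * 2 * d) = K * d], made
   equal to [e]. *)
pose K : R := 2 * M * (s + s^-1).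
have K0 : 0 < K by rewrite /K !mulr_gt0 // addr_gt0.
pose d := e / K; have d0 : 0 < d by rewrite divr_gt0.
have Kd : K * d = e by rewrite /d mulrC divfK // gt_eqF.
have [w1 [a1 b1 c1 d1]] := approx_all A1 coordA t1 d0.
have [w2 [a2 b2 c2 d2]] := approx_all A1 coordA t2 d0.
pose v := [seq (pmul (pmul k.2 l.1) p1, pmul (pmul k.1 l.2) p1) | k <- w1, l <- w2].
have vE : \sum_(k <- v) B k.1 k.2 = Lam (tmul t1 (swp t2)).
  rewrite /v big_allpairs_dep /= exchange_big /=.
  transitivity (\sum_(l <- w2) bt B t1 (pmul l.1 p1) (pmul l.2 p1)).
    apply: eq_bigr => l _; rewrite -(d1 _ hB); apply: eq_bigr => k _.
    by apply: (BS hB) => x _ /=; ring.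
  rewrite (bt_tmul _ _ _ _ hB) /bt exchange_big; apply: eq_bigr => p _ /=.
  rewrite -[RHS](rep_fam_swp d2 hB); apply: eq_bigr => l _.
  by apply: (BS hB) => x _ /=; ring.
rewrite -vE; apply: le_trans (sumB_bound b v s0) _.
have bnd (t : trig) (F : pol * pol -> pol) : (forall x, S x ->
    \sum_(k <- v) cabs2 (F k x) <= 2 * cabs2 (ev t x) + 2 * d) ->
    Rintegral mu setT (fun x => \sum_(k <- v) cabs2 (F k x)) <= 2 * norm2 mu (ev t) + 2 * d.
  move=> H; have /isL2P[_ It] := Linf_L2 (ev_Linf t).
  rewrite -RintZ // -[X in _ <= _ + X](Rint_cst mu) -RintD.
  - apply: ae_le_Rint; last by apply: filterS aeS => x; exact: H.
      by apply: bddm_intgr; apply: bddm_sum => k; exact: pol_cabs2_bddm.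
    by apply: intgrD; [exact: intgrZ|apply: bddm_intgr; exact: bddm_cst].
  - exact: intgrZ.
  - by apply: bddm_intgr; exact: bddm_cst.
have B1 := bnd t1 (fun k => k.1) _; have B2 := bnd t2 (fun k => k.2) _.
have {}B1 : Rintegral mu setT (fun x => \sum_(k <- v) cabs2 (k.1 x)) <= 2 * norm2 mu (ev t1) + 2 * d.
  apply: B1 => x Sx; rewrite /v big_allpairs_dep /=.
  under eq_bigr do under eq_bigr do rewrite mulr1 cabs2M.
  by rewrite sum_mul (unit_famR a2 Sx) mulr1; exact: (near_fam_norm a1 b1 Sx).
have {}B2 : Rintegral mu setT (fun x => \sum_(k <- v) cabs2 (k.2 x)) <= 2 * norm2 mu (ev t2) + 2 * d.
  apply: B2 => x Sx; rewrite /v big_allpairs_dep /=.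
  under eq_bigr do under eq_bigr do rewrite mulr1 cabs2M.
  by rewrite sum_mul (unit_famR a1 Sx) mul1r; exact: (near_fam_norm a2 b2 Sx).
move: B1 B2; set X := Rintegral _ _ _ => B1; set Y := Rintegral _ _ _ => B2.
rewrite -(ler_pM2l s0) in B1; rewrite -(ler_pM2l si0) in B2.
have H : M * (s * X + s^-1 * Y) <= M * (s * (2 * norm2 mu (ev t1) + 2 * d) + s^-1 * (2 * norm2 mu (ev t2) + 2 * d)).
  by rewrite ler_pM2l // lerD.
apply: le_trans H _; rewrite -Kd /K le_eqVlt; apply/orP; left; apply/eqP; ring.
Qed.

Definition tscale (c : C) (t : trig) : trig := [seq (pscale c p.1, p.2) | p <- t].

Lemma ev_tscale c t x : ev (tscale c t) x = c * ev t x.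
Proof. by rewrite /ev big_map mulr_sumr; apply: eq_bigr => p _ /=; rewrite mulrA. Qed.

Lemma Lam_tscale c t : Lam (tscale c t) = c * Lam t.
Proof.
rewrite /bt big_map mulr_sumr; apply: eq_bigr => p _ /=; rewrite -(BZl hB).
by apply: (BS hB) => x _ //=; rewrite mulrA.
Qed.

(** A relation and not a function of [h], since different [t] may agree on [S]; that they give the
    same value follows only from the norm bound. *)
Definition LRel b (h : T -> R) (y : R) := exists t, [/\ measurable_fun setT h,
  forall x, S x -> ev t x = Complex (h x) 0 & y = part b (Lam t)].

Lemma LRel_norm2 t (h : T -> R) : measurable_fun setT h ->
  (forall x, S x -> ev t x = Complex (h x) 0) ->
  norm2 mu (ev t) = Rintegral mu setT (fun x => h x ^+ 2).
Proof.
move=> mh H; have [me _] := ev_Linf t; apply: ae_eq_Rint.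
- exact: cmeas_cabs2.
- by under eq_fun do rewrite expr2; exact: measurable_funM.
- by apply: filterS aeS => x Sx; rewrite H // /cabs2 /= expr0n addr0.
Qed.

Lemma LRel_bddm b h y : LRel b h y -> bddm mu h.
Proof.
move=> [t [mh H _]]; split => //; have [_ [c tc]] := ev_Linf t.
exists (c + 1); apply: filterS2 aeS tc => x Sx; rewrite H // /cabs2 /= expr0n addr0 => hc.
rewrite -real_normK ?num_real // in hc; have := sqr_ge0 (`|h x| - 1); nra.
Qed.

Lemma LRel_lin b c h1 y1 h2 y2 : LRel b h1 y1 -> LRel b h2 y2 ->
  LRel b (fun x => c * h1 x + h2 x) (c * y1 + y2).
Proof.
move=> [t1 [m1 H1 ->]] [t2 [m2 H2 ->]]; exists (tscale (Complex c 0) t1 ++ t2); split.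
- by apply: measurable_funD => //; apply: measurable_funM.
- move=> x Sx; rewrite ev_cat ev_tscale H1 // H2 //.
  by apply/eqP; rewrite eq_complex /=; apply/andP; split; apply/eqP; ring.
- by rewrite bt_cat partD Lam_tscale part_realM.
Qed.

Lemma LRel1 b : exists y, LRel b (fun=> 1) y.
Proof.
exists (part b (Lam [:: (p1, p1)])), [:: (p1, p1)]; split => //.
by move=> x Sx; rewrite /ev big_seq1 /= conjc1 mulr1.
Qed.

(** As [h2] is real, [swp t2] represents it too, so [Lam2_bound] applies to the plain product. *)
Lemma LRel_mul b h1 y1 h2 y2 : LRel b h1 y1 -> LRel b h2 y2 ->
  exists y, LRel b (fun x => h1 x * h2 x) y /\ forall s : R, 0 < s ->
   `|y| <= (2 * M) * (s * Rintegral mu setT (fun x => h1 x ^+ 2) +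
       s^-1 * Rintegral mu setT (fun x => h2 x ^+ 2)).
Proof.
move=> [t1 [m1 H1 _]] [t2 [m2 H2 _]].
exists (part b (Lam (tmul t1 (swp t2)))); split.
  exists (tmul t1 (swp t2)); split => //; first exact: measurable_funM.
  move=> x Sx; rewrite ev_tmul ev_swp H1 // H2 //.
  by apply/eqP; rewrite eq_complex /=; apply/andP; split; apply/eqP; ring.
by move=> s s0; rewrite -(LRel_norm2 m1 H1) -(LRel_norm2 m2 H2); exact: Lam2_bound.
Qed.

(** [Lam2_bound] with the constant 1 as second factor. *)
Lemma LRel_bound b h y : LRel b h y -> forall s : R, 0 < s ->
  `|y| <= (2 * M) * (s * Rintegral mu setT (fun x => h x ^+ 2) + s^-1).
Proof.
move=> [t [mh H ->]] s s0.
have := Lam2_bound b t [:: (p1, p1)] s0; rewrite (LRel_norm2 mh H).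
have -> : norm2 mu (ev [:: (p1, p1)]) = 1.
  rewrite /norm2 -[RHS](Rint_cst mu); congr Rintegral; apply/funext => x.
  by rewrite /ev big_seq1 /= conjc1 mulr1 /cabs2 /= expr1n expr0n addr0.
rewrite mulr1 (_ : Lam (tmul t (swp [:: (p1, p1)])) = Lam t) //.
rewrite (bt_tmul _ _ _ _ hB); apply: eq_bigr => p _; rewrite /bt big_seq1 /=.
by apply: (BS hB) => x _ /=; ring.
Qed.

Definition tre (t : trig) := tscale (2^-1) (t ++ swp t).
Definition tim (t : trig) := tscale (Complex 0 (- 2^-1)) t ++ tscale (Complex 0 (2^-1)) (swp t).

Lemma half_complex : (2^-1 : C) = Complex (2^-1) 0.
Proof. by rewrite -[RHS]/(real_complex R (2^-1)) rmorphV ?unitfE ?pnatr_eq0 // rmorph_nat. Qed.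

Lemma ev_tre t x : ev (tre t) x = Complex (complex.Re (ev t x)) 0.
Proof.
rewrite ev_tscale ev_cat ev_swp half_complex; case: (ev t x) => a b.
by apply/eqP; rewrite eq_complex /=; apply/andP; split; apply/eqP; field.
Qed.

Lemma ev_tim t x : ev (tim t) x = Complex (complex.Im (ev t x)) 0.
Proof.
rewrite ev_cat !ev_tscale ev_swp; case: (ev t x) => a b.
by apply/eqP; rewrite eq_complex /=; apply/andP; split; apply/eqP; field.
Qed.

Lemma LRel_re b t : LRel b (fun x => complex.Re (ev t x)) (part b (Lam (tre t))).
Proof.
exists (tre t); split => //; first by case: (ev_Linf t) => -[].
by move=> x _; exact: ev_tre.
Qed.

Lemma LRel_im b t : LRel b (fun x => complex.Im (ev t x)) (part b (Lam (tim t))).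
Proof.
exists (tim t); split => //; first by case: (ev_Linf t) => -[].
by move=> x _; exact: ev_tim.
Qed.

(** Rays generate the Borel sets of the line, which gives all preimages under real and imaginary
    parts of coordinates; these generate the sigma-algebra of [Cspace]. *)
Lemma LRel_dens b (E : set T) : measurable E -> dens01 mu (LRel b) E.
Proof.
have lm h1 y1 h2 y2 : LRel b h1 y1 -> LRel b h2 y2 -> exists y, LRel b (fun x => h1 x * h2 x) y.
  by move=> H1 H2; have [y [Hy _]] := LRel_mul H1 H2; exists y.
have sig := dens01_sigma (@LRel_bddm b) (@LRel_lin b) (LRel1 b) lm.
have ray h y c : LRel b h y -> dens01 mu (LRel b) [set x | h x < c].
  exact: (dens01_ray (@LRel_bddm b) (@LRel_lin b) (LRel1 b) lm).
have bor h y : LRel b h y -> forall V : set R, measurable V -> dens01 mu (LRel b) (h @^-1` V).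
  move=> Hh.
  have sigR : sigma_algebra setT [set V : set R | dens01 mu (LRel b) (h @^-1` V)].
    case: sig => s0 sC sU; split.
    - by rewrite /= preimage_set0.
    - by move=> V /= HV; rewrite setTD preimage_setC -setTD; exact: sC.
    - by move=> F HF /=; rewrite preimage_bigcup; exact: sU.
  move=> V mV; have : (@RGenInftyO.G R).-sigma.-measurable V by rewrite -RGenInftyO.measurableE.
  apply: (@smallest_sub _ _ _ _ sigR) => W [c ->] /=.
  rewrite (_ : _ @^-1` _ = [set x | h x < c]); first exact: ray Hh.
  by apply/seteqP; split => x; rewrite /= in_itv.
apply: (@smallest_sub _ _ _ _ sig) => W [i [j [V [mV [->|->]]]]].
  have := bor _ _ (LRel_re b [:: (Pol (pf_coord R i j), p1)]) _ mV.
  congr (dens01 _ _ _); apply/seteqP.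
  by split=> x /=; rewrite /ev big_seq1 /= conjc1 mulr1.
have := bor _ _ (LRel_im b [:: (Pol (pf_coord R i j), p1)]) _ mV.
congr (dens01 _ _ _); apply/seteqP.
by split=> x /=; rewrite /ev big_seq1 /= conjc1 mulr1.
Qed.

Lemma part_symbol b : exists phi : T -> R, bddm mu phi /\
  forall h y, LRel b h y -> y = Rintegral mu setT (fun x => phi x * h x).
Proof.
(* The square estimate is [LRel_mul] with equal factors and [s = 1], which doubles the constant
   [2 * M]. *)
have M4 : 0 < 4 * M by rewrite mulr_gt0.
have M4' : 0 <= M := ltW M0.
apply: (@real_symbol _ _ _ mu (LRel b) (4 * M) M4 (@LRel_bddm b) (@LRel_lin b) (LRel1 b)).
- move=> h y Hh s s0; apply: le_trans (LRel_bound Hh s0) _.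
  apply: ler_wpM2r; last lra.
  by rewrite addr_ge0 ?mulr_ge0 ?Rint_sqr_ge0 ?invr_ge0 // ltW.
- move=> h y Hh; have [y' [Hy' yb]] := LRel_mul Hh Hh; exists y'.
  split; first by under eq_fun do rewrite expr2.
  by have := yb 1 ltr01; rewrite invr1 !mul1r; lra.
- exact: LRel_dens.
Qed.

Lemma Lam_split t : Lam t = Lam (tre t) + Complex 0 1 * Lam (tim t).
Proof.
rewrite bt_cat !Lam_tscale bt_cat half_complex.
case: (Lam t) => a b; case: (Lam (swp t)) => c d.
by apply/eqP; rewrite eq_complex /=; apply/andP; split; apply/eqP; field.
Qed.

(** Let [phi1] and [phi2] represent the real and imaginary parts of [Lam] on real functions. Complex
    linearity, through [Lam_split], makes [phi1 + i phi2] represent [Lam], and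
    [B f g = Lam (f * conj g)]. *)
Theorem form_symbol : exists phi, isLinf mu phi /\
  forall f g : pol, B f g = inner mu (fun x => phi x * f x) g.
Proof.
have [phi1 [[m1 [c1 b1]] H1]] := part_symbol true.
have [phi2 [[m2 [c2 b2]] H2]] := part_symbol false.
pose phi x := Complex (phi1 x) (phi2 x).
have hphi : isLinf mu phi.
  split; first by split.
  exists (c1 ^+ 2 + c2 ^+ 2); apply: filterS2 b1 b2 => x h1 h2; rewrite /cabs2 /=.
  have l1 : 0 <= c1 by exact: le_trans h1.
  have l2 : 0 <= c2 by exact: le_trans h2.
  by rewrite -[phi1 x ^+ 2]real_normK ?num_real // -[phi2 x ^+ 2]real_normK ?num_real // lerD // lerXn2r.
exists phi; split => // f g; pose t : trig := [:: (f, g)].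
have -> : B f g = Lam t.
  by rewrite /bt big_seq1 /=; apply: (BS hB) => x _ /=; rewrite mulr1.
rewrite Lam_split /inner.
have R1 := H1 _ _ (LRel_re true t); have I1 := H1 _ _ (LRel_im true t).
have R2 := H2 _ _ (LRel_re false t); have I2 := H2 _ _ (LRel_im false t).
have bt_ b : bddm mu (fun x => part b (ev t x)).
  by case: b; [exact: LRel_bddm (LRel_re true t)|exact: LRel_bddm (LRel_im true t)].
have bp1 : bddm mu phi1 by split => //; exists c1.
have bp2 : bddm mu phi2 by split => //; exists c2.
have ii (p : T -> R) b : bddm mu p -> intgr mu (fun x => p x * part b (ev t x)).
  by move=> bp; apply: bddm_intgr; exact: bddmM.
have e0 x : phi x * f x * conjc (g x) = phi x * ev t x.
  by rewrite /ev big_seq1 /= mulrA.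
under eq_fun do rewrite e0.
apply: complex_ext => b; rewrite cintE.
case: b.
- rewrite (_ : (fun x => _) = (fun x => phi1 x * part true (ev t x) + (-1) * (phi2 x * part false (ev t x)))).
    rewrite RintD ?RintZ //; try exact: ii; last by apply: intgrZ; exact: ii.
    rewrite -R1 -I2 /=; case: (Lam (tre t)) => a b; case: (Lam (tim t)) => c d /=; ring.
  by apply/funext => x; rewrite /phi; case: (ev t x) => a b /=; ring.
- rewrite (_ : (fun x => _) = (fun x => phi2 x * part true (ev t x) + (phi1 x * part false (ev t x)))).
    rewrite RintD; try exact: ii.
    rewrite -R2 -I1 /=; case: (Lam (tre t)) => a b; case: (Lam (tim t)) => c d /=; ring.
  by apply/funext => x; rewrite /phi; case: (ev t x) => a b /=; ring.
Qed.

End Symbol.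

(** * Toeplitz operators and the invariance identities *)

Section Toeplitz.
#[local] Arguments conjc : simpl never.
Variables (R : realType) (D : cartan).
Local Notation C := R[i].
Local Notation T := (Cspace R D).
Variable mu : probability T R.
Variables (S : set T) (r : nat).
Hypothesis aeS : {ae mu, forall x, S x}.
Hypothesis r0 : (0 < r)%N.
Variables (N : nat -> nat) (psi : forall l : nat, 'I_(N l) -> cmx R D -> C).
Hypothesis psi_poly : forall l, (1 <= l <= r)%N -> forall a, is_polyfun (@psi l a).
Hypothesis psi_sum : forall l, (1 <= l <= r)%N -> forall x, S x ->
  \sum_(a < N l) psi a x * conjc (psi a x) = ('C(r, l))%:R.
Hypothesis psi_coord : forall i j, exists c : 'I_(N 1) -> C, forall x, S x ->
  x i j = \sum_(k < N 1) c k * psi k x.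
Variable X : (T -> C) -> (T -> C).
Hypothesis hX : bounded_op_H2 mu X.

Let r1 : (1 <= 1 <= r)%N. Proof. by rewrite leqnn. Qed.

Let kap : C := Complex ((Num.sqrt (r%:R : R))^-1) 0.

Let kap2 : kap * conjc kap * r%:R = 1.
Proof.
rewrite (_ : r%:R = Complex (r%:R : R) 0); last first.
  exact: (esym (rmorph_nat (real_complex R) r)).
have s0 : (Num.sqrt (r%:R : R)) != 0 by rewrite sqrtr_eq0 -ltNge ltr0n.
rewrite mulcJE; apply/eqP; rewrite eq_complex /=; apply/andP; split; apply/eqP; last by ring.
by rewrite /cabs2 /= expr0n addr0 mulr0 subr0 exprVn sqr_sqrtr ?ler0n // mulVf // pnatr_eq0 -lt0n.
Qed.

Let A (k : 'I_(N 1)) : pol R D := pscale kap (Pol (psi_poly r1 k)).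

Let A1 x : S x -> \sum_(i < N 1) A i x * conjc (A i x) = 1.
Proof.
move=> Sx; rewrite -kap2 -[in RHS](bin1 r) -(psi_sum r1 Sx) mulr_sumr; apply: eq_bigr => i _ /=.
by rewrite rmorphM /=; ring.
Qed.

Let coordA i j : exists c : 'I_(N 1) -> C, forall x, S x ->
  x i j = \sum_(k < N 1) c k * A k x.
Proof.
(* The prefix [kap * conjc kap * r%:R] equals 1 by [kap2]; the coefficient is [c k / kap]. *)
have [c hc] := psi_coord i j; exists (fun k => kap * conjc kap * r%:R * c k / kap) => x Sx.
have k0 : kap != 0.
  by apply/eqP => k0; move: kap2; rewrite k0 !mul0r => /eqP; rewrite eq_sym oner_eq0.
rewrite hc //; apply: eq_bigr => k _ /=; rewrite kap2 mul1r -mulrA mulKf //.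
Qed.

Let cbd := coord_bdS aeS A1 coordA.
Let L2p (p : pol R D) : isL2 mu p := isH2_L2 (poly_H2 cbd (polP p)).
Let H2p (p : pol R D) : isH2 mu p := poly_H2 cbd (polP p).

Lemma X_H2 f : isH2 mu f -> isH2 mu (X f).
Proof. by case: hX => H _; exact: H. Qed.

Lemma X_lin (a : C) f g k : isH2 mu f -> isH2 mu g -> isL2 mu k ->
  inner mu (X (fun x => a * f x + g x)) k = a * inner mu (X f) k + inner mu (X g) k.
Proof.
move=> hf hg hk; have [_ [_ [hl _]]] := hX.
have l2 f' : isH2 mu f' -> isL2 mu (X f') by move=> h; exact/isH2_L2/X_H2.
rewrite -inner_linl; do ?exact: l2; last by [].
apply: inner_ae => //.
- by apply: l2; exact: H2_lin.
- by apply: isL2_lin; exact: l2.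
- exact: hl.
- exact: aeW.
Qed.

(** Against Hardy functions the projection drops out, so both sides are integrals of
    [phi * f * conj g]; on the left it carries the weight [\sum |psi|^2], which is the binomial on
    [S]. *)
Lemma toeplitz_identities : is_toeplitz mu X ->
  forall l, (1 <= l <= r)%N -> forall f g, isH2 mu f -> isH2 mu g ->
    \sum_(a < N l) inner mu (X (fun x => psi a x * f x)) (fun x => psi a x * g x)
    = ('C(r, l))%:R * inner mu (X f) g.
Proof.
move=> [phi [hphi sz]] l hl f g hf hg.
have szE u k : isH2 mu u -> isH2 mu k -> inner mu (X u) k = inner mu (fun x => phi x * u x) k.
  move=> hu hk; have [_ /(_ _ hk)] := sz u hu.
  rewrite (_ : (fun x => phi x * u x - X u x) = (fun x => (-1) * X u x + phi x * u x)).
    rewrite inner_linl; [|exact/isH2_L2/X_H2|exact/isL2M/isH2_L2|exact: isH2_L2].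
    by rewrite mulN1r addrC => /eqP; rewrite subr_eq0 => /eqP ->.
  by apply/funext => x; rewrite mulN1r addrC.
have hpf (a : 'I_(N l)) u : isH2 mu u -> isH2 mu (fun x => psi a x * u x).
  by move=> hu; apply: H2_polyM => //; exact: (psi_poly hl).
have i1 a := cintg_mulJ (isL2M hphi (isH2_L2 (hpf a _ hf))) (isH2_L2 (hpf a _ hg)).
rewrite (eq_bigr (fun a => inner mu (fun x => phi x * (psi a x * f x)) (fun x => psi a x * g x))); last first.
  by move=> a _; apply: szE; exact: hpf.
rewrite szE // /inner.
have i0 := cintg_mulJ (isL2M hphi (isH2_L2 hf)) (isH2_L2 hg).
rewrite -cintZ //.
have -> : \sum_(a < N l) cint mu (fun x => phi x * (psi a x * f x) * conjc (psi a x * g x)) =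
   cint mu (fun x => \sum_(a < N l) phi x * (psi a x * f x) * conjc (psi a x * g x)).
  elim: (index_enum _) => [|a s IH].
    rewrite big_nil; apply: complex_ext => b; rewrite cintE part0 -[LHS](Rint_cst mu).
    by congr Rintegral; apply/funext => x; rewrite big_nil part0.
  rewrite big_cons IH -cintD //.
    by congr cint; apply/funext => x; rewrite big_cons.
  move=> b; elim: s {IH} => [|a' s IH'].
    rewrite (_ : (fun x => _) = fun=> 0); first by apply: bddm_intgr; exact: bddm_cst.
    by apply/funext => x; rewrite big_nil part0.
  rewrite (_ : (fun x => _) = (fun x => part b (phi x * (psi a' x * f x) * conjc (psi a' x * g x)) +
      part b (\sum_(a <- s) phi x * (psi a x * f x) * conjc (psi a x * g x)))).
    by apply: intgrD => //; exact: i1.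
  by apply/funext => x; rewrite big_cons partD.
apply: cint_ae.
- elim: (index_enum _) => [|a s IH].
    by rewrite (_ : (fun x => _) = fun=> 0); [exact: cmeas_cst|apply/funext => x; rewrite big_nil].
  rewrite (_ : (fun x => _) = (fun x => phi x * (psi a x * f x) * conjc (psi a x * g x) +
     \sum_(a <- s) phi x * (psi a x * f x) * conjc (psi a x * g x))).
    apply: cmeasD => //; apply: cmeasM.
      by case: (isL2M hphi (isH2_L2 (hpf a _ hf))).
    by apply: cmeasJ; case: (isH2_L2 (hpf a _ hg)).
  by apply/funext => x; rewrite big_cons.
- apply: cmeasM; first exact: cmeas_cst.
  apply: cmeasM; first by case: (isL2M hphi (isH2_L2 hf)).
  by apply: cmeasJ; case: (isH2_L2 hg).
- apply: filterS aeS => x Sx; rewrite -(psi_sum hl Sx) mulr_suml; apply: eq_bigr => a _.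
  by rewrite rmorphM /=; ring.
Qed.

(** * From the first identity to the symbol *)

Section Converse.
Hypothesis Xid : forall f g, isH2 mu f -> isH2 mu g ->
  \sum_(a < N 1) inner mu (X (fun x => psi a x * f x)) (fun x => psi a x * g x)
    = r%:R * inner mu (X f) g.

Let B (f g : pol R D) := inner mu (X f) g.

(** Linearity of [X] is only given for [a * f + g] up to null sets; taking [a = -1] and [f = g = 0]
    kills the right side. *)
Lemma inner_X0 k : isL2 mu k -> inner mu (X (fun=> 0)) k = 0.
Proof.
move=> hk; have h0 : isH2 mu (fun=> 0) := H2p (pcst D 0).
have := X_lin (-1) h0 h0 hk.
by rewrite (_ : (fun x : T => _) = fun=> 0) ?mulN1r ?addNr // -funeqE mulN1r oppr0 addr0.
Qed.

Lemma X_good : good S A B.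
Proof.
have BZl a (f g : pol R D) : B (pscale a f) g = a * B f g.
  have h0 : isH2 mu (fun=> 0) := H2p (pcst D 0).
  have := X_lin a (H2p f) h0 (L2p g); rewrite inner_X0 // addr0 => <-; congr (inner _ (X _) _).
  by apply/funext => x /=; rewrite addr0.
have BZr a (f g : pol R D) : B g (pscale a f) = conjc a * B g f.
  have l0 : isL2 mu (fun=> 0) := L2p (pcst D 0).
  have := inner_linr a (L2p f) l0 (isH2_L2 (X_H2 (H2p g))).
  have -> : inner mu (X g) (fun=> 0) = 0.
    have := inner_linr (-1) l0 l0 (isH2_L2 (X_H2 (H2p g))).
    by rewrite rmorphN1 mulr0 addr0 mulN1r addNr.
  rewrite addr0 => <-; congr inner.
  by apply/funext => x /=; rewrite addr0.
split=> //.
- move=> f g h; have := X_lin 1 (H2p f) (H2p g) (L2p h); rewrite mul1r => <-.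
  by congr (inner _ (X _) _); apply/funext => x /=; rewrite mul1r.
- move=> f g h; have := inner_linr 1 (L2p f) (L2p g) (isH2_L2 (X_H2 (H2p h))).
  rewrite conjc1 mul1r => <-; congr inner.
  by apply/funext => x /=; rewrite mul1r.
- move=> f f' g g' ff gg; have [_ [hc _]] := hX.
  apply: inner_ae => //; do ?exact: isH2_L2 (X_H2 (H2p _)).
    by apply: hc; [exact: H2p|exact: H2p|apply: filterS aeS => x; exact: ff].
  by apply: filterS aeS => x; exact: gg.
- move=> f g.
  have E k : B (pmul (A k) f) (pmul (A k) g) =
     kap * conjc kap * inner mu (X (fun x => psi k x * f x)) (fun x => psi k x * g x).
    rewrite -mulrA -(BZr kap (pmul (Pol (psi_poly r1 k)) g) (pmul (Pol (psi_poly r1 k)) f)) -BZl /B.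
    by congr (inner _ (X _) _); apply/funext => x /=; rewrite mulrA.
  under eq_bigr do rewrite E.
  by rewrite -mulr_sumr Xid // mulrA kap2 mul1r.
Qed.

Lemma X_bound : exists2 M : R, 0 < M & forall b f g (s : R), isH2 mu f -> isL2 mu g -> 0 < s ->
  `|part b (inner mu (X f) g)| <= M * (s * norm2 mu f + s^-1 * norm2 mu g).
Proof.
have [_ [_ [_ [c hc]]]] := hX.
exists (`|c| + 1); first by have := normr_ge0 c; lra.
move=> b f g s hf hg s0.
apply: le_trans (inner_bound b s0 (isH2_L2 (X_H2 hf)) hg) _.
have H := hc f hf; have n1 := norm2_ge0 mu f; have n2 := norm2_ge0 mu g.
have H' : norm2 mu (X f) <= (`|c| + 1) * norm2 mu f.
  apply: le_trans H _; rewrite ler_wpM2r //; have := ler_norm c; lra.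
have G' : norm2 mu g <= (`|c| + 1) * norm2 mu g by rewrite ler_peMl //; have := normr_ge0 c; lra.
rewrite -(ler_pM2l s0) in H'; have si0 : 0 < s^-1 by rewrite invr_gt0.
rewrite -(ler_pM2l si0) in G'; lra.
Qed.

(** Given [s], choose [n] with [u n <= s ^+ 2]: both terms become of order [s]. *)
Lemma squeeze_seq (x a K : R) (u : nat -> R) : 0 <= a -> 0 <= K -> u @ \oo --> (0 : R) ->
  (forall n (s : R), 0 < s -> `|x| <= K * (s * a + s^-1 * u n)) -> x = 0.
Proof.
move=> a0 K0 hu H; apply: (@eq0_norm_le_eps _ (K * (a + 1))); first by rewrite mulr_ge0 // addr_ge0.
move=> s s0; have s2 : 0 < s ^+ 2 by rewrite exprn_gt0.
have /cvgrPdist_le/(_ _ s2)[n _ /(_ n (leqnn n))] := hu.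
rewrite sub0r normrN => /(le_trans (ler_norm _)) un.
apply: le_trans (H n s s0) _; rewrite -mulrA; apply: ler_wpM2l => //.
have : s^-1 * u n <= s^-1 * s ^+ 2 by rewrite ler_pM2l // invr_gt0.
by rewrite expr2 mulKf ?gt_eqF //; lra.
Qed.

Lemma L2_subp f (P : T -> C) : is_polyfun P -> isH2 mu f -> isH2 mu (fun x => f x - P x).
Proof.
move=> hP hf; rewrite (_ : (fun x => _) = (fun x => (-1) * P x + f x)).
  by apply: H2_lin => //; exact: poly_H2.
by apply/funext => x; rewrite mulN1r addrC.
Qed.

(** [form_symbol] settles polynomial pairs. The defect [Del] is bounded in each variable, so
    polynomial approximation extends its vanishing first to [k], then to [f], in the Hardy space. *)
Lemma identities_toeplitz : is_toeplitz mu X.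
Proof.
have [M M0 Mb] := X_bound.
have [|phi [hphi HB]] := @form_symbol R D mu S (N 1) A aeS A1 coordA B M X_good M0.
  by move=> b f g s s0; apply: Mb => //; exact: L2p.
exists phi; split => // f hf; split; first exact: X_H2.
pose Del f k := inner mu (fun x => phi x * f x) k - inner mu (X f) k.
have [_ [c0 phic0]] := hphi; pose c := `|c0| + 1.
have phic : {ae mu, forall x, cabs2 (phi x) <= c}.
  by apply: filterS phic0 => x h; apply: le_trans h _; have := ler_norm c0; rewrite /c; lra.
have c1 : 1 <= c by rewrite /c; have := normr_ge0 c0; lra.
have Db b u k (s : R) : isH2 mu u -> isL2 mu k -> 0 < s ->
    `|part b (Del u k)| <= (M + c) * (s * norm2 mu u + s^-1 * norm2 mu k).
  move=> hu hk s0; have hpu := isL2M hphi (isH2_L2 hu).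
  have e3 := inner_bound b s0 hpu hk; have e1 := Mb b u k s hu hk s0.
  have := norm2M hphi phic (isH2_L2 hu); rewrite -(ler_pM2l s0) => e2.
  rewrite /Del partD; have -> : part b (- inner mu (X u) k) = - part b (inner mu (X u) k).
    by case: (inner mu (X u) k) => ? ?; case: (b).
  apply: le_trans (ler_normB _ _) _.
  have : s^-1 * norm2 mu k <= c * (s^-1 * norm2 mu k).
    by rewrite ler_peMl // mulr_ge0 ?norm2_ge0 // invr_ge0 ltW.
  lra.
have Dl u v k : isH2 mu u -> isH2 mu v -> isL2 mu k ->
    Del (fun x => 1 * u x + v x) k = Del u k + Del v k.
  move=> hu hv hk; rewrite /Del X_lin //.
  have -> : (fun x => phi x * (1 * u x + v x)) = (fun x => 1 * (phi x * u x) + phi x * v x).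
    by apply/funext => x; ring.
  rewrite inner_linl //; [ring|exact/isL2M/isH2_L2|exact/isL2M/isH2_L2].
have Dr u k k' : isH2 mu u -> isL2 mu k -> isL2 mu k' ->
    Del u (fun x => 1 * k x + k' x) = Del u k + Del u k'.
  move=> hu hk hk'; rewrite /Del inner_linr // ?inner_linr //.
  - rewrite conjc1; ring.
  - exact/isH2_L2/X_H2.
  - exact/isL2M/isH2_L2.
have subE (u P : T -> C) : u = (fun x => 1 * (u x - P x) + P x).
  by apply/funext => x; ring.
have D0 (p : pol R D) k : isH2 mu k -> Del p k = 0.
  move=> hk; have [k2 [Q [hQ cQ]]] := hk; apply: complex_ext => b; rewrite part0.
  apply: (@squeeze_seq _ (norm2 mu p) (M + c) (fun n => norm2 mu (fun x => k x - Q n x))).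
  - exact: norm2_ge0.
  - by rewrite addr_ge0 ?ltW //; lra.
  - exact: cQ.
  - move=> n s s0.
    have l2 := isH2_L2 (L2_subp (hQ n) hk).
    have -> : Del p k = Del p (fun x => k x - Q n x).
      rewrite {1}(subE k (Q n)) Dr //; last exact: (L2p (Pol (hQ n))).
      have -> : Del p (Q n) = 0 by rewrite /Del -(HB p (Pol (hQ n))) /B subrr.
      by rewrite addr0.
    exact: Db.
move=> k hk.
have -> : inner mu (fun x => phi x * f x - X f x) k = Del f k.
  rewrite (_ : (fun x => phi x * f x - X f x) = (fun x => (-1) * X f x + phi x * f x)).
    rewrite inner_linl; [|exact/isH2_L2/X_H2|exact/isL2M/isH2_L2|exact: isH2_L2].
    by rewrite /Del mulN1r addrC.
  by apply/funext => x; rewrite mulN1r addrC.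
have [f2 [P [hP cP]]] := hf; apply: complex_ext => b; rewrite part0.
apply: (@squeeze_seq _ (norm2 mu k) (M + c) (fun n => norm2 mu (fun x => f x - P n x))).
- exact: norm2_ge0.
- by rewrite addr_ge0 ?ltW //; lra.
- exact: cP.
- move=> n s s0; have h2 := L2_subp (hP n) hf.
  have -> : Del f k = Del (fun x => f x - P n x) k.
    rewrite {1}(subE f (P n)) Dl //; [|exact: (H2p (Pol (hP n)))|exact: isH2_L2].
    by rewrite (D0 (Pol (hP n))) // addr0.
  (* The small factor is now the first argument, so the weights [s] and [s^-1] change places. *)
  have si0 : 0 < s^-1 by rewrite invr_gt0.
  by have := Db b _ k _ h2 (isH2_L2 hk) si0; rewrite invrK [s^-1 * _ + _]addrC.
Qed.

End Converse.
End Toeplitz.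

(** * Determinant identities for the triple determinant *)

Section TripleDeterminant.
#[local] Arguments conjc : simpl never.
Variable R : realType.
Local Notation C := R[i].

Lemma adjmxM m n k (U : 'M[C]_(m, n)) (V : 'M[C]_(n, k)) :
  adjmx (U *m V) = adjmx V *m adjmx U.
Proof. by rewrite /adjmx map_mxM trmx_mul. Qed.

Lemma adjmx_delta m n (i : 'I_m) (j : 'I_n) : adjmx (delta_mx i j) = delta_mx j i :> 'M[C]_(n, m).
Proof. by apply/matrixP => a b; rewrite !mxE rmorph_nat andbC. Qed.

Lemma unitaryC n (u : 'M[C]_n) : unitary u -> adjmx u *m u = 1%:M.
Proof. by move=> h; exact: (mulmx1C h). Qed.

Lemma unitary_tr n (u : 'M[C]_n) : unitary u -> u^T *m adjmx u^T = 1%:M.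
Proof.
move=> hu; have := unitaryC hu => /(congr1 trmx); rewrite trmx_mul trmx1 => <-.
by congr (_ *m _); apply/matrixP => i j; rewrite !mxE.
Qed.

(** Sylvester's identity: the block matrix with identity diagonal and off-diagonal blocks [U], [V]
    is factored in two ways. *)
Lemma det_1sub_comm (K : comNzRingType) m n (U : 'M[K]_(m, n)) (V : 'M[K]_(n, m)) :
  \det (1%:M - U *m V) = \det (1%:M - V *m U).
Proof.
have E1 : block_mx 1%:M U V 1%:M = block_mx 1%:M 0 V 1%:M *m block_mx 1%:M U 0 (1%:M - V *m U).
  by rewrite mulmx_block !mul1mx !mul0mx !mulmx1 ?mulmx0 ?addr0 addrC subrK.
have E2 : block_mx 1%:M U V 1%:M = block_mx (1%:M - U *m V) U 0 1%:M *m block_mx 1%:M 0 V 1%:M.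
  by rewrite mulmx_block ?mulmx1 ?mul1mx ?mulmx0 ?mul0mx ?add0r subrK.
have := congr1 determinant E1; rewrite E2 !det_mulmx !det_ublock !det_lblock !det1 !mulr1 !mul1r.
by [].
Qed.

Lemma det1mx_comm m n (U : 'M[C]_(m, n)) (V : 'M[C]_(n, m)) :
  det1mx (U *m V) = det1mx (V *m U).
Proof.
rewrite /det1mx !map_mxM /= scalemxAl det_1sub_comm.
by rewrite -scalemxAr.
Qed.

Lemma det1mx_1 n : det1mx (1%:M : 'M[C]_n) = (1 - 'X) ^+ n.
Proof.
rewrite /det1mx map_mx1 -det_scalar; congr determinant.
by apply/matrixP => i j; rewrite !mxE; case: (i == j); rewrite ?mulr1 ?mulr0 ?subr0.
Qed.

Lemma coef_1subX n l : (-1) ^+ l * (((1 - 'X) ^+ n : {poly C})`_l) = ('C(n, l))%:R.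
Proof.
rewrite -['X]scale1r -scaleNr exprDn coef_sum.
have E (i : 'I_n.+1) : ((1 ^+ (n - i) * (-1 *: 'X) ^+ i *+ 'C(n, i) : {poly C})`_l) =
    (l == i :> nat)%:R * ((-1) ^+ i * ('C(n, i))%:R).
  by rewrite expr1n mul1r exprZn coefMn coefZ coefXn -mulr_natr; ring.
under eq_bigr do rewrite E.
case: (ltnP l n.+1) => ln; last first.
  rewrite bin_small // big1 ?mulr0 // => i _.
  by rewrite gtn_eqF ?mul0r // (leq_trans (ltn_ord i)).
rewrite (bigD1 (Ordinal ln)) //= eqxx mul1r big1 ?addr0.
  by rewrite mulrA -exprMn mulrNN mulr1 expr1n mul1r.
move=> i ne; rewrite (_ : (l == i) = false) ?mul0r //.
by apply/negbTE; apply: contra ne => /eqP e; apply/eqP/val_inj.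
Qed.

Lemma det_mx22 (K : comNzRingType) (M : 'M[K]_2) :
  \det M = M 0 0 * M 1 1 - M 0 1 * M 1 0.
Proof.
have l0 : lift 0 0 = 1 :> 'I_2 by exact/val_inj.
have l1 : lift 1 0 = 0 :> 'I_2 by exact/val_inj.
rewrite (expand_det_row _ 0) !big_ord_recl big_ord0 /cofactor !det_mx11 !mxE /= !l0 !l1 /=.
by rewrite expr0 expr1 !mul1r addr0 mulN1r mulrN.
Qed.

Lemma det1mx_22 (M : 'M[C]_2) :
  det1mx M = 1 - (M 0 0 + M 1 1) *: 'X + (M 0 0 * M 1 1 - M 0 1 * M 1 0) *: 'X^2.
Proof.
rewrite /det1mx det_mx22 !mxE /= -!mul_polyC polyCD polyCB !polyCM; ring.
Qed.

(* The two nonzero columns of [z (e_ij + s e_ji)^*]; Sylvester's identity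
   reduces the determinant to their 2 x 2 minor. *)
Lemma det1mx_delta2 n (z : 'M[C]_n) (i j : 'I_n) (s : C) : conjc s = s ->
  det1mx (z *m adjmx (delta_mx i j + s *: delta_mx j i)) =
    1 - (z i j + s * z j i) *: 'X + (z i j * (s * z j i) - (s * z i i) * z j j) *: 'X^2.
Proof.
move=> sJ.
pose U : 'M[C]_(n, 2) := \matrix_(a, k) (if k == 0 then z a j else s * z a i).
pose V : 'M[C]_(2, n) := \matrix_(k, a) (if k == 0 then (a == i)%:R else (a == j)%:R).
have -> : z *m adjmx (delta_mx i j + s *: delta_mx j i) = U *m V.
  apply/matrixP => a b; rewrite !mxE !big_ord_recl big_ord0 !mxE /= addr0.
  under eq_bigr => k _ do rewrite !mxE rmorphD rmorphM /= !rmorph_nat sJ mulrDr.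
  rewrite big_split /=; congr (_ + _).
    rewrite (bigD1 j) //= eqxx andbT big1 ?addr0 // => k /negbTE ->.
    by rewrite andbF mulr0.
  rewrite (bigD1 i) //= eqxx andbT big1 ?addr0; first by rewrite mulrCA mulrA.
  by move=> k /negbTE ->; rewrite andbF !mulr0.
rewrite det1mx_comm det1mx_22.
have VU k l : (V *m U) k l = U (if k == 0 then i else j) l.
  rewrite mxE; case: (k =P 0) => [->|/eqP/negbTE k0].
    rewrite (bigD1 i) //= big1 => [|a /negbTE ai]; rewrite !mxE ?eqxx ?ai ?mul0r //.
    by rewrite mul1r addr0 ?mxE.
  rewrite (bigD1 j) //= big1 => [|a /negbTE ai]; rewrite !mxE k0 ?eqxx ?ai ?mul0r //.
  by rewrite mul1r addr0 ?mxE.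
by rewrite !VU !mxE /=.
Qed.

(** In an integral domain two square roots differ by a sign, and the value 1 at 0 excludes the
    opposite root. *)
Lemma xget_sqrt (d Q : {poly C}) : Q.[0] = 1 -> Q ^+ 2 = d ->
  xget 0 [set P : {poly C} | P.[0] = 1 /\ P ^+ 2 = d] = Q.
Proof.
move=> Q0 Qd; case: xgetP => [P _ [P0 Pd]|/(_ Q)]; last by case.
move: Pd; rewrite -Qd => /eqP; rewrite eqf_sqr => /orP[/eqP //|/eqP PQ].
move: P0; rewrite PQ hornerN Q0 => /eqP; rewrite -subr_eq0 -opprD oppr_eq0.
by rewrite -mulr2n pnatr_eq0.
Qed.

End TripleDeterminant.

(** * The triple determinant on the Shilov boundary *)

Section ShilovBoundary.
#[local] Arguments conjc : simpl never.
Variable R : realType.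
Local Notation C := R[i].

Lemma frame_CI n m : (n <= m)%N ->
  frame_sum R (CI n m) *m adjmx (frame_sum R (CI n m)) = 1%:M.
Proof.
move=> nm; apply/matrixP => i j; rewrite !mxE.
have im : (i < m)%N by exact: leq_trans (ltn_ord i) nm.
rewrite (bigD1 (Ordinal im)) //= big1 => [|k ki].
  rewrite !mxE /= eqxx mul1r addr0 -val_eqE /= eq_sym.
  by case: (_ == _); rewrite ?conjc1 ?conjc0.
rewrite !mxE (_ : (i == k :> nat) = false) ?mul0r //.
by apply/negbTE; apply: contra ki => /eqP e; apply/eqP/val_inj.
Qed.

(** The partner of an index in the 2 x 2 antisymmetric blocks of the type III frame. For odd size
    the last index has its mate out of range, so its row is zero. *)
Definition mate (i : nat) := if odd i then i.-1 else i.+1.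

Lemma mate_inj : injective mate.
Proof.
apply: (can_inj (g := mate)) => i; rewrite /mate; case: (boolP (odd i)) => hi.
  by case: i hi => //= i /negbTE ->.
by rewrite /= hi.
Qed.

Lemma frame_CIII n (i k : 'I_n) : frame_sum R (CIII n) i k =
  (-1) ^+ (odd i) * (k == mate i :> nat)%:R.
Proof.
rewrite !mxE /mate; case: (boolP (odd i)) => hi /=; last first.
  rewrite expr0 mul1r; case: eqP => //= ki.
  case: ifP => // /andP[ok /eqP ik]; move: hi; rewrite ik /= ok //.
rewrite expr1 mulN1r; have i0 : (0 < i)%N by case: (nat_of_ord i) hi.
have -> : (i == k.+1 :> nat) = (k == i.-1 :> nat) by rewrite -{1}(prednK i0) eqSS eq_sym.
case: eqP => [->|_]; last by rewrite andbF oppr0.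
by have := hi; rewrite -{1}(prednK i0) /= => ->.
Qed.

Lemma mate_lt n i : (i < n)%N -> (mate i < n)%N = (i < n./2.*2)%N.
Proof.
move=> lt_in; rewrite /mate -muln2.
have := odd_double_half n; have := odd_double_half i; rewrite -!muln2.
by case: (odd i); case: (odd n); lia.
Qed.

Lemma frame_CIII_gram n : frame_sum R (CIII n) *m adjmx (frame_sum R (CIII n)) =
  diag_mx (\row_(i < n) (i < n./2.*2)%N%:R).
Proof.
apply/matrixP => i j; rewrite !mxE.
under eq_bigr => k _ do rewrite [adjmx _ _ _]mxE [map_mx _ _ _ _]mxE !frame_CIII rmorphM rmorph_sign rmorph_nat.
rewrite -(mate_lt (ltn_ord i)).
case: (ltnP (mate i) n) => hm; last first.
  rewrite mul0rn big1 // => k _; rewrite (_ : (k == mate i :> nat) = false) ?mulr0 ?mul0r //.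
  by rewrite ltn_eqF // (leq_trans (ltn_ord k)).
rewrite (bigD1 (Ordinal hm)) //= eqxx mulr1 big1 => [|k ki]; last first.
  rewrite (_ : (k == mate i :> nat) = false) ?mulr0 ?mul0r //.
  by apply/negbTE; apply: contra ki => /eqP e; apply/eqP/val_inj.
rewrite addr0 (inj_eq mate_inj) val_eqE; case: (i =P j) => [->|_]; last by rewrite !mulr0.
by rewrite mulr1 -expr2 sqrr_sign.
Qed.

Lemma det1mx_diag n k : (k <= n)%N ->
  det1mx (diag_mx (\row_(i < n) ((i < k)%N%:R : C))) = (1 - 'X) ^+ k.
Proof.
move=> kn; rewrite /det1mx.
have -> : 1%:M - 'X *: map_mx polyC (diag_mx (\row_(i < n) ((i < k)%N%:R : C))) =
    diag_mx (\row_(i < n) (if (i < k)%N then 1 - 'X else 1 : {poly C})).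
  apply/matrixP => i j; rewrite !mxE; case: (i == j); rewrite ?mulr0n ?mulr1n.
    by case: (i < k)%N; rewrite ?mulr1 ?mulr0 ?subr0.
  by rewrite mulr0 subr0.
rewrite det_diag; under eq_bigr do rewrite mxE.
rewrite -big_mkcond /= -(big_ord_widen _ (fun=> 1 - 'X) kn).
by rewrite prodr_const card_ord.
Qed.

(** Needed because the kernel identity for [psi] is assumed only on the space [V]. *)
Lemma shilov_inV D (z : cmx R D) : shilov z -> inV z.
Proof.
case: D z => [n m|n|n|n] z //= [k [[u [hu ->]] ->]] /=.
  by rewrite !trmx_mul trmx1 trmxK mulmxA.
rewrite !trmx_mul trmxK mulmxA -mulNmx -mulmxN; congr (_ *m _ *m _).
apply/matrixP => i j; rewrite !mxE.
case: (boolP (~~ odd j && (i == j.+1 :> nat))) => [/andP[oj /eqP e]|_].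
  by rewrite e /= (negbTE oj) /= opprK.
by case: ifP => _; rewrite ?oppr0.
Qed.

(** The polynomial is [(1 - X) ^ r] in each type. For I and II, [z z^*] is the identity; for III it
    is unitarily equivalent to a projection of rank [2 * n./2], and the square root is taken; for
    IV, [z z^* = 1] and [z z^T = c ^ 2] has modulus 1. *)
Lemma shilov_jdelta D (z : cmx R D) l : cartan_valid D -> shilov z ->
  jdelta_l l z z = ('C(crank D, l))%:R.
Proof.
case: D z => [n m|n|n|n] z /= hD [k [hk ->]]; rewrite /jdelta_l /=.
- case: hk => [u [v [hu [hv ->]]]].
  have -> : u *m frame_sum R (CI n m) *m v *m adjmx (u *m frame_sum R (CI n m) *m v) = 1%:M.
    rewrite !adjmxM !mulmxA -(mulmxA _ v) hv mulmx1 -(mulmxA u) frame_CI ?mulmx1 //.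
    by case: hD.
  by rewrite det1mx_1 coef_1subX.
- case: hk => [u [hu ->]].
  have -> : u *m 1%:M *m u^T *m adjmx (u *m 1%:M *m u^T) = 1%:M.
    by rewrite mulmx1 adjmxM !mulmxA -(mulmxA u) unitary_tr // mulmx1.
  by rewrite det1mx_1 coef_1subX.
- case: hk => [u [hu ->]].
  rewrite (@xget_sqrt _ _ ((1 - 'X) ^+ n./2)) ?coef_1subX //.
    by rewrite horner_exp !hornerE subr0 expr1n.
  set e := frame_sum R (CIII n).
  have -> : u *m e *m u^T *m adjmx (u *m e *m u^T) = u *m ((e *m adjmx e) *m adjmx u).
    by rewrite !adjmxM !mulmxA -(mulmxA _ u^T) unitary_tr // mulmx1.
  rewrite frame_CIII_gram det1mx_comm -mulmxA unitaryC // mulmx1 det1mx_diag.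
    by rewrite -exprM muln2.
  by rewrite -[leqRHS](odd_double_half n) leq_addl.
- case: hk => [c [q [hc [ho [_ ->]]]]].
  pose e : 'M[C]_(1, n) := frame_sum R (CIV n).
  have oo : (rcast q)^T *m rcast q = 1%:M.
    apply: mulmx1C.
    have -> : (rcast q)^T = map_mx (real_complex R) q^T by apply/matrixP => i j; rewrite !mxE.
    rewrite -[rcast q]/(map_mx (real_complex R) q) -(map_mxM (real_complex R)) ho.
    exact: (map_mx1 (real_complex R)).
  have ee : e *m e^T = 1%:M.
    apply/matrixP => i j; rewrite !mxE !ord1 eqxx.
    have n0 : (0 < n)%N by exact: leq_trans hD.
    rewrite (bigD1 (Ordinal n0)) //= big1 => [|k' kk]; rewrite !mxE /= ?mulr1 ?addr0 //.
    by rewrite (_ : (k' == 0%N :> nat) = false) ?mul0r //; apply/negbTE; apply: contra kk => /eqP kE; apply/eqP/val_inj.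
  have eJ : adjmx e = e^T.
    by apply/matrixP => i j; rewrite !mxE; case: ifP; rewrite ?conjc1 ?conjc0.
  have oJ : adjmx ((rcast q)^T) = rcast q.
    by apply/matrixP => i j; rewrite !mxE /conjc oppr0.
  have zz : (c *: (e *m (rcast q)^T)) *m (c *: (e *m (rcast q)^T))^T = (c * c)%:M.
    rewrite linearZ /= -scalemxAl -scalemxAr scalerA trmx_mul trmxK mulmxA -(mulmxA e) oo mulmx1 ee.
    by rewrite scalemx1.
  have zw : (c *: (e *m (rcast q)^T)) *m adjmx (c *: (e *m (rcast q)^T)) = 1%:M.
    have -> : adjmx (c *: (e *m (rcast q)^T)) = conjc c *: (rcast q *m e^T).
      rewrite -{2}oJ -eJ -adjmxM; move: (e *m (rcast q)^T) => W.
      by apply/matrixP => i j; rewrite !mxE rmorphM.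
    rewrite -scalemxAl -scalemxAr scalerA hc scale1r mulmxA -(mulmxA e) oo mulmx1 ee //.
  rewrite zz zw !mxE eqxx /= !mulr1n.
  have -> : c * c * conjc (c * c) = 1 by rewrite rmorphM /= mulrACA hc mulr1.
  have -> : 1 - (2 * 1) *: 'X + 1 *: 'X ^+ 2 = (1 - 'X) ^+ 2 :> {poly C}.
    by rewrite mulr1 scale1r scaler_nat; ring.
  by rewrite coef_1subX.
Qed.

(** Testing the kernel at a suitable [w] isolates one coordinate, which exhibits it as a combination
    of the degree-one [psi]. The left case is the diagonal in type III; the constant 2 is
    [z i j + z j i] in type II and the normalisation of the kernel in type IV. *)
Lemma jdelta1_coord D (i : 'I_(cp D)) (j : 'I_(cq D)) :
  (forall z : cmx R D, inV z -> z i j = 0) \/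
  exists (w : cmx R D) (c : C), [/\ inV w, c != 0 &
    forall z : cmx R D, inV z -> jdelta_l 1 z w = c * z i j].
Proof.
case: D i j => [n m|n|n|n] /= i j.
- right; exists (delta_mx i j), 1; split; rewrite ?oner_eq0 // => z _.
  rewrite /jdelta_l /= adjmx_delta.
  have -> : z *m delta_mx j i = col j z *m (delta_mx 0 i : 'rV[C]_n).
    by rewrite colE -mulmxA mul_delta_mx.
  rewrite det1mx_comm /det1mx det_mx11 !mxE eqxx coefB coef1 /= coefXM /= coefC /= (bigD1 i) //= big1.
    by rewrite !mxE !eqxx /=; ring.
  by move=> k ki; rewrite !mxE (negbTE ki) /= mul0r.
- right; exists (delta_mx i j + 1 *: delta_mx j i), 2; split.
  + by rewrite linearD linearZ /= !trmx_delta !scale1r addrC.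
  + by rewrite pnatr_eq0.
  move=> z zT; rewrite /jdelta_l /= det1mx_delta2 ?conjc1 //.
  have -> : z j i = z i j by rewrite -[in LHS]zT mxE.
  by rewrite coefD coefB !coefZ coef1 coefX coefXn /=; ring.
- have zD (z : 'M[C]_n) : z^T = - z -> forall k, z k k = 0.
    move=> zT k; have : z k k = - z k k by rewrite -{1}[z]trmxK zT !mxE.
    by move/eqP; rewrite -addr_eq0 -mulr2n mulrn_eq0 => /eqP.
  case: (i =P j) => [->|_]; first by left => z /zD.
  right; exists (delta_mx i j + (-1) *: delta_mx j i), 1; split; rewrite ?oner_eq0 //.
    by rewrite linearD linearZ /= !trmx_delta !scaleN1r opprD opprK addrC.
  move=> z zT; rewrite /jdelta_l /=.
  rewrite (@xget_sqrt _ _ (1 - z i j *: 'X)).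
  + by rewrite coefB coefZ coef1 coefX /=; ring.
  + by rewrite !hornerE; ring.
  rewrite det1mx_delta2; last by rewrite rmorphN1.
  have -> : z j i = - z i j by have := congr1 (fun M : 'M[C]_n => M i j) zT; rewrite !mxE.
  rewrite !zD // -!mul_polyC !(polyCD, polyCB, polyCM, polyCN, polyC0); ring.
- right; exists (delta_mx i j), 2; split; [by []|by rewrite pnatr_eq0|].
  move=> z _; rewrite /jdelta_l /= adjmx_delta.
  have -> : (z *m delta_mx j i) 0 0 = z i j.
    by rewrite !ord1 -colE mxE.
  by rewrite coefD coefB !coefZ coef1 coefX coefXn /=; ring.
Qed.

End ShilovBoundary.

(** * Continuity of complex matrix-valued maps *)

Section ComplexContinuity.
#[local] Arguments conjc : simpl never.
Variables (R : realType) (P : topologicalType).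
Local Notation C := R[i].

(** Tested on both parts, so that only the topology of the reals enters. *)
Definition ccont (h : P -> C) := forall b, continuous (fun p => part b (h p) : R).

Lemma ccont_cst c : ccont (fun=> c).
Proof. by move=> b p; exact: cvg_cst. Qed.

Lemma ccontD f g : ccont f -> ccont g -> ccont (fun p => f p + g p).
Proof.
move=> hf hg b.
have -> : (fun p => part b (f p + g p)) = (fun p => part b (f p) + part b (g p)).
  by apply/funext => p; rewrite partD.
by move=> p; exact: cvgD (hf b p) (hg b p).
Qed.

Lemma ccontM f g : ccont f -> ccont g -> ccont (fun p => f p * g p).
Proof.
move=> hf hg [].
  have -> : (fun p => part true (f p * g p)) = (fun p =>
      part true (f p) * part true (g p) - part false (f p) * part false (g p)).
    by apply/funext => p; exact: ReM.
  by move=> p; apply: cvgB; apply: cvgM; [exact: hf|exact: hg|exact: hf|exact: hg].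
have -> : (fun p => part false (f p * g p)) = (fun p =>
    part true (f p) * part false (g p) + part false (f p) * part true (g p)).
  by apply/funext => p; exact: ImM.
by move=> p; apply: cvgD; apply: cvgM; [exact: hf|exact: hg|exact: hf|exact: hg].
Qed.

Lemma ccontJ f : ccont f -> ccont (fun p => conjc (f p)).
Proof.
move=> hf [].
  have -> : (fun p => part true (conjc (f p))) = (fun p => part true (f p)).
    by apply/funext => p; case: (f p).
  exact: hf.
have -> : (fun p => part false (conjc (f p))) = (fun p => - part false (f p)).
  by apply/funext => p; case: (f p).
by move=> p; apply: cvgN; exact: hf.
Qed.

Lemma ccont_sum (J : Type) (s : seq J) (F : J -> P -> C) :
  (forall j, ccont (F j)) -> ccont (fun p => \sum_(j <- s) F j p).
Proof.
move=> hF; elim: s => [|j s IH].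
  by under eq_fun do rewrite big_nil; exact: ccont_cst.
by under eq_fun do rewrite big_cons; exact: ccontD.
Qed.

Lemma ccont_prod (J : Type) (s : seq J) (F : J -> P -> C) :
  (forall j, ccont (F j)) -> ccont (fun p => \prod_(j <- s) F j p).
Proof.
move=> hF; elim: s => [|j s IH].
  by under eq_fun do rewrite big_nil; exact: ccont_cst.
by under eq_fun do rewrite big_cons; exact: ccontM.
Qed.

Definition mcont m n (M : P -> 'M[C]_(m, n)) := forall i j, ccont (fun p => M p i j).

Lemma mcont_cst m n (M : 'M[C]_(m, n)) : mcont (fun=> M).
Proof. by move=> i j; exact: ccont_cst. Qed.

Lemma mcontM m n k (U : P -> 'M[C]_(m, n)) (V : P -> 'M[C]_(n, k)) :
  mcont U -> mcont V -> mcont (fun p => U p *m V p).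
Proof.
move=> hU hV i j; under eq_fun do rewrite mxE.
by apply: ccont_sum => l; exact: ccontM.
Qed.

Lemma mcont_tr m n (U : P -> 'M[C]_(m, n)) : mcont U -> mcont (fun p => (U p)^T).
Proof. by move=> hU i j; under eq_fun do rewrite mxE; exact: hU. Qed.

Lemma mcont_adj m n (U : P -> 'M[C]_(m, n)) : mcont U -> mcont (fun p => adjmx (U p)).
Proof. by move=> hU i j; under eq_fun do rewrite !mxE; apply: ccontJ; exact: hU. Qed.

Lemma mcontZ m n (c : P -> C) (U : P -> 'M[C]_(m, n)) : ccont c -> mcont U ->
  mcont (fun p => c p *: U p).
Proof. by move=> hc hU i j; under eq_fun do rewrite !mxE; exact: ccontM. Qed.

Lemma ccont_det n (U : P -> 'M[C]_n) : mcont U -> ccont (fun p => \det (U p)).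
Proof.
move=> hU; rewrite /determinant; apply: ccont_sum => s.
by apply: ccontM; [exact: ccont_cst|apply: ccont_prod => i; exact: hU].
Qed.

Lemma closed_ceq (h : P -> C) c : ccont h -> closed [set p | h p = c].
Proof.
move=> hh; have -> : [set p | h p = c] =
    \bigcap_(b in [set: bool]) ((fun p => part b (h p)) @^-1` [set x | x = part b c]).
  apply/seteqP; split => [p /= hp b _ /=|p /= H]; first by rewrite hp.
  by apply: complex_ext => b; exact: H.
apply: closed_bigI => b _; apply: preimage_closed; last exact: closed_eq.
by move=> p _; exact: hh.
Qed.

Lemma closed_meq m n (M : P -> 'M[C]_(m, n)) (N : 'M[C]_(m, n)) :
  mcont M -> closed [set p | M p = N].
Proof.
move=> hM; have -> : [set p | M p = N] =
    \bigcap_(ij in [set: 'I_m * 'I_n]) [set p | M p ij.1 ij.2 = N ij.1 ij.2].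
  apply/seteqP; split => [p /= hp ij _ /=|p /= H]; first by rewrite hp.
  by apply/matrixP => i j; exact: (H (i, j)).
by apply: closed_bigI => ij _; apply: closed_ceq.
Qed.

End ComplexContinuity.

(** * Continuous images of compact sets are Borel *)

Section CompactImage.
Variables (R : realType) (D : cartan).
Local Notation C := R[i].
Local Notation T := (Cspace R D).

Definition cdist (z w : cmx R D) : R :=
  \sum_(i < cp D) \sum_(j < cq D) (`|part true (z i j - w i j)| + `|part false (z i j - w i j)|).

Lemma cdist_ge0 z w : 0 <= cdist z w.
Proof. by apply: sumr_ge0 => i _; apply: sumr_ge0 => j _; rewrite addr_ge0. Qed.

Lemma cdistC z w : cdist z w = cdist w z.
Proof.
apply: eq_bigr => i _; apply: eq_bigr => j _.
by case: (z i j) => a b; case: (w i j) => c d /=; rewrite distrC [`|b - d|]distrC.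
Qed.

Lemma cdist_tri z w y : cdist z y <= cdist z w + cdist w y.
Proof.
rewrite /cdist -big_split /=; apply: ler_sum => i _; rewrite -big_split /=; apply: ler_sum => j _.
case: (z i j) => a b; case: (w i j) => c d; case: (y i j) => e f /=.
by have := ler_distD c a e; have := ler_distD d b f; lra.
Qed.

Lemma cdist_eq0 z w : cdist z w = 0 -> z = w.
Proof.
move=> /eqP; rewrite psumr_eq0; last by move=> i _; apply: sumr_ge0 => j _; rewrite addr_ge0.
move=> /allP H; apply/matrixP => i j.
have := H i (mem_index_enum _); rewrite /= psumr_eq0; last by move=> j' _; rewrite addr_ge0.
move=> /allP /(_ j (mem_index_enum _)) /=; rewrite paddr_eq0 // !normr_eq0.
case: (z i j) => a b; case: (w i j) => c d /=; rewrite !subr_eq0.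
by move=> /andP[/eqP -> /eqP ->].
Qed.

Lemma cdist_meas (w : cmx R D) : measurable_fun setT (fun z : T => cdist z w).
Proof.
rewrite /cdist; apply: measurable_sum => i; apply: measurable_sum => j.
have /cmeasP mz := cmeasD (coord_meas R i j) (cmeas_cst D (- w i j)).
by apply: measurable_funD; apply: measurableT_comp (mz _).
Qed.

Lemma ratr_dense (w : cmx R D) (e : R) : 0 < e -> exists c : {ffun 'I_(cp D) * 'I_(cq D) -> rat * rat},
  cdist w (\matrix_(i, j) Complex (ratr (c (i, j)).1) (ratr (c (i, j)).2)) < e.
Proof.
move=> e0; pose K : R := (cp D * cq D)%:R * 2 + 1.
have K0 : 0 < K by rewrite /K; have := @ler0n R (cp D * cq D); lra.
have d0 : 0 < e / K by exact: divr_gt0.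
have H (x : R) : exists q : rat, `|x - ratr q| <= e / K.
  have [|q] := @rat_in_itvoo R x (x + e / K); first by rewrite ltrDl.
  rewrite in_itv /= => /andP[q1 q2]; exists q.
  by rewrite distrC ger0_norm ?subr_ge0 ?ltW //; lra.
have [ap apP] := choice H.
exists [ffun ij => (ap (complex.Re (w ij.1 ij.2)), ap (complex.Im (w ij.1 ij.2)))].
apply: (@le_lt_trans _ _ (\sum_(i < cp D) \sum_(j < cq D) 2 * (e / K))).
  apply: ler_sum => i _; apply: ler_sum => j _; rewrite mxE ffunE /=.
  case: (w i j) => a b /=; have := apP a; have := apP b; lra.
under eq_bigr do rewrite sumr_const card_ord.
rewrite sumr_const card_ord -mulrnA -mulr_natl.
have eK : e = (e / K) * K by rewrite divfK // gt_eqF.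
rewrite [ltRHS]eK /K; move: d0; set d := e / K => d0; rewrite mulnC.
lra.
Qed.

Variables (P : topologicalType) (K : set P) (F : P -> cmx R D).
Hypothesis cK : compact K.
Hypothesis cF : mcont F.

Lemma compact_image_dist (z : cmx R D) : ~ (exists2 p, K p & z = F p) ->
  exists2 e : R, 0 < e & forall p, K p -> e <= cdist z (F p).
Proof.
move=> Hz; pose g p := cdist z (F p).
have cg : continuous g.
  have cts_sum (J : Type) (s : seq J) (G : J -> P -> R) :
      (forall j, continuous (G j)) -> continuous (fun p => \sum_(j <- s) G j p).
    move=> hG; elim: s => [|j s IH].
      by under eq_fun do rewrite big_nil; move=> p; exact: cvg_cst.
    under eq_fun do rewrite big_cons.
    by move=> p; exact: cvgD (hG j p) (IH p).
  rewrite /g /cdist; apply: (@cts_sum) => i; apply: (@cts_sum) => j p.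
  have h : ccont (fun p => z i j - F p i j).
    under eq_fun do rewrite -mulN1r.
    by apply: ccontD; [exact: ccont_cst|apply: ccontM; [exact: ccont_cst|exact: cF]].
  by apply: cvgD; apply: cvg_norm; exact: h.
have gK : compact (g @` K).
  by apply: continuous_compact => //; exact: continuous_subspaceT.
have gC : closed (g @` K) by apply: compact_closed => //; exact: Rhausdorff.
have : (~` (g @` K)) 0.
  by move=> [p Kp gp]; apply: Hz; exists p => //; exact: cdist_eq0.
have oC : open (~` (g @` K)) by rewrite openC.
move=> g0; have /nbhs_ballP[e e0 He] : nbhs (0 : R) (~` (g @` K)).
  by apply: open_nbhs_nbhs; split.
exists e => // p Kp; rewrite leNgt; apply/negP => lt.
apply: (He (g p)); last by exists p.
by rewrite /ball /= sub0r normrN ger0_norm ?cdist_ge0.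
Qed.

Lemma compact_image_meas : measurable ([set z | exists2 p, K p & z = F p] : set T).
Proof.
set S := [set z | _].
pose J := ({ffun 'I_(cp D) * 'I_(cq D) -> rat * rat} * rat)%type.
pose ctr (c : {ffun 'I_(cp D) * 'I_(cq D) -> rat * rat}) : cmx R D :=
  \matrix_(i, j) Complex (ratr (c (i, j)).1) (ratr (c (i, j)).2).
pose box (c : J) : set T := [set z | cdist z (ctr c.1) < ratr c.2 /\
   forall s, S s -> ~ cdist s (ctr c.1) < ratr c.2].
have mbox c : measurable (box c).
  have [H|H] := pselect (forall s, S s -> ~ cdist s (ctr c.1) < ratr c.2).
    have -> : box c = (fun z => cdist z (ctr c.1)) @^-1` `]-oo, ratr c.2[.
      by apply/seteqP; split => z; rewrite /box /= in_itv /= => //; case.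
    by rewrite -[_ @^-1` _]setTI; apply: cdist_meas.
  by rewrite (_ : box c = set0) //; apply/seteqP; split => // z [].
have SE : ~` S = \bigcup_c box c.
  apply/seteqP; split => [z Sz|z [c _ [zc Hc]] Sz]; last exact: Hc Sz zc.
  have [e e0 He] := compact_image_dist Sz.
  have e4 : 0 < e / 4 by lra.
  have [c zc] := ratr_dense z e4.
  have [|q] := @rat_in_itvoo R (e / 4) (e / 2); first by lra.
  rewrite in_itv /= => /andP[q1 q2]; exists (c, q) => //; split => /=.
    exact: lt_trans zc q1.
  move=> s [p Kp ->] sc; have := He p Kp; have := cdist_tri z (ctr c) (F p).
  by rewrite (cdistC (ctr c)); move: zc sc; rewrite -/(ctr c); lra.
rewrite -[S]setCK SE; apply: measurableC; apply: countable_bigcupT_measurable => //.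
exact: countableP.
Qed.

End CompactImage.

Section ShilovMeasurable.
#[local] Arguments conjc : simpl never.
Variable R : realType.
Local Notation C := R[i].

Lemma unitary_entry n (u : 'M[C]_n) i j b : unitary u -> `|part b (u i j)| <= 1.
Proof.
move=> hu; have : \sum_k cabs2 (u i k) = 1.
  have := congr1 (fun M : 'M[C]_n => M i i) hu; rewrite !mxE eqxx /=.
  under eq_bigr do rewrite !mxE.
  by rewrite -sum_cabs2 => -[].
rewrite (bigD1 j) //= => H.
have : cabs2 (u i j) <= 1.
  by rewrite -H lerDl; apply: sumr_ge0 => k _; exact: cabs2_ge0.
move=> H1; rewrite -(@expr_le1 _ 2) // real_normK ?num_real //.
apply: le_trans H1; rewrite /cabs2; case: b => /=; rewrite ?lerDl ?lerDr sqr_ge0 //.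
Qed.

Lemma unitary_param_meas (D : cartan) a b (Q : 'M[C]_a -> 'M[C]_b -> Prop)
    (F : 'M[C]_a -> 'M[C]_b -> cmx R D) :
  (forall (P : topologicalType) (U : P -> 'M[C]_a) (V : P -> 'M[C]_b),
    mcont U -> mcont V -> closed [set p | Q (U p) (V p)]) ->
  (forall (P : topologicalType) (U : P -> 'M[C]_a) (V : P -> 'M[C]_b),
    mcont U -> mcont V -> mcont (fun p => F (U p) (V p))) ->
  measurable ([set z | exists u v, [/\ unitary u, unitary v, Q u v & z = F u v]] : set (Cspace R D)).
Proof.
move=> cQ cF.
pose I : eqType := ((bool * ('I_a * 'I_a)) + (bool * ('I_b * 'I_b)))%type.
pose P : topologicalType := prod_topology (fun _ : I => (R : topologicalType)).
pose U (f : P) : 'M[C]_a := \matrix_(i, j) Complex (f (inl (true, (i, j)))) (f (inl (false, (i, j)))).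
pose V (f : P) : 'M[C]_b := \matrix_(i, j) Complex (f (inr (true, (i, j)))) (f (inr (false, (i, j)))).
have cp k : continuous (fun f : P => f k : R).
  exact: (@proj_continuous I (fun=> (R : topologicalType)) k).
have mU : mcont U.
  by move=> i j; under eq_fun do rewrite mxE; case; exact: cp.
have mV : mcont V.
  by move=> i j; under eq_fun do rewrite mxE; case; exact: cp.
pose cube := [set f : P | forall k, `[-1, 1] (f k)].
have ccube : compact cube.
  exact: (@tychonoff I (fun=> (R : topologicalType)) (fun=> `[-1, 1]) (fun=> @segment_compact R (-1) 1)).
pose K := cube `&` ([set f | U f *m adjmx (U f) = 1%:M] `&`
   ([set f | V f *m adjmx (V f) = 1%:M] `&` [set f | Q (U f) (V f)])).
have cK : compact K.
  apply: compact_closedI => //; apply: closedI; last apply: closedI.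
  - by apply: closed_meq; apply: mcontM => //; exact: mcont_adj.
  - by apply: closed_meq; apply: mcontM => //; exact: mcont_adj.
  - exact: cQ.
rewrite (_ : [set z | _] = [set z | exists2 p, K p & z = F (U p) (V p)]).
  by apply: (compact_image_meas cK); exact: cF.
apply/seteqP; split => z; last first.
  by move=> [p [_ [hu [hv hq]]] ->]; exists (U p), (V p).
move=> [u [v [hu hv hq ->]]].
pose f : P := fun k => match k with
  | inl (b, (i, j)) => part b (u i j) | inr (b, (i, j)) => part b (v i j) end.
have Uf : U f = u by apply/matrixP => i j; rewrite mxE /=; case: (u i j).
have Vf : V f = v by apply/matrixP => i j; rewrite mxE /=; case: (v i j).
exists f; rewrite ?Uf ?Vf //; split; last by rewrite /= Uf Vf.
by move=> [[c [i j]]|[c [i j]]] /=; rewrite in_itv /= -ler_norml; exact: unitary_entry.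
Qed.

Lemma unitary0 : unitary (0 : 'M[C]_0).
Proof. by apply/matrixP => -[]. Qed.

Lemma shilov_measurable D : measurable (@shilov R D : set (Cspace R D)).
Proof.
case: D => [n m|n|n|n].
- rewrite (_ : @shilov R (CI n m) = [set z | exists (u : 'M[C]_n) (v : 'M[C]_m),
     [/\ unitary u, unitary v, True & z = u *m frame_sum R (CI n m) *m v]]).
    apply: (@unitary_param_meas (CI n m) n m (fun _ _ => True)
      (fun u v => u *m frame_sum R (CI n m) *m v)).
      by move=> P U V _ _; exact: closedT.
    by move=> P U V hU hV; apply: mcontM => //; apply: mcontM => //; exact: mcont_cst.
  apply/seteqP; split => z; first by move=> [k [[u [v [hu [hv ->]]]] ->]]; exists u, v.
  by move=> [u [v [hu hv _ ->]]]; exists (fun z => u *m z *m v); split => //; exists u, v.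
- rewrite (_ : @shilov R (CII n) = [set z | exists (u : 'M[C]_n) (v : 'M[C]_0),
     [/\ unitary u, unitary v, True & z = u *m frame_sum R (CII n) *m u^T]]).
    apply: (@unitary_param_meas (CII n) n 0 (fun _ _ => True)
      (fun u v => u *m frame_sum R (CII n) *m u^T)).
      by move=> P U V _ _; exact: closedT.
    move=> P U V hU hV; apply: mcontM; last exact: mcont_tr.
    by apply: mcontM => //; exact: mcont_cst.
  apply/seteqP; split => z; first by move=> [k [[u [hu ->]] ->]]; exists u, 0; split => //; exact: unitary0.
  by move=> [u [v [hu hv _ ->]]]; exists (fun z => u *m z *m u^T); split => //; exists u.
- rewrite (_ : @shilov R (CIII n) = [set z | exists (u : 'M[C]_n) (v : 'M[C]_0),
     [/\ unitary u, unitary v, True & z = u *m frame_sum R (CIII n) *m u^T]]).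
    apply: (@unitary_param_meas (CIII n) n 0 (fun _ _ => True)
      (fun u v => u *m frame_sum R (CIII n) *m u^T)).
      by move=> P U V _ _; exact: closedT.
    move=> P U V hU hV; apply: mcontM; last exact: mcont_tr.
    by apply: mcontM => //; exact: mcont_cst.
  apply/seteqP; split => z; first by move=> [k [[u [hu ->]] ->]]; exists u, 0; split => //; exact: unitary0.
  by move=> [u [v [hu hv _ ->]]]; exists (fun z => u *m z *m u^T); split => //; exists u.
- pose Q (u : 'M[C]_1) (v : 'M[C]_n) := map_mx (@conjc R) v = v /\ \det v = 1.
  rewrite (_ : @shilov R (CIV n) = [set z | exists (u : 'M[C]_1) (v : 'M[C]_n),
     [/\ unitary u, unitary v, Q u v & z = u 0 0 *: (frame_sum R (CIV n) *m v^T)]]).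
    apply: (@unitary_param_meas (CIV n) 1 n Q
      (fun u v => u 0 0 *: (frame_sum R (CIV n) *m v^T))).
      move=> P U V hU hV.
      have c2 : closed [set p | \det (V p) = 1] by apply: closed_ceq; exact: ccont_det.
      suff c1 : closed [set p | map_mx (@conjc R) (V p) = V p] by exact: closedI c1 c2.
      rewrite (_ : [set p | _] = [set p | map_mx (@conjc R) (V p) + (-1) *: V p = 0]).
        apply: closed_meq => i j; under eq_fun do rewrite !mxE.
        apply: ccontD; first by apply: ccontJ; exact: hV.
        by apply: ccontM; [exact: ccont_cst|exact: hV].
      apply/seteqP; split => p /=; rewrite scaleN1r; first by move=> ->; rewrite subrr.
      by move/eqP; rewrite subr_eq0 => /eqP.
    move=> P U V hU hV; apply: mcontZ; first exact: hU.
    by apply: mcontM; [exact: mcont_cst|exact: mcont_tr].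
  have rcE (o : 'M[R]_n) : rcast o = map_mx (real_complex R) o by [].
  have adjr (o : 'M[R]_n) : adjmx (rcast o) = map_mx (real_complex R) o^T.
    by apply/matrixP => i j; rewrite !mxE /conjc oppr0.
  apply/seteqP; split => z.
    move=> [k [[c [q [hc [ho [hd ->]]]]] ->]]; exists (c%:M), (rcast q); split.
    + rewrite /unitary; apply/matrixP => i j; rewrite !mxE big_ord1 !mxE !ord1 eqxx !mulr1n.
      exact: hc.
    + by rewrite /unitary adjr rcE -map_mxM ho map_mx1.
    + split; first by apply/matrixP => i j; rewrite !mxE /conjc oppr0.
      by rewrite rcE det_map_mx hd rmorph1.
    + by rewrite mxE eqxx mulr1n.
  move=> [u [v [hu hv [vr vd] ->]]].
  pose q : 'M[R]_n := map_mx (@complex.Re R) v.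
  have vq : v = rcast q.
    apply/matrixP => i j; rewrite !mxE.
    have := congr1 (fun M : 'M[C]_n => M i j) vr; rewrite !mxE /conjc.
    case: (v i j) => x y [e] /=; congr Complex; lra.
  exists (fun z => u 0 0 *: (z *m (rcast q)^T)); split; last by rewrite vq.
  exists (u 0 0), q; split; last split; last split => //.
  + by have := congr1 (fun M : 'M[C]_1 => M 0 0) hu; rewrite !mxE big_ord1 !mxE eqxx.
  + apply: (map_mx_inj (f := real_complex R)); rewrite map_mxM map_mx1 -adjr -rcE -vq.
    exact: hv.
  + by apply: (@complexI R); rewrite -det_map_mx -rcE -vq vd rmorph1.
Qed.

End ShilovMeasurable.

Theorem theorem3p4 (R : realType) (D : cartan) (hD : cartan_valid D)
  (mu : probability (Cspace R D) R)
  (mu_shilov : mu (~` (@shilov R D : set (Cspace R D))) = 0%E)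
  (mu_inv : forall k : cmx R D -> cmx R D, inK k ->
     forall A : set (Cspace R D), measurable A -> mu (k @^-1` A) = mu A)
  (N : nat -> nat) (psi : forall l : nat, 'I_(N l) -> cmx R D -> R[i])
  (psi_hom : forall l, (1 <= l <= crank D)%N -> forall a, homog_poly l (psi l a))
  (psi_ker : forall l, (1 <= l <= crank D)%N -> forall z w : cmx R D,
     inV z -> inV w -> \sum_(a < N l) psi l a z * conjc (psi l a w) = jdelta_l l z w)
  (X : (Cspace R D -> R[i]) -> (Cspace R D -> R[i]))
  (hX : bounded_op_H2 mu X) :
  is_toeplitz mu X <->
  (forall l, (1 <= l <= crank D)%N ->
     forall f g, isH2 mu f -> isH2 mu g ->
       \sum_(a < N l) inner mu (X (fun x => psi l a x * f x)) (fun x => psi l a x * g x)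
       = ('C(crank D, l))%:R * inner mu (X f) g).
Proof.
pose S : set (Cspace R D) := @shilov R D.
have aeS : {ae mu, forall x, S x}.
  exists (~` S); split => //; first by apply: measurableC; exact: shilov_measurable.
have r0 : (0 < crank D)%N.
  by case: D hD {mu mu_shilov mu_inv psi psi_hom psi_ker X hX S aeS} => [n m []|n|n|n] //= n2; rewrite half_gt0.
have psi_poly l : (1 <= l <= crank D)%N -> forall a, is_polyfun (psi l a).
  by move=> hl a; case: (psi_hom l hl a).
have psi_sum l : (1 <= l <= crank D)%N -> forall x, S x ->
    \sum_(a < N l) psi l a x * conjc (psi l a x) = ('C(crank D, l))%:R.
  move=> hl x Sx; have xV := shilov_inV Sx.
  by rewrite psi_ker // shilov_jdelta.
have psi_coord i j : exists c : 'I_(N 1) -> R[i], forall x : Cspace R D, S x ->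
    x i j = \sum_(k < N 1) c k * psi 1%N k x.
  have [H|[w [c [wV c0 H]]]] := jdelta1_coord R i j.
    exists (fun=> 0) => x Sx; rewrite H; last exact: shilov_inV.
    by rewrite big1 // => k _; rewrite mul0r.
  exists (fun k => c^-1 * conjc (psi 1%N k w)) => x Sx; have xV := shilov_inV Sx.
  apply: (mulfI c0); rewrite -H // -psi_ker // mulr_sumr; apply: eq_bigr => k _.
  by rewrite !mulrA divff // mul1r mulrC.
split; first exact: (toeplitz_identities aeS r0 psi_poly psi_sum psi_coord hX).
move=> H; apply: (identities_toeplitz aeS r0 psi_poly psi_sum psi_coord hX) => f g hf hg.
by rewrite H ?bin1.
Qed.
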